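(* Let $\{\tilde\theta_n\}$ be defined by $\tilde\theta_{n+1}=\tilde\theta_n+\alpha_{n+1}[A\tilde\theta_n+\Delta_{n+1}]$, $n\ge 0$, under assumptions (A1)–(A3) of the context. Then: (i) If $\mathrm{Real}(\lambda)<-\tfrac12$ for every eigenvalue $\lambda$ of $A$, then for some $\delta=\delta(A,\Sigma_\Delta)>0$, $$\mathrm{Cov}(\theta_n)=n^{-1}\Sigma_\theta+O(n^{-1-\delta}),\qquad n\ge 1,$$ where $\Sigma_\theta\ge 0$ is the solution to the Lyapunov equation $$[\tfrac12 I+A]\Sigma+\Sigma[\tfrac12 I+A]^{\top}+\Sigma_\Delta=0 .$$ Consequently, the rate of convergence of $\mathsf E[\|\tilde\theta_n\|^2]$ to zero is $1/n$. (ii) Suppose there is an eigenvalue $\lambda$ of $A$ that satisfies $-\varrho_0=\mathrm{Real}(\lambda)>-\tfrac12$. Let $v\ne 0$ denote a corresponding left eigenvector ($v^{\top}A=\lambda v^{\top}$), and suppose that $\Sigma_\Delta v\neq 0$. Then $\mathsf E[|v^{\top}\tilde\theta_n|^2]$ converges to $0$ at rate $n^{-2\varrho_0}$.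
   Context: Let $\mathsf Z$ be a Polish space and $V:\mathsf Z\to[1,\infty)$ a measurable function. For measurable $g:\mathsf Z\to\mathbb R$ put $\|g\|_V=\sup_{z}|g(z)|/V(z)$, and let $L_\infty^V$ be the set of measurable $g$ with $\|g\|_V<\infty$. (A1) $\{\Phi_n\}_{n\ge0}$ is a time-homogeneous Markov chain on $\mathsf Z$ that is $V$-uniformly ergodic with unique invariant measure $\pi$: there are $\rho\in(0,1)$ and $B_V<\infty$ such that for all $g\in L_\infty^V$, $z\in\mathsf Z$, $n\ge 0$, $|\mathsf E[g(\Phi_n)\mid\Phi_0=z]-\pi(g)|\le B_V\|g\|_V\rho^nV(z)$, where $\pi(g)=\int g\,d\pi$. (A2) $A$ is a real $d\times d$ Hurwitz matrix (all eigenvalues have strictly negative real part), and $\alpha_n=1/n$ for $n\ge1$. (A3) $f^*:\mathsf Z\to\mathbb R^d$ is measurable with $\|(f_i^* )^2\|_V<\infty$ and $\pi(f_i^* )=0$ for each $i$. Put $\Delta_n=f^*(\Phi_n)$ and $\Sigma_\Delta=\sum_{k=-\infty}^{\infty}\mathsf E_\pi[\Delta_k\Delta_0^{\top}]$, where $\mathsf E_\pi$ is expectation for the (two-sided) stationary version of the chain. The initial condition $(\Phi_0,\tilde\theta_0)$ is fixed (deterministic), with $\tilde\theta_0\in\mathbb R^d$, and $\mathrm{Cov}(\theta_n)=\mathsf E[\tilde\theta_n\tilde\theta_n^{\top}]$. A deterministic (scalar- or vector-valued) sequence $\{e_n\}$ is said to converge to zero at rate $1/n^{\varrho_1}$ if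 $\lim_{n\to\infty}n^{\varrho}\|e_n\|=0$ for every $\varrho<\varrho_1$ and $\lim_{n\to\infty}n^{\varrho}\|e_n\|=\infty$ for every $\varrho>\varrho_1$.
   Formalization: The rate 1/n of E‖θ̃_n‖² in (i) is stated only for Σ_Δ ≠ 0; if Σ_Δ = 0 (e.g. f* = 0) then Σ_θ = 0 and E‖θ̃_n‖² = O(n^{-1-δ}), so the claimed rate fails. *)

(* Defs.v *)
From HB Require Import structures.
From mathcomp Require Import all_boot all_order all_algebra.
From mathcomp Require Import all_classical all_reals all_analysis.
From mathcomp Require Import complex.

Set Implicit Arguments.
Unset Strict Implicit.
Unset Printing Implicit Defensive.

Import Order.TTheory GRing.Theory Num.Theory.
Import numFieldNormedType.Exports.

Local Open Scope classical_set_scope.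
Local Open Scope ring_scope.

Definition polish (R : realType) (Z : topologicalType) : Prop :=
  (exists2 D : set Z, countable D & dense D) /\
  exists dist : Z -> Z -> R,
    [/\ [/\ forall x y, 0 <= dist x y,
            forall x y, dist x y = 0 <-> x = y,
            forall x y, dist x y = dist y x &
            forall x y z, dist x z <= dist x y + dist y z],
        forall (x : Z) (U : set Z),
          nbhs x U <-> exists2 e : R, 0 < e & [set y | dist x y < e] `<=` U &
        forall u : nat -> Z,
          (forall e : R, 0 < e -> exists N, forall m n,
             (N <= m)%N -> (N <= n)%N -> dist (u m) (u n) < e) ->
          exists l : Z, u @ \oo --> l].

Notation borel Z := (g_sigma_algebraType (@open Z)).

Section weighted_norm.
Context {d : measure_display} {Z : measurableType d} {R : realType}.
Local Open Scope ereal_scope.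

Definition Vnorm (V g : Z -> R) : \bar R :=
  ereal_sup (range (fun z => (`|g z| / V z)%:E)).

Definition LVinfty (V g : Z -> R) : Prop :=
  measurable_fun setT g /\ Vnorm V g < +oo.

End weighted_norm.

Section markov.
Context {d : measure_display} {Z : measurableType d} {R : realType}.
Local Open Scope ereal_scope.

(* [nstep P n z] is the law of Phi_n given Phi_0 = z. *)
Fixpoint nstep (P : R.-pker Z ~> Z) (n : nat) : R.-spker Z ~> Z :=
  if n is m.+1 then mkcomp_noparam (nstep P m) P
  else kdirac (@measurable_id _ Z setT).

Definition invariant_law (P : R.-pker Z ~> Z) (pi : probability Z R) : Prop :=
  forall B, measurable B -> \int[pi]_z P z B = pi B.

Definition unique_invariant_law (P : R.-pker Z ~> Z) (pi : probability Z R) :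
    Prop :=
  invariant_law P pi /\
  forall pi' : probability Z R, invariant_law P pi' ->
    forall B, measurable B -> pi' B = pi B.

(* The inequality is between extended reals, where +oo - +oo = -oo has absolute
   value +oo; taking g = V, it therefore also says that V is integrable with
   respect to pi and to every P^n(z, .). *)
Definition V_uniformly_ergodic (V : Z -> R) (P : R.-pker Z ~> Z)
    (pi : probability Z R) : Prop :=
  exists rho B : R, [/\ (0 < rho)%R, (rho < 1)%R &
    forall g, LVinfty V g -> forall z n,
      `| \int[nstep P n z]_y (g y)%:E - \int[pi]_y (g y)%:E |
        <= B%:E * Vnorm V g * (rho ^+ n * V z)%:E].

Context {dO : measure_display} {Omega : measurableType dO}.

(* The sigma-algebra generated by the X_i, i in J. *)
Definition sigma_of {I : Type} (X : I -> Omega -> Z) (J : set I) :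
    set (set Omega) :=
  <<s \bigcup_(i in J) preimage_set_system setT (X i) measurable >>.

(* Pr(X_t in B | sigma(X_i, i in J)) = P(X_s, B) almost surely, by the defining
   property of conditional expectation (s in J). *)
Definition markov_transition {I : Type} (Pr : probability Omega R)
    (P : R.-pker Z ~> Z) (X : I -> Omega -> Z) (J : set I) (s t : I) : Prop :=
  forall B C, measurable B -> sigma_of X J C ->
    Pr (C `&` X t @^-1` B) = \int[Pr]_(w in C) P (X s w) B.

Definition markov_chain (Pr : probability Omega R) (P : R.-pker Z ~> Z)
    (Phi : nat -> {mfun Omega >-> Z}) : Prop :=
  forall n : nat, markov_transition Pr P Phi [set i | (i <= n)%N] n n.+1.

Definition stationary_chain (Pr : probability Omega R) (P : R.-pker Z ~> Z)
    (pi : probability Z R) (Psi : int -> {mfun Omega >-> Z}) : Prop :=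
  (forall n : int,
     markov_transition Pr P Psi [set i | (i <= n)%R] n (n + 1)%R) /\
  (forall (n : int) B, measurable B -> Pr (Psi n @^-1` B) = pi B).

End markov.

(* Sum of a two-sided series: the one over k >= 0 plus the one over k <= -1. *)
Definition two_sided_sum {R : realType} (c : int -> R) : R :=
  limn (series (fun k : nat => c k%:Z)) +
  limn (series (fun k : nat => c (- (k.+1)%:Z))).

(* \sum_k E_pi[Delta_k Delta_0^T], with Delta_k = f (Psi_k). *)
Definition Sigma_Delta {R : realType} {d : nat} {dZ dO : measure_display}
    {Z : measurableType dZ} {Omega : measurableType dO}
    (Pr : probability Omega R) (Psi : int -> {mfun Omega >-> Z})
    (f : Z -> 'cV[R]_d) : 'M[R]_d :=
  \matrix_(i, j) two_sided_sum (fun k : int =>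
    fine ('E_Pr[fun w => (f (Psi k w) i 0 * f (Psi 0 w) j 0)%R])%E).

Section linear_SA.
Context {R : realType} {d : nat}.

Definition step_size (n : nat) : R := n%:R^-1.

Fixpoint linear_sa (A : 'M[R]_d) (Delta : nat -> 'cV[R]_d) (theta0 : 'cV[R]_d)
    (n : nat) : 'cV[R]_d :=
  if n is m.+1 then
    let theta := linear_sa A Delta theta0 m in
    theta + step_size m.+1 *: (A *m theta + Delta m.+1)
  else theta0.

Definition complexify (m n : nat) (M : 'M[R]_(m, n)) : 'M[R[i]]_(m, n) :=
  map_mx (real_complex R) M.

Definition hurwitz (A : 'M[R]_d) : Prop :=
  forall lambda : R[i], eigenvalue (complexify A) lambda ->
    complex.Re lambda < 0.

Definition possemidef (M : 'M[R]_d) : Prop :=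
  M^T = M /\ forall x : 'cV[R]_d, 0 <= (x^T *m M *m x) 0 0.

Definition lyapunov_eq (A S Sigma : 'M[R]_d) : Prop :=
  ((1 / 2)%:M + A) *m Sigma + Sigma *m ((1 / 2)%:M + A)^T + S = 0.

Definition sqnorm (x : 'cV[R]_d) : R := \sum_i x i 0 ^+ 2.

(* |v^T x|^2 *)
Definition sqmod_pairing (v : 'cV[R[i]]_d) (x : 'cV[R]_d) : R :=
  let z := (v^T *m complexify x) 0 0 in complex.Re z ^+ 2 + complex.Im z ^+ 2.

End linear_SA.

(* "e_n converges to zero at rate 1 / n^rho1". Expectations live in \bar R. *)
Definition converges_at_rate {R : realType} (e : nat -> \bar R) (rho1 : R) :
    Prop :=
  (forall rho : R, rho < rho1 ->
     ((n%:R `^ rho)%:E * `|e n|)%E @[n --> \oo] --> 0%E) /\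
  (forall rho : R, rho1 < rho ->
     ((n%:R `^ rho)%:E * `|e n|)%E @[n --> \oo] --> +oo%E).

(* Main.v *)
Require Import Defs.
From HB Require Import structures.
From mathcomp Require Import all_boot all_order all_algebra.
From mathcomp Require Import all_classical all_reals all_analysis.
From mathcomp Require Import measurable_realfun complex.
From mathcomp Require Import ring lra.

(** The theorem speaks of second moments only, and the proof follows the matrices
Y_n = E[theta_n theta_n^T] through deterministic recursions.

Ergodicity in the norm of sqrt V. If |g| <= c sqrt V, cut g at the height
T = r^n sqrt (V z), where r = sqrt rho. The bounded part contributes at most 2 T to
P^n g (z) - pi g because the measures have mass at most 1; the rest is at most
(c^2 / T) V, so V-uniform ergodicity makes its contribution a multiple of
rho^n V z / T = T. Hence P^n g (z) - pi g = O(r^n sqrt (V z)) [sqrt_decay].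

From the chain to moments. The Markov property and Cauchy-Schwarz turn this into
geometric decay in the lag: E[f(Phi_m) f(Phi_{m+k})^T] is within C r^(m+k) of the
stationary autocovariance R_k, and T_{n,k} = E[theta_n f(Phi_{n+k+1})^T] is bounded by
C r^k sqrt (tr Y_n). The two recursions that link Y, T and the lagged moments are
collected in [moment_data], which [linear_sa_moment_data] establishes.

Correcting the moments. With S_n = sum_k T_{n,k}, the matrices
U_n = Y_n + (S_n + S_n^T) / n satisfy
  U_{n+1} = G_n U_n G_n^T + Sigma_Delta / (n+1)^2 + O(sqrt (tr Y_n) + 1/n) / n^2
with G_n = I + A / (n+1): the recursion for T telescopes over the lags, and what is
left over is the sum of all autocovariances [corrected_moments].

Contraction. If the spectrum of A lies to the left of -c, then for some b > 2 c the maps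
M |-> G_n M G_n^T contract a suitable norm by the factor 1 - b / (n+1) + O(1/n^2): make
A triangular over the complex numbers and rescale the basis so that the entries off
the diagonal become small [contracting_normP]. Comparison with powers of n
[rate_upper] gives first tr Y_n = O(n^-e) for every e <= b, e < 1, and then, if b > 1,
U_n - Sigma / n = O(n^(-1-delta)) for the solution Sigma of the Lyapunov equation
[covariance_expansion]. This is part (i).

Part (ii). Write the left eigenvector as v = x + i y. The numbers
x^T U_n x + y^T U_n y obey a scalar recursion with factor
|1 + lambda / (n+1)|^2 = 1 - 2 rho0 / (n+1) + O(1/n^2) and forcing
(x^T Sigma_Delta x + y^T Sigma_Delta y) / (n+1)^2 up to o(n^-2). As 2 rho0 < 1, the
forcing is summable against the decay n^(-2 rho0), so that this rate is an upper
bound; as the forcing is positive, the sequence cannot vanish identically, so that the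
rate is also a lower bound [mode_rate]. Positivity requires Sigma_Delta to be positive
semidefinite. That is part (i) for A = -I, whose Lyapunov solution is Sigma_Delta
itself [possemidef_noise]. *)

Set Implicit Arguments.
Unset Strict Implicit.
Unset Printing Implicit Defensive.

Import Order.TTheory GRing.Theory Num.Theory.
Import numFieldNormedType.Exports.

Local Open Scope classical_set_scope.
Local Open Scope ring_scope.

(** * Comparison of scalar recursions with powers of n *)

Section rates.
Context {R : realType}.
Implicit Types (b s K : R) (x : nat -> R).

Lemma powR_natE (n : nat) b : (0 < n)%N -> (n%:R : R) `^ b = expR (b * ln n%:R).
Proof. by move=> n0; rewrite /powR pnatr_eq0 gtn_eqF. Qed.

Lemma ln_step_le (n : nat) : (0 < n)%N ->
  ln (n.+1%:R : R) - ln n%:R <= n%:R^-1.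
Proof.
move=> n0; have n0' : (0 : R) < n%:R by rewrite ltr0n.
rewrite -ln_div ?posrE ?ltr0n//.
have -> : n.+1%:R / n%:R = 1 + n%:R^-1 :> R.
  by rewrite -natr1 mulrDl divff ?gt_eqF// mul1r.
by apply: le_ln1Dx; rewrite (lt_trans (ltrN10 _))// invr_gt0.
Qed.

Lemma ln_step_ge (n : nat) : (0 < n)%N ->
  n.+1%:R^-1 <= ln (n.+1%:R : R) - ln n%:R.
Proof.
move=> n0; have n0' : (0 : R) < n%:R by rewrite ltr0n.
rewrite -lerN2 opprB -ln_div ?posrE ?ltr0n//.
have -> : n%:R / n.+1%:R = 1 - n.+1%:R^-1 :> R.
  by rewrite -[X in X / _](addrK 1) natr1 mulrBl divff ?pnatr_eq0// mul1r.
apply: le_ln1Dx; rewrite ltrN2 invf_lt1 ?ltr0n//.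
by rewrite ltr1n ltnS.
Qed.

(** A mean value bound for t^-eta on [n, n + 1]; summed over n, it controls the tails of
the series of n^(-1-eta). *)
Lemma powR_tail_telescope (eta : R) (n : nat) : 0 < eta -> (0 < n)%N ->
  eta * n.+1%:R `^ (- (1 + eta)) <= n%:R `^ (- eta) - n.+1%:R `^ (- eta).
Proof.
move=> eta0 n0.
have -> : - (1 + eta) = - eta - 1 by ring.
rewrite powRD; last by rewrite pnatr_eq0 implybT.
rewrite powR_inv1 ?ler0n//.
have -> : (n%:R : R) `^ (- eta) =
    n.+1%:R `^ (- eta) * expR (eta * (ln n.+1%:R - ln n%:R)).
  by rewrite !powR_natE// -expRD; congr expR; ring.
set p := _ `^ _; have p0 : 0 <= p by exact: powR_ge0.
rewrite -[X in _ - X]mulr1 -mulrBr mulrCA ler_wpM2l//.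
rewrite lerBrDl (le_trans _ (expR_ge1Dx _))// lerD2l ler_wpM2l ?(ltW eta0)//.
exact: ln_step_ge.
Qed.

(** The factor 1 - b/n shrinks like n^-b, and the source n^(-1-s) is summable after
multiplication by n^b because b < s. The proof makes this exact: exp((K + b)/n) n^b x_n
grows by at most a constant times n^(-1-(s-b)), and adding a multiple of n^-(s-b)
turns it into a nonincreasing sequence. *)
Lemma rate_upper b s K x : 0 <= b -> b < s -> 0 <= K ->
  (forall n, (0 < n)%N -> 0 <= x n) ->
  (forall n, (0 < n)%N ->
     x n.+1 <= (1 - b / n.+1%:R + K / n.+1%:R ^+ 2) * x n
               + K * n.+1%:R `^ (- (1 + s))) ->
  exists2 C : R, 0 <= C & forall n, (0 < n)%N -> x n <= C * n%:R `^ (- b).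
Proof.
move=> b0 bs K0 x0 rec.
(* 1/n - 1/(n+1) = 1/(n (n+1)) controls both K/(n+1)^2 and the error b/n - b/(n+1)
   of the comparison of n^b with a product, hence the constant K + b *)
pose K2 := K + b; have K20 : 0 <= K2 by rewrite addr_ge0.
pose eta := s - b; have eta0 : 0 < eta by rewrite subr_gt0.
pose g n := expR (K2 / n%:R) * n%:R `^ b * x n.
pose D := K * expR K2 / eta.
have D0 : 0 <= D by rewrite !mulr_ge0 ?expR_ge0 ?invr_ge0// ltW.
pose h n := g n + D * n%:R `^ (- eta).
have hS n : (0 < n)%N -> h n.+1 <= h n.
  move=> n0; rewrite /h -lerBrDr -addrA -mulrBr.
  have n1 : (0 : R) < n%:R by rewrite ltr0n.
  have n2 : (0 : R) < n.+1%:R by rewrite ltr0n.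
  apply: (@le_trans _ _ (g n + D * (eta * n.+1%:R `^ (- (1 + eta))))); last first.
    by rewrite lerD2l ler_wpM2l// powR_tail_telescope.
  rewrite /g; set P := _ * _ `^ b.
  have P0 : 0 <= P by rewrite mulr_ge0 ?expR_ge0 ?powR_ge0.
  apply: (le_trans (ler_wpM2l P0 (rec _ n0))).
  rewrite mulrDr lerD//.
    rewrite mulrA ler_wpM2r ?x0//.
    set q := 1 - _ + _.
    have qE : q <= expR (- (b / n.+1%:R) + K / n.+1%:R ^+ 2).
      by rewrite (le_trans _ (expR_ge1Dx _))// /q addrA.
    apply: (le_trans (ler_wpM2l P0 qE)).
    rewrite /P !powR_natE// -!expRD ler_expR.
    have l1 : b * (ln n.+1%:R - ln n%:R) <= b / n%:R.
      by rewrite ler_wpM2l// ln_step_le.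
    suff : K2 / n.+1%:R + b / n%:R - b / n.+1%:R + K / n.+1%:R ^+ 2 <= K2 / n%:R.
      move: l1; rewrite mulrBr -subr_ge0 => l1; rewrite -subr_ge0 => l2.
      by rewrite -subr_ge0; have := addr_ge0 l1 l2; congr (0 <= _); ring.
    have e : n%:R^-1 - n.+1%:R^-1 = n%:R^-1 * n.+1%:R^-1 :> R.
      rewrite -natr1; field; rewrite natr1 !gt_eqF//.
    have l2 : K / n.+1%:R ^+ 2 <= K * (n%:R^-1 * n.+1%:R^-1).
      rewrite ler_wpM2l// expr2 invfM ler_wpM2r ?invr_ge0 ?ltW//.
      by rewrite ltf_pV2 ?posrE// ltr_nat.
    rewrite -e -subr_ge0 in l2; rewrite /K2 -subr_ge0.
    by move: l2; congr (0 <= _); ring.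
  have DE : D * eta = K * expR K2 by rewrite /D mulfVK// gt_eqF.
  rewrite [leRHS]mulrA DE -mulrA mulrCA ler_wpM2l//.
  have -> : - (1 + s) = - b - (1 + eta) by rewrite /eta; ring.
  rewrite powRD; last by rewrite pnatr_eq0 implybT.
  rewrite [X in X <= _]mulrA ler_wpM2r ?powR_ge0// /P -mulrA -powRD ?pnatr_eq0 ?implybT//.
  rewrite subrr powRr0 mulr1 ler_expR ler_pdivrMr// ler_peMr//.
  by rewrite ler1n.
have h1 n : (0 < n)%N -> h n <= h 1%N.
  elim: n => // -[//|n] IH _; exact: le_trans (hS _ _) (IH _).
exists (h 1%N).
  by rewrite addr_ge0// mulr_ge0 ?powR_ge0 ?x0// mulr_ge0 ?expR_ge0 ?powR_ge0.
move=> n n0; apply: (@le_trans _ _ (g n * n%:R `^ (- b))); last first.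
  rewrite ler_wpM2r ?powR_ge0// (le_trans _ (h1 _ n0))//.
  by rewrite lerDl mulr_ge0 ?powR_ge0.
rewrite /g mulrAC -(mulrA (expR _)) -powRD ?subrr ?powRr0 ?mulr1; last first.
  by rewrite pnatr_eq0 -lt0n n0 implybT.
rewrite ler_peMl ?x0// -expR0 ler_expR divr_ge0//.
Qed.

(** By concavity of ln, 1 - b/(n+1) >= (n/(n+1))^b when b <= 1, so that n^b x_n is
nondecreasing. *)
Lemma rate_lower b (N : nat) x : 0 <= b <= 1 -> (0 < N)%N ->
  (forall n, (N <= n)%N -> (1 - b / n.+1%:R) * x n <= x n.+1) ->
  0 < x N ->
  exists2 c : R, 0 < c & forall n, (N <= n)%N -> c * n%:R `^ (- b) <= x n.
Proof.
move=> /andP[b0 b1] N0 rec xN.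
exists (N%:R `^ b * x N); first by rewrite mulr_gt0// powR_gt0// ltr0n.
elim=> [|n IH]; first by rewrite leqn0 => /eqP NE; rewrite NE in N0.
rewrite leq_eqVlt => /predU1P[<-|].
  rewrite mulrAC -powRD ?subrr ?powRr0 ?mul1r//.
  by rewrite pnatr_eq0 -lt0n N0 implybT.
rewrite ltnS => Nn; apply: le_trans (rec _ Nn).
have n0 : (0 < n)%N by exact: leq_trans Nn.
have n1 : (0 : R) < n%:R by rewrite ltr0n.
have n2 : (0 : R) < n.+1%:R by rewrite ltr0n.
have t01 : 0 <= 1 - b / n.+1%:R.
  rewrite subr_ge0 ler_pdivrMr// mul1r (le_trans b1)// ler1n//.
apply: le_trans (ler_wpM2l t01 (IH Nn)).
set p := N%:R `^ b * x N; have p0 : 0 <= p by rewrite mulr_ge0 ?powR_ge0 ?ltW.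
rewrite mulrCA ler_wpM2l//.
have [->|bn0] := eqVneq b 0.
  by rewrite mul0r subr0 mul1r oppr0 !powRr0.
have tp : 0 < 1 - b / n.+1%:R.
  by rewrite subr_gt0 ltr_pdivrMr// mul1r (le_lt_trans b1)// ltr1n ltnS.
suff : b * (ln n%:R - ln n.+1%:R) <= ln (1 - b / n.+1%:R).
  rewrite -ler_expR lnK ?posrE// => e.
  apply: le_trans (ler_wpM2r (powR_ge0 _ _) e).
  by rewrite !powR_natE// -expRD ler_expR; lra.
have q0 : 0 < n%:R / n.+1%:R :> R by rewrite divr_gt0.
have := @concave_ln R (Itv01 b0 b1) (n%:R / n.+1%:R) 1 q0 ltr01.
rewrite !convRE/= ln1 !mulr0 !addr0 ln_div ?posrE// mulr1.
suff -> : b * (n%:R / n.+1%:R) + (1 - b) = 1 - b / n.+1%:R by [].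
by rewrite -natr1; field; rewrite natr1 gt_eqF.
Qed.

End rates.

(** * A norm contracted by the Euler steps *)

Section lyapunov_norm.
Context {R : realType}.
Local Notation C := R[i].
Local Notation nc := (@Normc.normc R).

Lemma nc_ge0 (z : C) : 0 <= nc z.
Proof. by case: z => a b /=; rewrite sqrtr_ge0. Qed.

Lemma nc_real (x : R) : nc x%:C%C = `|x|.
Proof. by rewrite /= expr0n/= addr0 sqrtr_sqr. Qed.

Lemma nc_sum (I : Type) (r : seq I) (P : pred I) (F : I -> C) :
  nc (\sum_(i <- r | P i) F i) <= \sum_(i <- r | P i) nc (F i).
Proof.
elim/big_ind2 : _ => [|x1 x2 y1 y2 h1 h2|//]; first by rewrite Normc.normc0.
by apply: le_trans (le_normcD _ _) _; rewrite lerD.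
Qed.

(** From sqrt s <= (1 + s)/2 with s = |1 + a l|^2. The linear term is Re l, hence an
Euler step is a contraction to first order when Re l < 0. *)
Lemma nc_euler (l : C) (a : R) :
  nc (1 + a%:C%C * l) <=
  1 + a * complex.Re l + a ^+ 2 * (complex.Re l ^+ 2 + complex.Im l ^+ 2) / 2.
Proof.
case: l => x y.
have -> : nc (1 + a%:C%C * (x +i* y)%C) = Num.sqrt ((1 + a * x) ^+ 2 + (a * y) ^+ 2).
  by congr (Num.sqrt (_ ^+ 2 + _ ^+ 2)); rewrite /= mul0r ?subr0 ?addr0 ?add0r.
rewrite /=; set s := _ + _ : R.
have s0 : 0 <= s by rewrite addr_ge0 ?sqr_ge0.
have := sqr_ge0 (Num.sqrt s - 1); rewrite sqrrB1 sqr_sqrtr//.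
rewrite /s; set q := Num.sqrt _; lra.
Qed.

(** In a basis that makes A lower triangular, conjugation by diag(eps^i) multiplies the
entry (i, j), j < i, by eps^(i-j) <= eps and keeps the eigenvalues on the diagonal. For
small eps the column sums of I + a A are then those of its diagonal, up to a small
multiple of a. *)
Lemma stable_coordinates (n : nat) (A : 'M[R]_n.+1) (c : R) :
  (forall l : C, eigenvalue (complexify A) l -> complex.Re l < - c) ->
  exists S Si : 'M[C]_n.+1, exists c' K : R,
    [/\ S *m Si = 1%:M, Si *m S = 1%:M, c < c', 0 <= K &
     forall a : R, 0 <= a -> forall j,
       \sum_i nc ((S *m complexify (1%:M + a *: A) *m Si) i j)
         <= 1 - c' * a + K * a ^+ 2].
Proof.
move=> hA.
have [P Pu /= Ptrig] := @Schur C n.+1 (complexify A) (ltn0Sn _).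
have Punit : P \in unitmx by exact: unitarymx_unit.
pose T := conjmx P (complexify A).
have TE : T = P *m complexify A *m invmx P by rewrite /T conjumx.
have Ttrig : is_trig_mx T by [].
have Tdiag j : complex.Re (T j j) < - c.
  apply: hA; apply: (@eigenvalue_conjmx _ _ _ P (complexify A)).
  - exact: stablemx_unit.
  - by rewrite row_free_unit.
  rewrite -[_ \in _]/(eigenvalue T (T j j)) eigenvalue_root_char char_poly_trig//.
  by rewrite (bigD1 j)//= rootM root_XsubC eqxx.
pose m := \big[Num.min/c + 1]_j (- complex.Re (T j j)).
have cm : c < m.
  rewrite /m; elim/big_ind : _ => [|x y xc yc|j _]; first by rewrite ltrDl.
    by rewrite lt_min xc yc.
  by rewrite ltrNr.
have Tm j : complex.Re (T j j) <= - m.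
  by rewrite lerNr /m (bigD1 j)//= ge_min lexx.
pose K0 := \sum_i \sum_j nc (T i j).
have K00 : 0 <= K0 by apply: sumr_ge0 => i _; apply: sumr_ge0 => j _; exact: nc_ge0.
(* half of the gap m - c is spent on the entries off the diagonal *)
pose eps := Num.min 1 ((m - c) / 2 / (1 + K0)).
have e0 : 0 < eps.
  by rewrite lt_min ltr01 !divr_gt0 ?subr_gt0// ltr_pwDl.
have e1 : eps <= 1 by rewrite ge_min lexx.
have eK : eps * K0 <= (m - c) / 2.
  apply: (@le_trans _ _ ((m - c) / 2 / (1 + K0) * (1 + K0))); last first.
    by rewrite mulfVK// gt_eqF// ltr_pwDl.
  by rewrite ler_pM// ?(ltW e0)// ?ge_min ?lexx ?orbT// lerDr.
pose W := diag_mx (\row_(i < n.+1) (eps ^+ i)%:C%C).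
pose Wi := diag_mx (\row_(i < n.+1) (eps ^- i)%:C%C).
have WWi : W *m Wi = 1%:M.
  apply/matrixP => i j; rewrite mul_diag_mx !mxE.
  case: eqP => [->|_]; last by rewrite !mulr0n mulr0.
  rewrite !mulr1n -rmorphM/= divff ?expf_neq0 ?gt_eqF//.
have WiW : Wi *m W = 1%:M by exact: mulmx1C.
pose B := W *m T *m Wi.
have BE i j : B i j = (eps ^+ i * eps ^- j)%:C%C * T i j.
  rewrite /B mul_mx_diag mul_diag_mx !mxE rmorphM/=; ring.
have Bnc i j : i != j -> nc (B i j) <= eps * nc (T i j).
  move=> ij; have [lt_ij|le_ji] := ltnP i j.
    rewrite BE (is_trig_mxP Ttrig _ _ lt_ij) mulr0 Normc.normc0//.
    by rewrite mulr_ge0 ?Normc.normc0// ltW.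
  have ji : (j < i)%N by rewrite ltn_neqAle le_ji andbT eq_sym.
  rewrite BE Normc.normcM nc_real ler_wpM2r ?nc_ge0//.
  rewrite ger0_norm; last by rewrite divr_ge0 ?exprn_ge0 ?ltW.
  rewrite -expfB// ler_iXnr//; [by rewrite subn_gt0|exact: ltW].
pose K1 := \sum_j (complex.Re (T j j) ^+ 2 + complex.Im (T j j) ^+ 2).
have K10 : 0 <= K1 by apply: sumr_ge0 => j _; rewrite addr_ge0 ?sqr_ge0.
exists (W *m P), (invmx P *m Wi), ((m + c) / 2), K1; split.
- by rewrite mulmxA -(mulmxA W) mulmxV// mulmx1.
- by rewrite mulmxA -(mulmxA (invmx P)) WiW mulmx1 mulVmx.
- by move: cm; lra.
- by [].
move=> a a0 j.
have GE : W *m P *m complexify (1%:M + a *: A) *m (invmx P *m Wi) =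
          1%:M + a%:C%C *: B.
  rewrite /complexify map_mxD map_scalar_mx/= map_mxZ/=.
  rewrite mulmxDr mulmx1 mulmxDl; congr (_ + _).
    by rewrite mulmxA -(mulmxA W) mulmxV// mulmx1.
  by rewrite /B TE -!scalemxAr -!scalemxAl !mulmxA.
have EB (B' : 'M[C]_n.+1) i k :
  (1%:M + a%:C%C *: B') i k = (i == k)%:R + a%:C%C * B' i k by rewrite !mxE.
rewrite GE (bigD1 j)//=.
have -> : (1%:M + a%:C%C *: B) j j = 1 + a%:C%C * T j j.
  by rewrite EB eqxx BE divff ?expf_neq0 ?gt_eqF// mul1r.
apply: (@le_trans _ _ (1 + a * complex.Re (T j j) + a ^+ 2 * K1 + a * (eps * K0))).
  apply: lerD.
    apply: le_trans (nc_euler _ _) _; rewrite lerD2l -mulrA ler_wpM2l ?sqr_ge0//.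
    have h : complex.Re (T j j) ^+ 2 + complex.Im (T j j) ^+ 2 <= K1.
      rewrite /K1 (bigD1 j)//= lerDl; apply: sumr_ge0 => k _.
      by rewrite addr_ge0 ?sqr_ge0.
    by move: h K10; lra.
  rewrite mulr_sumr mulr_sumr big_mkcond/=; apply: ler_sum => i _.
  have h0 : 0 <= a * (eps * \sum_j0 nc (T i j0)).
    by rewrite !mulr_ge0// ?(ltW e0)// sumr_ge0// => k _; exact: nc_ge0.
  case: ifPn => [ij|_ //].
  rewrite EB (negbTE ij) add0r Normc.normcM nc_real ger0_norm//.
  rewrite ler_wpM2l// (le_trans (Bnc _ _ ij))// ler_wpM2l ?(ltW e0)//.
  by rewrite (bigD1 j)//= lerDl sumr_ge0// => k _; exact: nc_ge0.
have h1 : a * complex.Re (T j j) <= a * - m by rewrite ler_wpM2l.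
have h2 : a * (eps * K0) <= a * ((m - c) / 2) by rewrite ler_wpM2l.
by move: h1 h2; nra.
Qed.


Definition nc_total (d : nat) (X : 'M[C]_d) : R := \sum_i \sum_j nc (X i j).

Lemma nc_total_ge0 (d : nat) (X : 'M[C]_d) : 0 <= nc_total X.
Proof. by apply: sumr_ge0 => i _; apply: sumr_ge0 => j _; exact: nc_ge0. Qed.

Lemma nc_le_total (d : nat) (X : 'M[C]_d) i j : nc (X i j) <= nc_total X.
Proof.
rewrite /nc_total (bigD1 i)//= (bigD1 j)//= -addrA lerDl addr_ge0//.
  by apply: sumr_ge0 => k _; exact: nc_ge0.
by apply: sumr_ge0 => k _; apply: sumr_ge0 => l _; exact: nc_ge0.
Qed.

Lemma col_le_total (d : nat) (X : 'M[C]_d) j : \sum_i nc (X i j) <= nc_total X.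
Proof.
apply: ler_sum => i _; rewrite (bigD1 j)//= lerDl.
by apply: sumr_ge0 => k _; exact: nc_ge0.
Qed.

(** Column sums bound the operator norm on l^1, and X acts once on each side. *)
Lemma nc_total_congruence (d : nat) (X Y : 'M[C]_d) (g : R) :
  (forall k, \sum_i nc (X i k) <= g) ->
  nc_total (X *m Y *m X^T) <= g ^+ 2 * nc_total Y.
Proof.
move=> Xg.
have XYX i j : nc ((X *m Y *m X^T) i j) <=
    \sum_l \sum_k nc (X i k) * (nc (Y k l) * nc (X j l)).
  rewrite mxE; apply: le_trans (nc_sum _ _ _) _; apply: ler_sum => l _.
  rewrite !mxE Normc.normcM.
  apply: le_trans (ler_wpM2r (nc_ge0 _) (nc_sum _ _ _)) _.
  by rewrite mulr_suml; apply: ler_sum => k _; rewrite Normc.normcM mulrA.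
apply: (@le_trans _ _ (\sum_i \sum_j \sum_l \sum_k
    nc (X i k) * (nc (Y k l) * nc (X j l)))).
  by apply: ler_sum => i _; apply: ler_sum => j _; exact: XYX.
have -> : \sum_i \sum_j \sum_l \sum_k nc (X i k) * (nc (Y k l) * nc (X j l)) =
    \sum_k \sum_l (\sum_i nc (X i k)) * (nc (Y k l) * \sum_j nc (X j l)).
  under eq_bigr do rewrite exchange_big.
  under eq_bigr do under eq_bigr do rewrite exchange_big.
  under eq_bigr do under eq_bigr do under eq_bigr do rewrite -mulr_sumr.
  under eq_bigr do under eq_bigr do under eq_bigr do rewrite -mulr_sumr.
  under eq_bigr do rewrite exchange_big.
  rewrite exchange_big/=; apply: eq_bigr => k _.
  by rewrite exchange_big/=; apply: eq_bigr => l _; rewrite mulr_suml.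
rewrite /nc_total mulr_sumr; apply: ler_sum => k _.
rewrite mulr_sumr; apply: ler_sum => l _.
have p0 m : 0 <= \sum_i nc (X i m) by apply: sumr_ge0 => i _; exact: nc_ge0.
rewrite expr2 -mulrA ler_pM ?mulr_ge0 ?nc_ge0 ?p0//.
by rewrite mulrC ler_wpM2r ?nc_ge0.
Qed.

(** The linear rate b is what matters; K absorbs the second-order term of the step and
the comparison with the entries. *)
Definition contracting_norm (d : nat) (A : 'M[R]_d) (b K : R)
    (nu : 'M[R]_d -> R) : Prop :=
  (forall M, 0 <= nu M) /\
  [/\
      forall M N, nu (M + N) <= nu M + nu N,
      forall t M, nu (t *: M) = `|t| * nu M,
      forall (M : 'M[R]_d) i j, `|M i j| <= K * nu M,
      forall M, nu M <= K * \sum_i \sum_j `|M i j| &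
      forall a M, 0 <= a <= 1 ->
        nu ((1%:M + a *: A) *m M *m (1%:M + a *: A)^T)
          <= (1 - b * a + K * a ^+ 2) * nu M].

(** The norm is the sum of the moduli of the entries of S M S^T, where S gives the
coordinates of [stable_coordinates]. The transpose, rather than the adjoint, is enough
because only moduli are used. Each side of M contributes the rate c' > c. *)
Lemma contracting_normP (d : nat) (A : 'M[R]_d) (c : R) : 0 <= c ->
  (forall l : C, eigenvalue (complexify A) l -> complex.Re l < - c) ->
  exists b K : R, exists nu : 'M[R]_d -> R,
    [/\ 2 * c < b, 0 <= K & contracting_norm A b K nu].
Proof.
case: d A => [|n] A c0 hA.
  (* in dimension 0 all entries and all norms vanish, and any b > 2 c will do *)
  exists (2 * c + 1), (2 * c + 1), (fun=> 0); split.
  - by rewrite ltrDl.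
  - by rewrite addr_ge0// mulr_ge0.
  split=> [//|]; split=> [M N|t M|M i|M|a M _]; rewrite ?addr0 ?mulr0//; first by case: i.
  by rewrite big_ord0 mulr0.
have [S [Si [c' [K0 [SSi SiS cc' K00 hG]]]]] := stable_coordinates hA.
pose nu (M : 'M[R]_n.+1) := nc_total (S *m complexify M *m S^T).
have c'0 : 0 <= c' by rewrite (le_trans c0)// ltW.
pose L1 := nc_total S; pose L2 := nc_total Si.
pose K1 := c' ^+ 2 + 2 * K0 + K0 ^+ 2.
pose K := L1 ^+ 2 + L2 ^+ 2 + K1.
have K10 : 0 <= K1 by rewrite /K1 !addr_ge0 ?sqr_ge0 ?mulr_ge0.
have nu0 M : 0 <= nu M by exact: nc_total_ge0.
have mapM (M N : 'M[R]_n.+1) : complexify (M *m N) = complexify M *m complexify N.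
  exact: map_mxM.
exists (2 * c'), K, nu; split.
- by rewrite ltr_pM2l.
- by rewrite /K addr_ge0// addr_ge0 ?sqr_ge0.
split=> //; split.
- move=> M N; rewrite /nu /complexify map_mxD mulmxDr mulmxDl /nc_total -big_split/=.
  apply: ler_sum => i _; rewrite -big_split/=; apply: ler_sum => j _.
  by rewrite mxE le_normcD.
- move=> t M; rewrite /nu /complexify map_mxZ/= -scalemxAr -scalemxAl /nc_total.
  rewrite mulr_sumr; apply: eq_bigr => i _; rewrite mulr_sumr; apply: eq_bigr => j _.
  by rewrite mxE Normc.normcM nc_real.
- move=> M i j.
  apply: (@le_trans _ _ (L2 ^+ 2 * nu M)); last first.
    by rewrite ler_wpM2r// /K addrAC lerDr addr_ge0 ?sqr_ge0.
  have -> : `|M i j| = nc (complexify M i j) by rewrite mxE nc_real.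
  apply: le_trans (nc_le_total _ _ _) _.
  have -> : complexify M = Si *m (S *m complexify M *m S^T) *m Si^T.
    rewrite !mulmxA SiS mul1mx -mulmxA -trmx_mul SiS trmx1 mulmx1//.
  by apply: nc_total_congruence => k; exact: col_le_total.
- move=> M; apply: (@le_trans _ _ (L1 ^+ 2 * nc_total (complexify M))).
    by apply: nc_total_congruence => k; exact: col_le_total.
  have -> : nc_total (complexify M) = \sum_i \sum_j `|M i j|.
    by apply: eq_bigr => i _; apply: eq_bigr => j _; rewrite mxE nc_real.
  rewrite ler_wpM2r//; last by rewrite /K -addrA lerDl addr_ge0 ?sqr_ge0.
  by apply: sumr_ge0 => i _; apply: sumr_ge0 => j _.
move=> a M /andP[a0 a1].
pose G := S *m complexify (1%:M + a *: A) *m Si.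
have -> : nu ((1%:M + a *: A) *m M *m (1%:M + a *: A)^T) =
    nc_total (G *m (S *m complexify M *m S^T) *m G^T).
  congr nc_total; rewrite !mapM /G !trmx_mul.
  have -> : complexify (1%:M + a *: A)^T = (complexify (1%:M + a *: A))^T.
    by rewrite /complexify map_trmx.
  set H := complexify (_ + _).
  rewrite -!mulmxA (mulmxA Si) SiS mul1mx; congr (_ *m (_ *m (_ *m _))).
  by rewrite (mulmxA S^T) -(trmx_mul Si) SiS trmx1 mul1mx.
apply: le_trans (nc_total_congruence _ (hG a a0)) _.
rewrite ler_wpM2r ?nc_total_ge0//.
have K1K : K1 <= K by rewrite /K lerDr addr_ge0 ?sqr_ge0.
have a2 : 0 <= a ^+ 2 by exact: sqr_ge0.
apply: (@le_trans _ _ (1 - 2 * c' * a + K1 * a ^+ 2)); last first.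
  by rewrite lerD2l ler_wpM2r.
have h3 : 0 <= c' * K0 * a ^+ 2 * a by rewrite !mulr_ge0.
have h4 : 0 <= K0 ^+ 2 * a ^+ 2 * (1 - a ^+ 2).
  by rewrite !mulr_ge0 ?sqr_ge0// subr_ge0 expr_le1.
rewrite /K1 -subr_ge0.
apply: le_trans (addr_ge0 (addr_ge0 h3 h3) h4) _.
by rewrite le_eqVlt; apply/orP; left; apply/eqP; ring.
Qed.

End lyapunov_norm.

(** * Entrywise norm and matrix series *)

Section entry_norm.
Context {R : realType} {d : nat}.
Implicit Types M N : 'M[R]_d.

Definition entry_norm M : R := \sum_i \sum_j `|M i j|.

Lemma entry_norm_ge0 M : 0 <= entry_norm M.
Proof. by apply: sumr_ge0 => i _; apply: sumr_ge0 => j _. Qed.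

Lemma entry_normD M N : entry_norm (M + N) <= entry_norm M + entry_norm N.
Proof.
rewrite /entry_norm -big_split/=; apply: ler_sum => i _.
by rewrite -big_split/=; apply: ler_sum => j _; rewrite mxE ler_normD.
Qed.

Lemma entry_normZ t M : entry_norm (t *: M) = `|t| * entry_norm M.
Proof.
rewrite /entry_norm mulr_sumr; apply: eq_bigr => i _.
by rewrite mulr_sumr; apply: eq_bigr => j _; rewrite mxE normrM.
Qed.

Lemma entry_normN M : entry_norm (- M) = entry_norm M.
Proof. by rewrite -scaleN1r entry_normZ normrN1 mul1r. Qed.

Lemma entry_normT M : entry_norm M^T = entry_norm M.
Proof.
rewrite /entry_norm exchange_big/=; apply: eq_bigr => i _.
by apply: eq_bigr => j _; rewrite mxE.
Qed.

Lemma entry_normM M N : entry_norm (M *m N) <= entry_norm M * entry_norm N.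
Proof.
rewrite /entry_norm mulr_suml; apply: ler_sum => i _.
apply: (@le_trans _ _ (\sum_j \sum_k `|M i k| * `|N k j|)).
  apply: ler_sum => j _; rewrite mxE; apply: le_trans (ler_norm_sum _ _ _) _.
  by apply: ler_sum => k _; rewrite normrM.
rewrite exchange_big/= mulr_suml; apply: ler_sum => k _.
rewrite -mulr_sumr ler_wpM2l// [leRHS](bigD1 k)//= lerDl.
by apply: sumr_ge0 => l _; apply: sumr_ge0 => j _.
Qed.

Lemma le_entry_norm M i j : `|M i j| <= entry_norm M.
Proof.
rewrite /entry_norm [leRHS](bigD1 i)//= [X in _ <= X + _](bigD1 j)//= -addrA lerDl addr_ge0//.
  exact: sumr_ge0.
by apply: sumr_ge0 => k _; exact: sumr_ge0.
Qed.

Lemma entry_norm_le M (e : R) : (forall i j, `|M i j| <= e) ->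
  entry_norm M <= (d * d)%:R * e.
Proof.
move=> h; apply: (@le_trans _ _ (\sum_(i < d) \sum_(j < d) e)).
  by apply: ler_sum => i _; apply: ler_sum => j _; exact: h.
by rewrite !sumr_const !card_ord -mulrnA mulr_natl.
Qed.

Lemma mxtrace_le_entry_norm M : \tr M <= entry_norm M.
Proof.
apply: ler_sum => i _; rewrite (bigD1 i)//= (le_trans (ler_norm _))// lerDl.
exact: sumr_ge0.
Qed.

End entry_norm.

Section geometric_series.
Context {R : realType}.
Implicit Types u v : nat -> R.

Lemma geometric_bound_cvg u (C r : R) : 0 <= r < 1 ->
  (forall k, `|u k| <= C * r ^+ k) ->
  cvgn (series u) /\ `|limn (series u)| <= C / (1 - r).
Proof.
move=> /andP[r0 r1] ur.
have rn : `|r| < 1 by rewrite ger0_norm.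
have cg : cvgn (series (geometric C r)) by exact: is_cvg_geometric_series.
have cn : cvgn [normed series u].
  apply: (series_le_cvg _ _ _ cg) => n //=.
  exact: le_trans (ur n).
split; first exact: (@normed_cvg R R^o).
apply: le_trans (@lim_series_norm R R^o _ cn) _.
rewrite -(cvg_lim _ (@cvg_geometric_series R C r rn))//.
by apply: lim_series_le => // n; exact: ur.
Qed.

(** Removal of the first term, which is how the lag recursion telescopes. *)
Lemma lim_series_recl u : cvgn (series u) ->
  cvgn (series (fun k => u k.+1)) /\
  limn (series u) = u 0%N + limn (series (fun k => u k.+1)).
Proof.
move=> cu.
have E : series (fun k => u k.+1) = (fun n => series u n.+1 - u 0%N).
  by apply/funext => n; rewrite /series/= big_nat_recl// addrAC subrr add0r.
have cl : series u n.+1 - u 0%N @[n --> \oo] --> limn (series u) - u 0%N.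
  by apply: cvgB; [rewrite cvg_shiftS|exact: cvg_cst].
rewrite E; split; first by apply/cvg_ex; exists (limn (series u) - u 0%N).
by rewrite (cvg_lim _ cl)// addrC subrK.
Qed.

End geometric_series.

Section matrix_series.
Context {R : realType} {d : nat}.
Implicit Types F H : nat -> 'M[R]_d.

Definition mx_series F : 'M[R]_d :=
  \matrix_(i, j) limn (series (fun k => F k i j)).

Definition geometric_mx (C r : R) F : Prop :=
  forall k i j, `|F k i j| <= C * r ^+ k.

Definition mx_summable F : Prop :=
  forall i j, cvgn (series (fun k => F k i j)).

Lemma geometric_mx_summable C r F : 0 <= r < 1 -> geometric_mx C r F ->
  mx_summable F /\
  entry_norm (mx_series F) <= (d * d)%:R * (C / (1 - r)).
Proof.
move=> r01 FC; split=> [i j|].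
  by have [] := geometric_bound_cvg r01 (fun k => FC k i j).
apply: entry_norm_le => i j; rewrite mxE.
by have [] := geometric_bound_cvg r01 (fun k => FC k i j).
Qed.

Lemma mx_series_recl F : mx_summable F ->
  mx_summable (fun k => F k.+1) /\
  mx_series F = F 0%N + mx_series (fun k => F k.+1).
Proof.
move=> sF; split=> [i j|]; first by have [] := lim_series_recl (sF i j).
by apply/matrixP => i j; rewrite !mxE; have [_ ->] := lim_series_recl (sF i j).
Qed.

Lemma mx_seriesD F H : mx_summable F -> mx_summable H ->
  mx_summable (fun k => F k + H k) /\
  mx_series (fun k => F k + H k) = mx_series F + mx_series H.
Proof.
move=> sF sH.
have E i j : series (fun k => (F k + H k) i j) =
    series (fun k => F k i j) + series (fun k => H k i j).
  by rewrite -seriesD; congr series; apply/funext => k; rewrite mxE.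
split=> [i j|]; first by rewrite E; exact: is_cvgD.
by apply/matrixP => i j; rewrite !mxE E limD.
Qed.

Lemma mx_seriesMl (G : 'M[R]_d) F : mx_summable F ->
  mx_summable (fun k => G *m F k) /\
  mx_series (fun k => G *m F k) = G *m mx_series F.
Proof.
move=> sF.
have E i j : series (fun k => (G *m F k) i j) =
    \sum_l (fun n => G i l * series (fun k => F k l j) n).
  apply/funext => n; rewrite /series/= fct_sumE.
  under eq_bigr do rewrite mxE; rewrite exchange_big/=.
  by apply: eq_bigr => l _; rewrite mulr_sumr.
have cl i j : (\sum_l (fun n => G i l * series (fun k => F k l j) n)) n @[n --> \oo]
    --> \sum_l G i l * limn (series (fun k => F k l j)).
  under eq_cvg do rewrite fct_sumE.
  apply: cvg_big => [|l _]; [exact: add_continuous|exact: cvgMr (sF _ _)].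
split=> [i j|]; first by rewrite E; apply/cvg_ex; eexists; exact: cl.
apply/matrixP => i j; rewrite mxE E (cvg_lim _ (cl i j))// mxE.
by apply: eq_bigr => l _; rewrite mxE.
Qed.

Lemma mx_seriesB F H : mx_summable F -> mx_summable H ->
  mx_summable (fun k => F k - H k) /\
  mx_series (fun k => F k - H k) = mx_series F - mx_series H.
Proof.
move=> sF sH; have [sN NE] := mx_seriesMl (- 1%:M) sH.
have -> : (fun k => F k - H k) = (fun k => F k + (- 1%:M) *m H k).
  by apply/funext => k; rewrite mulNmx mul1mx.
have [s ->] := mx_seriesD sF sN; split=> //.
by rewrite NE mulNmx mul1mx.
Qed.

End matrix_series.

(** * Moment recursions and their correction *)

Section moment_recursion.
Context {R : realType} {d : nat}.
Implicit Types (A Sg Sigma : 'M[R]_d).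

(** The step from n to n + 1 uses the step size 1 / (n + 1). *)
Definition euler_mx A (n : nat) : 'M[R]_d := 1%:M + n.+1%:R^-1 *: A.

(** What the deterministic analysis needs to know about the chain. For a chain with
noise D_k, T n k is E[theta_n D_{n+k+1}^T] (so lag k + 1), c m k is E[D_m D_{m+k}^T],
and Rk k is its stationary limit. *)
Definition moment_data A Sg (Y : nat -> 'M[R]_d) : Prop :=
  exists (T c : nat -> nat -> 'M[R]_d) (Rk : nat -> 'M[R]_d) (C r : R),
    [/\ 0 <= r < 1, 0 <= C,
        forall n, Y n.+1 = euler_mx A n *m Y n *m (euler_mx A n)^T
          + n.+1%:R^-1 *: (euler_mx A n *m T n 0%N + (euler_mx A n *m T n 0%N)^T)
          + n.+1%:R^-1 ^+ 2 *: c n.+1 0%N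
      & forall n k,
          T n.+1 k = euler_mx A n *m T n k.+1 + n.+1%:R^-1 *: c n.+1 k.+1] /\
    [/\ forall n, possemidef (Y n),
        forall n k i j, `|T n k i j| <= C * r ^+ k * Num.sqrt (\tr (Y n)),
        forall m k i j, `|c m k i j - Rk k i j| <= C * r ^+ (m + k),
        forall k i j, `|Rk k i j| <= C * r ^+ k
      & Sg = mx_series Rk + (mx_series (fun k => Rk k.+1))^T].

Lemma geometric_le_inv (r : R) (n : nat) : 0 <= r < 1 -> (0 < n)%N ->
  r ^+ n <= (1 - r)^-1 * n%:R^-1.
Proof.
move=> /andP[r0 r1] n0; have r1' : 0 < 1 - r by rewrite subr_gt0.
have h : n%:R * (1 - r) * r ^+ n <= 1 - r ^+ n.
  elim: n {n0} => [|n IH]; first by rewrite !mul0r expr0 subrr.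
  have rn : 0 <= r ^+ n by rewrite exprn_ge0.
  have rn1 : r ^+ n.+1 <= 1 by rewrite exprn_ile1// ltW.
  have := ler_wpM2l r0 IH.
  have : 0 <= (1 - r) * (1 - r ^+ n.+1) by rewrite mulr_ge0 ?subr_ge0// ltW.
  rewrite -natr1 exprS; nra.
have n1 : (0 : R) < n%:R by rewrite ltr0n.
rewrite -invfM -[leRHS]mul1r ler_pdivlMr ?mulr_gt0// mulrC (mulrC (1 - r)).
apply: le_trans h _; by rewrite lerBlDr lerDl exprn_ge0.
Qed.

(** The algebra behind [corrected_moments]: Y1 is G Y G^T, P is G S and PA is P A^T. The
hypothesis holds for q = 1/n and a = 1/(n+1), and makes the terms of order 1/n cancel. *)
Lemma defect_identity (q a : R) (Y1 P PA T0 c0 cs Sg : 'M[R]_d) :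
  a - q + q * a = 0 ->
  (Y1 + a *: (T0 + T0^T) + a ^+ 2 *: c0
    + a *: ((P - T0 + a *: cs) + (P - T0 + a *: cs)^T))
  - (Y1 + q *: ((P + a *: PA) + (P + a *: PA)^T)) - a ^+ 2 *: Sg
  = - (q * a) *: ((P + PA) + (P + PA)^T) + a ^+ 2 *: (c0 + cs + cs^T - Sg).
Proof.
move=> h; apply/matrixP => i j; rewrite !mxE.
apply/eqP; rewrite -subr_eq0; apply/eqP.
transitivity ((a - q + q * a) * (P i j + P j i)); last by rewrite h mul0r.
ring.
Qed.

(** Summing the recursion of T over all lags gives S_{n+1} = G S_n - G T_{n,0} + a s, with
s the sum of the noise moments of positive lag. Adding a (S + S^T) to Y thus removes
G T_{n,0} from the recursion of Y and brings in the noise moments of all lags, which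
add up to Sg. *)
Lemma corrected_moments A Sg Y : moment_data A Sg Y ->
  exists (U : nat -> 'M[R]_d) (K : R), 0 <= K /\ forall n, (0 < n)%N ->
    entry_norm (U n - Y n) <= K * (n%:R^-1 * Num.sqrt (\tr (Y n))) /\
    entry_norm (U n.+1 - euler_mx A n *m U n *m (euler_mx A n)^T
                - n.+1%:R^-1 ^+ 2 *: Sg)
      <= K * (n.+1%:R^-1 ^+ 2 * (Num.sqrt (\tr (Y n)) + n%:R^-1)).
Proof.
move=> [T [c [Rk [C [r [[r01 C0 recY recT] [_ hT hc hR hS]]]]]]].
have /andP[r0 r1] := r01.
have r1' : 0 < 1 - r by rewrite subr_gt0.
pose S n := mx_series (T n).
pose U n := Y n + n%:R^-1 *: (S n + (S n)^T).
pose D := (d * d)%:R * (C / (1 - r)).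
have D0 : 0 <= D by rewrite mulr_ge0// divr_ge0// ltW.
pose sq n := Num.sqrt (\tr (Y n)).
have sq0 n : 0 <= sq n by exact: sqrtr_ge0.
have gT n : geometric_mx (C * sq n) r (T n).
  by move=> k i j; rewrite mulrAC; exact: hT.
have sT n : mx_summable (T n) by have [] := geometric_mx_summable r01 (gT n).
have Sn n : entry_norm (S n) <= D * sq n.
  have [_ h] := geometric_mx_summable r01 (gT n).
  by apply: le_trans h _; rewrite le_eqVlt; apply/orP; left; apply/eqP; rewrite /D; ring.
have sR : mx_summable Rk by have [] := geometric_mx_summable r01 hR.
have gc n : geometric_mx (C * r ^+ n) r (fun k => c n k - Rk k).
  by move=> k i j; rewrite !mxE -mulrA -exprD; exact: hc.
have scR n : mx_summable (fun k => c n k - Rk k).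
  by have [] := geometric_mx_summable r01 (gc n).
have sc n : mx_summable (c n).
  have [+ _] := mx_seriesD (scR n) sR.
  by under eq_fun do rewrite subrK.
pose cs n := mx_series (fun k => c n k.+1).
have scS n : mx_summable (fun k => c n k.+1) by have [] := mx_series_recl (sc n).
have sRS : mx_summable (fun k => Rk k.+1) by have [] := mx_series_recl sR.
have hsum n : entry_norm (c n 0%N + cs n + (cs n)^T - Sg) <= 2 * D * r ^+ n.
  have -> : c n 0%N + cs n + (cs n)^T - Sg = mx_series (fun k => c n k - Rk k)
      + (mx_series (fun k => c n k.+1 - Rk k.+1))^T.
    have [_ ->] := mx_seriesB (sc n) sR; have [_ ->] := mx_seriesB (scS n) sRS.
    have [_ ->] := mx_series_recl (sc n).
    rewrite hS linearB/=; apply/matrixP => i j; rewrite !mxE; ring.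
  apply: le_trans (entry_normD _ _) _; rewrite entry_normT -mulrA mulr_natl mulr2n.
  have [_ h1] := geometric_mx_summable r01 (gc n).
  have gcS : geometric_mx (C * r ^+ n) r (fun k => c n k.+1 - Rk k.+1).
    move=> k i j; apply: le_trans (gc n k.+1 i j) _.
    rewrite exprS mulrCA ler_piMl ?(ltW r1)//.
    by rewrite !mulr_ge0 ?exprn_ge0.
  have [_ h2] := geometric_mx_summable r01 gcS.
  have DE : (d * d)%:R * (C * r ^+ n / (1 - r)) = D * r ^+ n.
    by rewrite /D; ring.
  by rewrite lerD// -DE.
pose g := entry_norm (1%:M : 'M[R]_d) + entry_norm A.
have g0 : 0 <= g by rewrite addr_ge0// entry_norm_ge0.
have gG n : entry_norm (euler_mx A n) <= g.
  apply: le_trans (entry_normD _ _) _; rewrite lerD2l entry_normZ.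
  rewrite ger0_norm ?invr_ge0// ler_piMl ?entry_norm_ge0//.
  by rewrite invf_le1// ler1n.
have gA : entry_norm (1%:M + A^T) <= g.
  by apply: le_trans (entry_normD _ _) _; rewrite entry_normT.
pose K := 2 * D + 4 * (g * g * D) + 2 * D * (1 - r)^-1.
have ggD : 0 <= g * g * D by rewrite mulr_ge0// mulr_ge0.
have DR : 0 <= 2 * D * (1 - r)^-1.
  by apply: mulr_ge0; [rewrite mulr_ge0|rewrite invr_ge0 ltW].
have K0 : 0 <= K by move: D0 ggD DR; rewrite /K; lra.
exists U, K; split=> // n n0.
have n1 : (0 : R) < n%:R by rewrite ltr0n.
have q0 : (0 : R) <= n%:R^-1 by rewrite invr_ge0.
split.
  rewrite /U addrC addKr entry_normZ ger0_norm// mulrCA ler_wpM2l//.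
  apply: le_trans (entry_normD _ _) _; rewrite entry_normT.
  apply: le_trans (lerD (Sn n) (Sn n)) _; rewrite -/(sq n).
  rewrite -mulrDl ler_wpM2r//.
  have : 0 <= 4 * (g * g * D) by rewrite mulr_ge0.
  by move: DR; rewrite /K; lra.
set a := n.+1%:R^-1; set q := n%:R^-1; set G := euler_mx A n.
have a0 : 0 <= a by rewrite invr_ge0.
have aq : a - q + q * a = 0.
  by rewrite /a /q -natr1; field; rewrite natr1 !gt_eqF.
have qa : q <= 2 * a.
  rewrite /q /a -ler_pdivrMr ?invr_gt0// invrK ler_pdivrMl//.
  by rewrite mulr_natr mulr2n -natr1 lerD2l ler1n.
have GT : G^T = 1%:M + a *: A^T.
  by rewrite /G /euler_mx linearD/= linearZ/= trmx1.
have SS : S n.+1 = G *m S n - G *m T n 0%N + a *: cs n.+1.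
  have [sTS TE] := mx_series_recl (sT n).
  have -> : S n.+1 = mx_series (fun k => G *m T n k.+1 + a%:M *m c n.+1 k.+1).
    by rewrite /S; congr mx_series; apply/funext => k; rewrite mul_scalar_mx recT.
  have [s1 e1] := mx_seriesMl G sTS; have [s2 e2] := mx_seriesMl a%:M (scS n.+1).
  have [_ ->] := mx_seriesD s1 s2; rewrite e1 e2 mul_scalar_mx; congr (_ + _).
  by rewrite /S TE mulmxDr addrC addKr.
pose P := G *m S n.
have -> : U n.+1 - G *m U n *m G^T - a ^+ 2 *: Sg =
  - (q * a) *: ((P + P *m A^T) + (P + P *m A^T)^T)
   + a ^+ 2 *: (c n.+1 0%N + cs n.+1 + (cs n.+1)^T - Sg).
  rewrite -(defect_identity (G *m Y n *m G^T) P (P *m A^T) (G *m T n 0%N)) //.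
  congr (_ - _ - _).
    by rewrite /U recY SS.
  rewrite /U mulmxDr mulmxDl; congr (_ + _).
  rewrite -scalemxAr -scalemxAl; congr (_ *: _).
  rewrite mulmxDr mulmxDl -/P; congr (_ + _).
    by rewrite GT mulmxDr mulmx1 -scalemxAr.
  have -> : P + a *: (P *m A^T) = P *m G^T by rewrite GT mulmxDr mulmx1 -scalemxAr.
  by rewrite /P !trmx_mul trmxK !mulmxA.
apply: le_trans (entry_normD _ _) _.
rewrite !entry_normZ normrN ger0_norm ?mulr_ge0// (ger0_norm (sqr_ge0 _)).
have PE : P + P *m A^T = P *m (1%:M + A^T) by rewrite mulmxDr mulmx1.
have hP : entry_norm (P + P *m A^T) <= g * g * D * sq n.
  rewrite PE; apply: le_trans (entry_normM _ _) _.
  have -> : g * g * D * sq n = (g * (D * sq n)) * g by ring.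
  rewrite ler_pM ?entry_norm_ge0//.
  apply: le_trans (entry_normM _ _) _.
  exact: ler_pM (entry_norm_ge0 _) (entry_norm_ge0 _) (gG n) (Sn n).
have hP2 : entry_norm (P + P *m A^T + (P + P *m A^T)^T) <= 2 * (g * g * D * sq n).
  apply: le_trans (entry_normD _ _) _.
  by rewrite entry_normT mulr_natl mulr2n lerD.
have hc2 : entry_norm (c n.+1 0%N + cs n.+1 + (cs n.+1)^T - Sg)
    <= 2 * D * (1 - r)^-1 * q.
  apply: le_trans (hsum n.+1) _; rewrite -[leRHS]mulrA ler_wpM2l//; first exact: mulr_ge0.
  apply: (@le_trans _ _ (r ^+ n)).
    by rewrite exprS ler_piMl ?exprn_ge0// ltW.
  exact: geometric_le_inv.
have a2 : 0 <= a ^+ 2 by exact: sqr_ge0.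
have h1 : q * a * entry_norm (P + P *m A^T + (P + P *m A^T)^T)
    <= a ^+ 2 * (4 * (g * g * D) * sq n).
  have -> : a ^+ 2 * (4 * (g * g * D) * sq n) = (2 * a * a) * (2 * (g * g * D * sq n)).
    by ring.
  by rewrite ler_pM ?mulr_ge0 ?entry_norm_ge0// ler_wpM2r.
have h2 := ler_wpM2l a2 hc2.
apply: le_trans (lerD h1 h2) _; rewrite -mulrDr [leRHS]mulrCA ler_wpM2l//.
rewrite -/(sq n) [leRHS]mulrDr lerD// ler_wpM2r//; move: D0 ggD DR; rewrite /K; lra.
Qed.

End moment_recursion.

(** * Decay of the moments *)

Section powers.
Context {R : realType}.

Lemma powR_sub2 (n : nat) (p : R) :
  n.+1%:R `^ (- (2 + p)) = n.+1%:R^-1 ^+ 2 * n.+1%:R `^ (- p) :> R.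
Proof.
have -> : - (2 + p) = - p - 2%:R by ring.
rewrite powRD; last by rewrite pnatr_eq0 implybT.
by rewrite powR_invn ?ler0n// mulrC exprVn.
Qed.

Lemma powR_succ_le (n : nat) (p : R) : 0 <= p <= 1 -> (0 < n)%N ->
  n%:R `^ (- p) <= 2 * n.+1%:R `^ (- p).
Proof.
move=> /andP[p0 p1] n0; have n1 : (0 : R) < n%:R by rewrite ltr0n.
rewrite !powRN -[leLHS]mul1r ler_pdivrMr ?powR_gt0// mulrAC.
rewrite ler_pdivlMr ?powR_gt0// mul1r.
apply: (@le_trans _ _ ((2 * n%:R) `^ p)).
  rewrite ge0_ler_powR ?nnegrE ?mulr_ge0 ?ler0n//.
  by rewrite -natr1 mulr_natl mulr2n lerD2l ler1n.
rewrite powRM ?ler0n// ler_wpM2r ?powR_ge0//.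
by rewrite -[leRHS]powRr1// ler_powR// ler1n.
Qed.

Lemma inv_le_powR (n : nat) (p : R) : p <= 1 -> (0 < n)%N ->
  n%:R^-1 <= n%:R `^ (- p) :> R.
Proof.
move=> p1 n0; rewrite -powR_inv1 ?ler0n// ler_powR ?ler1n//.
by rewrite lerN2.
Qed.

Lemma powR_natN_le1 (n : nat) (p : R) : 0 <= p -> (0 < n)%N ->
  n%:R `^ (- p) <= 1 :> R.
Proof.
by move=> p0 n0; rewrite -[leRHS](powRr0 (n%:R : R)) ler_powR ?ler1n// oppr_le0.
Qed.

End powers.

Section decay.
Context {R : realType} {d : nat}.
Variables (A Sg : 'M[R]_d) (b K : R) (nu : 'M[R]_d -> R).
Hypothesis (nuA : contracting_norm A b K nu) (K0 : 0 <= K).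
Variables (Y U : nat -> 'M[R]_d) (K1 : R).
Hypothesis (Y0 : forall n, 0 <= \tr (Y n)) (K10 : 0 <= K1).
Hypothesis UY : forall n, (0 < n)%N ->
    entry_norm (U n - Y n) <= K1 * (n%:R^-1 * Num.sqrt (\tr (Y n))) /\
    entry_norm (U n.+1 - euler_mx A n *m U n *m (euler_mx A n)^T
                - n.+1%:R^-1 ^+ 2 *: Sg)
      <= K1 * (n.+1%:R^-1 ^+ 2 * (Num.sqrt (\tr (Y n)) + n%:R^-1)).

Let c1 : R := 2 * ((d * d)%:R * K).

Let c10 : 0 <= c1. Proof. by rewrite !mulr_ge0. Qed.

Lemma entry_norm_le_nu M : entry_norm M <= (d * d)%:R * K * nu M.
Proof.
by have [_ [_ _ h _ _]] := nuA; rewrite -mulrA entry_norm_le.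
Qed.

Lemma nu_le_entry_norm M : nu M <= K * entry_norm M.
Proof. by have [_ [_ _ _ h _]] := nuA; exact: h. Qed.

(** tr Y <= |U| + K1 sqrt (tr Y) / n is a quadratic inequality in sqrt (tr Y). *)
Lemma trace_le_nu (n : nat) : (0 < n)%N ->
  \tr (Y n) <= c1 * nu (U n) + K1 ^+ 2 * n%:R^-1 ^+ 2.
Proof.
move=> n0; have [h _] := UY n0.
have hU := entry_norm_le_nu (U n).
have : \tr (Y n) <= entry_norm (U n) + entry_norm (U n - Y n).
  rewrite -[X in \tr X](subrK (U n)) addrC linearD/= -[Y n - U n]opprB.
  rewrite -(entry_normN (U n - Y n)) lerD// mxtrace_le_entry_norm//.
move: h hU; set e := entry_norm (_ - _); set s := Num.sqrt _.
have sE : s ^+ 2 = \tr (Y n) by rewrite sqr_sqrtr.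
rewrite -sE => h hU hY.
have := sqr_ge0 (s - K1 * n%:R^-1).
rewrite /c1 -exprMn sqrrB; move: h hU hY.
rewrite [K1 * (_ * s)]mulrA; set t := K1 * n%:R^-1.
set u := nu _; set w := (d * d)%:R; nra.
Qed.

Lemma nu_step (n : nat) : (0 < n)%N ->
  nu (U n.+1) <= (1 - b / n.+1%:R + K / n.+1%:R ^+ 2) * nu (U n) +
    K * (n.+1%:R^-1 ^+ 2 * (entry_norm Sg + K1 * (Num.sqrt (\tr (Y n)) + n%:R^-1))).
Proof.
move=> n0; have [_ h] := UY n0.
have [nu0 [nuD nuZ _ _ nuG]] := nuA.
set a := n.+1%:R^-1; set G := euler_mx A n in h *.
have a01 : 0 <= a <= 1 by rewrite invr_ge0 ler0n/= invf_le1// ler1n.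
have -> : U n.+1 = G *m U n *m G^T +
    (a ^+ 2 *: Sg + (U n.+1 - G *m U n *m G^T - a ^+ 2 *: Sg)).
  by rewrite (addrC (a ^+ 2 *: Sg)) subrK addrC subrK.
apply: le_trans (nuD _ _) _; rewrite lerD//.
  have := nuG a (U n) a01; rewrite -/(euler_mx A n) -/G /a.
  by rewrite -exprVn.
apply: le_trans (nu_le_entry_norm _) _; rewrite ler_wpM2l//.
apply: le_trans (entry_normD _ _) _.
rewrite entry_normZ (ger0_norm (sqr_ge0 _)) mulrDr lerD2l.
by rewrite mulrCA.
Qed.

(** A first, crude rate: sqrt (tr Y) <= 1 + tr Y makes the recursion of nu (U n) linear
with a source of order n^-2, so that [rate_upper] applies with s = 1. *)
Lemma trace_decay (e : R) : 0 <= e -> e <= b -> e < 1 ->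
  exists2 C : R, 0 <= C & forall n, (0 < n)%N -> \tr (Y n) <= C * n%:R `^ (- e).
Proof.
move=> e0 eb e1; have [nu0 _] := nuA.
pose K2 := K + K * K1 * c1 + K * (entry_norm Sg + K1 * (2 + K1 ^+ 2)).
have KK : 0 <= K * K1 * c1 by rewrite mulr_ge0// mulr_ge0.
have KK' : 0 <= K * (entry_norm Sg + K1 * (2 + K1 ^+ 2)).
  by apply: mulr_ge0 => //; rewrite addr_ge0 ?entry_norm_ge0// mulr_ge0// addr_ge0// sqr_ge0.
have K20 : 0 <= K2 by exact: (addr_ge0 (addr_ge0 K0 KK) KK').
have rec n : (0 < n)%N -> nu (U n.+1) <=
    (1 - e / n.+1%:R + K2 / n.+1%:R ^+ 2) * nu (U n) + K2 * n.+1%:R `^ (- (1 + 1)).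
  move=> n0; apply: le_trans (nu_step n0) _.
  rewrite -[X in _ `^ (- X)]addr0 powR_sub2 oppr0 powRr0 mulr1 -!exprVn.
  set a := n.+1%:R^-1; set s := Num.sqrt _.
  have a0 : 0 <= a by rewrite invr_ge0.
  have a2 : 0 <= a ^+ 2 by exact: sqr_ge0.
  have q1 : n%:R^-1 <= 1 :> R by rewrite invf_le1 ?ler1n// ltr0n.
  have q0 : 0 <= n%:R^-1 :> R by rewrite invr_ge0.
  have q2 : n%:R^-1 ^+ 2 <= 1 :> R by rewrite expr_le1.
  have sy : s <= 1 + (c1 * nu (U n) + K1 ^+ 2).
    apply: (@le_trans _ _ (1 + \tr (Y n))).
      have := sqr_ge0 (s - 1); rewrite sqrrB1 sqr_sqrtr// -/s.
      by move: (Y0 n); lra.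
    rewrite lerD2l (le_trans (trace_le_nu n0))// lerD2l.
    by rewrite ler_piMr// sqr_ge0.
  have h1 : K * (a ^+ 2 * (entry_norm Sg + K1 * (s + n%:R^-1))) <=
     K * (a ^+ 2 * (entry_norm Sg + K1 * (2 + K1 ^+ 2 + c1 * nu (U n)))).
    rewrite !ler_wpM2l// lerD2l ler_wpM2l//; move: sy q1; lra.
  have h2 : e * a * nu (U n) <= b * a * nu (U n) by rewrite !ler_wpM2r.
  have h3 : 0 <= K * (entry_norm Sg + K1 * (2 + K1 ^+ 2)) * a ^+ 2 * nu (U n).
    by exact: (mulr_ge0 (mulr_ge0 KK' a2) (nu0 _)).
  have h4 : 0 <= (K + K * K1 * c1) * a ^+ 2 by rewrite mulr_ge0// addr_ge0.
  apply: le_trans (lerD (lexx _) h1) _.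
  rewrite -subr_ge0 in h2; rewrite -subr_ge0.
  apply: le_trans (addr_ge0 (addr_ge0 h3 h4) h2) _.
  by rewrite le_eqVlt; apply/orP; left; apply/eqP; rewrite /K2; ring.
have [C C0 hC] := rate_upper e0 e1 K20 (fun n _ => nu0 (U n)) rec.
exists (c1 * C + K1 ^+ 2) => [|n n0].
  by rewrite addr_ge0 ?sqr_ge0// mulr_ge0.
apply: le_trans (trace_le_nu n0) _.
rewrite mulrDl lerD//; first by rewrite -mulrA ler_wpM2l// hC.
rewrite ler_wpM2l ?sqr_ge0//.
apply: le_trans (inv_le_powR (ltW e1) n0).
rewrite expr2 ler_piMl ?invr_ge0// invf_le1 ?ler1n// ltr0n//.
Qed.

(** The crude rate of the trace lets both remainders gain a factor n^(-e/2). *)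
Lemma remainder_decay (e : R) : 0 <= e -> e <= b -> e < 1 ->
  exists2 C : R, 0 <= C & forall n, (0 < n)%N ->
    [/\ Num.sqrt (\tr (Y n)) <= C * n%:R `^ (- (e / 2)),
      entry_norm (U n - Y n) <= C * (n%:R^-1 * n%:R `^ (- (e / 2))) &
      entry_norm (U n.+1 - euler_mx A n *m U n *m (euler_mx A n)^T
                - n.+1%:R^-1 ^+ 2 *: Sg)
        <= C * n.+1%:R `^ (- (2 + e / 2))].
Proof.
move=> e0 eb e1; have [C C0 hC] := trace_decay e0 eb e1.
have p01 : 0 <= e / 2 <= 1 by apply/andP; split; [lra|lra].
have s0 : 0 <= Num.sqrt C by exact: sqrtr_ge0.
have C'0 : 0 <= K1 * Num.sqrt C by rewrite mulr_ge0.
exists (Num.sqrt C + K1 * Num.sqrt C + K1 * ((Num.sqrt C + 1) * 2)) => [|n n0].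
  by rewrite !addr_ge0// !mulr_ge0// addr_ge0.
have C''0 : 0 <= K1 * ((Num.sqrt C + 1) * 2) by rewrite !mulr_ge0// addr_ge0.
have hs : Num.sqrt (\tr (Y n)) <= Num.sqrt C * n%:R `^ (- (e / 2)).
  apply: le_trans (ler_wsqrtr (hC _ n0)) _.
  rewrite sqrtrM// ler_wpM2l//.
  by rewrite -powR12_sqrt ?powR_ge0// -powRrM mulNr.
have [h1 h2] := UY n0.
split.
- apply: le_trans hs _; rewrite ler_wpM2r ?powR_ge0//.
  by rewrite -addrA lerDl addr_ge0.
- apply: le_trans h1 _.
  apply: (@le_trans _ _ (K1 * (n%:R^-1 * (Num.sqrt C * n%:R `^ (- (e / 2)))))).
    by rewrite !ler_wpM2l// invr_ge0.
  have -> : K1 * (n%:R^-1 * (Num.sqrt C * n%:R `^ (- (e / 2)))) =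
    K1 * Num.sqrt C * (n%:R^-1 * n%:R `^ (- (e / 2))) by ring.
  apply: ler_wpM2r; first by rewrite mulr_ge0 ?invr_ge0 ?powR_ge0.
  by rewrite [leRHS]addrAC lerDr addr_ge0.
apply: le_trans h2 _; rewrite powR_sub2.
set P := n.+1%:R `^ _; set a2 := _ ^+ 2.
have /andP[p0 p1] := p01; have hq := inv_le_powR p1 n0.
have hP : n%:R `^ (- (e / 2)) <= 2 * P by exact: powR_succ_le.
have a20 : 0 <= a2 by exact: sqr_ge0.
have P0 : 0 <= P by exact: powR_ge0.
apply: (@le_trans _ _ (K1 * ((Num.sqrt C + 1) * 2) * (a2 * P))); last first.
  by apply: ler_wpM2r; [exact: mulr_ge0|rewrite lerDr addr_ge0].
have -> : K1 * ((Num.sqrt C + 1) * 2) * (a2 * P) =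
  K1 * (a2 * (Num.sqrt C * (2 * P) + 2 * P)) by ring.
rewrite !ler_wpM2l// lerD//; last exact: le_trans hP.
by apply: le_trans hs _; rewrite ler_wpM2l.
Qed.

End decay.

(** * The Lyapunov equation and the expansion of the covariance *)

Section limits.
Context {R : realType}.

Lemma powR_natN_cvg0 (p : R) : 0 < p -> n%:R `^ (- p) @[n --> \oo] --> (0 : R).
Proof.
move=> p0; apply/cvgrPdist_lt => e e0; near=> n.
have n0 : (0 : R) < n%:R by near: n; exists 1%N => // m /=; rewrite ltr0n.
rewrite sub0r normrN ger0_norm ?powR_ge0// powRN invf_plt ?posrE ?powR_gt0//.
have -> : e^-1 = (e^-1 `^ p^-1) `^ p.
  by rewrite -powRrM mulVf ?gt_eqF// powRr1// invr_ge0 ltW.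
rewrite gt0_ltr_powR ?nnegrE ?powR_ge0 ?ltW//.
by near: n; exact: nbhs_infty_gtr.
Unshelve. all: by end_near. Qed.

Lemma le0_of_le_powR (x C p : R) : 0 < p ->
  (forall n, (0 < n)%N -> x <= C * n%:R `^ (- p)) -> x <= 0.
Proof.
move=> p0 h.
have c0 : C * n%:R `^ (- p) @[n --> \oo] --> (C * 0 : R).
  by apply: cvgMr; exact: powR_natN_cvg0.
rewrite -(mulr0 C); apply: (cvgr_to_ge c0); near=> n; apply: h.
by near: n; exists 1%N.
Unshelve. all: by end_near. Qed.

End limits.

Section lyapunov_equation.
Context {R : realType} {d : nat}.
Implicit Types (A Sg Sigma : 'M[R]_d).

Lemma quadratic_form_le (x : 'cV[R]_d) (M : 'M[R]_d) :
  `|(x^T *m M *m x) 0 0| <= (\sum_i `|x i 0|) ^+ 2 * entry_norm M.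
Proof.
have xs i : `|x i 0| <= \sum_i `|x i 0|.
  by rewrite [leRHS](bigD1 i)//= lerDl sumr_ge0.
rewrite mxE; apply: le_trans (ler_norm_sum _ _ _) _.
rewrite /entry_norm exchange_big/= mulr_sumr; apply: ler_sum => j _.
rewrite normrM mxE.
apply: (@le_trans _ _ ((\sum_i `|x i 0| * `|M i j|) * `|x j 0|)).
  rewrite ler_wpM2r//; apply: le_trans (ler_norm_sum _ _ _) _.
  by apply: ler_sum => i _; rewrite normrM mxE.
set s := \sum_i `|x i 0|; set m := \sum_i `|M i j|.
have -> : s ^+ 2 * m = s * m * s by ring.
apply: ler_pM => //; first by apply: sumr_ge0 => i _; rewrite mulr_ge0.
by rewrite /m mulr_sumr; apply: ler_sum => i _; rewrite ler_wpM2r.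
Qed.

(** If A S + S A^T = - S, then (1 - a) S = (I + a A) S (I + a A)^T - a^2 A S A^T, so that
a (b - 1) nu S = O(a^2) for all small a, which forces nu S = 0 since b > 1. *)
Lemma lyapunov_kernel A Sigma (b K : R) nu : contracting_norm A b K nu -> 0 <= K ->
  1 < b -> lyapunov_eq A 0 Sigma -> Sigma = 0.
Proof.
move=> [nu0 [nuD nuZ nuE _ nuG]] K0 b1 lyap.
pose V := A *m Sigma + Sigma *m A^T; pose W := A *m Sigma *m A^T.
have VE : V = - Sigma.
  move: lyap; rewrite /lyapunov_eq addr0 linearD/= tr_scalar_mx mulmxDl mulmxDr.
  rewrite mul_scalar_mx mul_mx_scalar addrACA -scalerDl -/V => /eqP.
  rewrite (_ : 1 / 2 + 1 / 2 = 1 :> R); last by field.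
  by rewrite scale1r addrC addr_eq0 => /eqP.
have key a : 0 <= a <= 1 -> a * ((b - 1) * nu Sigma) <= a ^+ 2 * (K * nu Sigma + nu W).
  move=> a01; have /andP[a0 a1] := a01.
  have E : (1 - a) *: Sigma =
      (1%:M + a *: A) *m Sigma *m (1%:M + a *: A)^T + (- a ^+ 2) *: W.
    rewrite linearD/= trmx1 linearZ/= mulmxDl mul1mx mulmxDr mulmx1 mulmxDl.
    rewrite -!scalemxAl -!scalemxAr scalerA -/W scaleNr -expr2 addrA addrK.
    by rewrite -addrA -scalerDr -/V VE scalerN scalerBl scale1r.
  have := nuD ((1%:M + a *: A) *m Sigma *m (1%:M + a *: A)^T) ((- a ^+ 2) *: W).
  rewrite -E !nuZ normrN (ger0_norm (sqr_ge0 a)) ger0_norm ?subr_ge0//.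
  by have := nuG a Sigma a01; lra.
have nuS0 : nu Sigma = 0.
  apply/eqP; rewrite eq_le nu0 andbT leNgt; apply/negP => nuS.
  (* a = N / (M + N) violates a N <= a^2 M *)
  pose N := (b - 1) * nu Sigma; pose M := K * nu Sigma + nu W.
  have N0 : 0 < N by rewrite mulr_gt0// subr_gt0.
  have M0 : 0 <= M by rewrite addr_ge0// mulr_ge0.
  have MN0 : 0 < M + N by rewrite ltr_wpDl.
  have a0 : 0 < N / (M + N) by rewrite divr_gt0.
  have a1 : N / (M + N) <= 1 by rewrite ler_pdivrMr// mul1r lerDr.
  have := key (N / (M + N)); rewrite (ltW a0) a1 => /(_ isT).
  rewrite expr2 -mulrA ler_pM2l// -/N -/M mulrAC ler_pdivlMr//.
  by rewrite ler_pM2l// leNgt ltrDl N0.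
apply/matrixP => i j; rewrite mxE; apply/eqP.
by rewrite -normr_le0 (le_trans (nuE _ _ _))// nuS0 mulr0.
Qed.

(** An injective linear endomorphism of the space of matrices is surjective. *)
Lemma lyapunov_solvable A Sg (b K : R) nu : contracting_norm A b K nu -> 0 <= K ->
  1 < b -> exists Sigma, lyapunov_eq A Sg Sigma /\
    forall Sigma', lyapunov_eq A Sg Sigma' -> Sigma' = Sigma.
Proof.
move=> nuA K0 b1; pose B := (1 / 2)%:M + A.
pose L := lin_mulmx B + lin_mulmxr B^T.
have LE (X : 'M[R]_d) : mxvec X *m L = mxvec (B *m X + X *m B^T).
  by rewrite /L mulmxDr !mul_vec_lin/= -linearD.
have Lfree : row_free L.
  apply: inj_row_free => v vL0.
  have : mxvec (B *m vec_mx v + vec_mx v *m B^T) = 0 by rewrite -LE vec_mxK.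
  move/eqP; rewrite mxvec_eq0 => /eqP e.
  have /(lyapunov_kernel nuA K0 b1) : lyapunov_eq A 0 (vec_mx v).
    by rewrite /lyapunov_eq addr0.
  by move/eqP; rewrite vec_mx_eq0 => /eqP.
have Lunit : L \in unitmx by rewrite -row_free_unit.
exists (vec_mx (mxvec (- Sg) *m invmx L)).
set Sigma := vec_mx _.
have SE : lyapunov_eq A Sg Sigma.
  apply/eqP; rewrite addr_eq0; apply/eqP; apply: (can_inj mxvecK).
  by rewrite -LE /Sigma vec_mxK mulmxKV.
split=> // Sigma' S'E; apply/eqP; rewrite -subr_eq0; apply/eqP.
apply: (lyapunov_kernel nuA K0 b1).
rewrite /lyapunov_eq addr0 mulmxBr mulmxBl addrACA -opprD.
move: SE S'E; rewrite /lyapunov_eq => /eqP; rewrite addr_eq0 => /eqP ->.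
by move=> /eqP; rewrite addr_eq0 => /eqP ->; rewrite subrr.
Qed.

(** Sigma / n satisfies the recursion of U up to O(n^-3): here GUG is G U G^T,
V = A Sigma + Sigma A^T and W = A Sigma A^T, and - (Sigma + V) is the noise covariance
by the Lyapunov equation. *)
Lemma centering_identity (q a : R) (U1 GUG Sigma V W : 'M[R]_d) :
  a - q + q * a = 0 ->
  U1 - a *: Sigma = GUG - q *: (Sigma + a *: V + a ^+ 2 *: W) +
    (U1 - GUG - a ^+ 2 *: (- (Sigma + V)) + (q * a ^+ 2) *: (Sigma + V + W)).
Proof.
move=> aq; apply/matrixP => i j; rewrite !mxE.
apply/eqP; rewrite -subr_eq0; apply/eqP.
transitivity (- (a - q + q * a) * ((1 + a) * Sigma i j + a * V i j)).
  by ring.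
by rewrite aq oppr0 mul0r.
Qed.

(** D_n = U_n - Sigma / n satisfies the homogeneous recursion up to O(n^(-9/4)), so that
D_n = O(n^-b') for b' = min(b, 9/8), which lies strictly between 1 and 5/4. The
exponent b' - 1 depends on A alone. Positivity passes to the limit of n Y_n. *)
Lemma covariance_expansion A (b K : R) nu : contracting_norm A b K nu -> 0 <= K ->
  1 < b -> exists2 delta : R, 0 < delta & forall Sg Y, moment_data A Sg Y ->
  exists Sigma, [/\ possemidef Sigma, lyapunov_eq A Sg Sigma,
    forall Sigma', lyapunov_eq A Sg Sigma' -> Sigma' = Sigma &
    exists C : R, forall n i j, (0 < n)%N ->
      `|Y n i j - n%:R^-1 * Sigma i j| <= C * n%:R `^ (- 1 - delta)].
Proof.
move=> nuA K0 b1; pose b' : R := Num.min b (9 / 8).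
have b'1 : 1 < b' by rewrite lt_min b1/=; lra.
have b'9 : b' <= 9 / 8 by rewrite ge_min lexx orbT.
have b'b : b' <= b by rewrite ge_min lexx.
exists (b' - 1) => [|Sg Y dataY]; first by rewrite subr_gt0.
have [Sigma [lyap uniq_Sigma]] := lyapunov_solvable Sg nuA K0 b1.
have [U [K1 [K10 UY]]] := corrected_moments dataY.
have Ysemi : forall n, possemidef (Y n).
  by case: dataY => [T [c [Rk [C [r [_ []]]]]]].
have Y0 n : 0 <= \tr (Y n).
  apply: sumr_ge0 => i _; have [_ /(_ (delta_mx i 0))] := Ysemi n.
  by rewrite trmx_delta -rowE -colE !mxE.
have [nu0 [nuD nuZ nuE nuK nuG]] := nuA.
(* e = 1/2 gives remainders O(n^(-9/4)), enough for an exponent b' < 5/4 *)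
have [||| C C0 hC] := @remainder_decay _ _ _ _ _ _ _ nuA K0 _ _ _ Y0 K10 UY (1 / 2).
- by lra.
- by apply: ltW; apply: lt_trans b1; lra.
- by lra.
have e4 : (1 / 2 / 2 : R) = 1 / 4 by field.
rewrite e4 in hC.
pose V := A *m Sigma + Sigma *m A^T; pose W := A *m Sigma *m A^T.
have SgE : Sg = - (Sigma + V).
  move: lyap; rewrite /lyapunov_eq linearD/= tr_scalar_mx mulmxDl mulmxDr.
  rewrite mul_scalar_mx mul_mx_scalar [X in X + Sg]addrACA -scalerDl -/V => /eqP.
  rewrite (_ : 1 / 2 + 1 / 2 = 1 :> R); last by field.
  by rewrite scale1r addr_eq0 => /eqP ->; rewrite opprK.
pose D n := U n - n%:R^-1 *: Sigma.
pose K2 := K + K * (C + 2 * entry_norm (Sigma + V + W)).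
have en0 : 0 <= 2 * entry_norm (Sigma + V + W) by rewrite mulr_ge0// entry_norm_ge0.
have K20 : 0 <= K2 by rewrite /K2 addr_ge0// mulr_ge0// addr_ge0.
have rec n : (0 < n)%N -> nu (D n.+1) <=
    (1 - b' / n.+1%:R + K2 / n.+1%:R ^+ 2) * nu (D n) + K2 * n.+1%:R `^ (- (1 + 5 / 4)).
  move=> n0; have [_ _ hE] := hC n n0.
  have n1 : (0 : R) < n%:R by rewrite ltr0n.
  set a := n.+1%:R^-1; pose q : R := n%:R^-1; set G := euler_mx A n in hE *.
  set E := _ - a ^+ 2 *: Sg in hE.
  have a0 : 0 <= a by rewrite invr_ge0.
  have a01 : 0 <= a <= 1 by rewrite a0/= invf_le1// ler1n.
  have aq : a - q + q * a = 0.
    by rewrite /a /q -natr1; field; rewrite natr1 !gt_eqF.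
  have GSG : G *m Sigma *m G^T = Sigma + a *: V + a ^+ 2 *: W.
    rewrite /G /euler_mx -/a linearD/= trmx1 linearZ/= mulmxDl mul1mx mulmxDr mulmx1.
    rewrite mulmxDl -!scalemxAl -!scalemxAr scalerA -/W -expr2 addrA scalerDr.
    by rewrite !addrA.
  have DE : D n.+1 = G *m D n *m G^T + (E + (q * a ^+ 2) *: (Sigma + V + W)).
    have -> : G *m D n *m G^T = G *m U n *m G^T - q *: (Sigma + a *: V + a ^+ 2 *: W).
      by rewrite /D mulmxBr mulmxBl -scalemxAr -scalemxAl GSG.
    by rewrite /D /E -/a SgE; exact: centering_identity.
  rewrite DE; apply: le_trans (nuD _ _) _; rewrite lerD//.
    have := nuG a (D n) a01; rewrite -/(euler_mx A n) -/G => h.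
    apply: le_trans h _; rewrite ler_wpM2r// -exprVn -/a.
    have h1 : b' * a <= b * a by rewrite ler_wpM2r.
    have h2 : 0 <= K * (C + 2 * entry_norm (Sigma + V + W)) * a ^+ 2.
      by rewrite mulr_ge0 ?sqr_ge0// mulr_ge0// addr_ge0.
    by rewrite /K2 mulrDl; lra.
  apply: le_trans (nuK _) _.
  apply: (@le_trans _ _ (K * (C + 2 * entry_norm (Sigma + V + W)) *
      n.+1%:R `^ (- (1 + 5 / 4)))); last first.
    by rewrite ler_wpM2r ?powR_ge0// /K2 lerDr.
  rewrite -mulrA ler_wpM2l// -/(entry_norm _).
  apply: le_trans (entry_normD _ _) _; rewrite mulrDl.
  have -> : (1 + 5 / 4 : R) = 2 + 1 / 4 by field.
  rewrite lerD// entry_normZ (ger0_norm (mulr_ge0 _ (sqr_ge0 _))) ?invr_ge0//.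
  rewrite powR_sub2 -/a; set s := entry_norm _.
  have qp : q <= 2 * n.+1%:R `^ (- (1 / 4)).
    apply: (@le_trans _ _ (n%:R `^ (- (1 / 4)))); first by apply: inv_le_powR => //; lra.
    by apply: powR_succ_le => //; lra.
  have -> : 2 * s * (a ^+ 2 * n.+1%:R `^ (- (1 / 4))) =
    (2 * n.+1%:R `^ (- (1 / 4))) * a ^+ 2 * s by ring.
  by rewrite ler_wpM2r ?entry_norm_ge0// ler_wpM2r// sqr_ge0.
have b'54 : b' < 5 / 4 by apply: le_lt_trans b'9 _; lra.
have b'0 : 0 <= b' by apply: ltW; apply: lt_trans b'1.
have [C3 C30 hC3] := rate_upper b'0 b'54 K20 (fun n _ => nu0 (D n)) rec.
pose C4 := C + (d * d)%:R * K * C3.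
have hY n : (0 < n)%N -> entry_norm (Y n - n%:R^-1 *: Sigma) <= C4 * n%:R `^ (- b').
  move=> n0; have [_ hUY _] := hC n n0.
  have -> : Y n - n%:R^-1 *: Sigma = - (U n - Y n) + D n.
    by rewrite /D opprB addrA subrK.
  apply: le_trans (entry_normD _ _) _; rewrite entry_normN mulrDl lerD//.
    apply: le_trans hUY _; rewrite ler_wpM2l// -powR_inv1// -powRD; last first.
      by rewrite pnatr_eq0 -lt0n n0 implybT.
    by rewrite ler_powR ?ler1n//; lra.
  apply: le_trans (entry_norm_le_nu nuA _) _.
  by rewrite -[leRHS]mulrA ler_wpM2l ?hC3// mulr_ge0.
have powE n : n%:R `^ (- b') = n%:R `^ (- 1 - (b' - 1)) :> R by congr powR; ring.
have inv_pow n : (0 < n)%N -> n%:R `^ (- b') = n%:R^-1 * n%:R `^ (- (b' - 1)) :> R.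
  move=> n0; rewrite -powR_inv1// -powRD; last first.
    by rewrite pnatr_eq0 -lt0n n0 implybT.
  by congr powR; ring.
exists Sigma; split=> //; last first.
  exists C4 => n i j n0; rewrite -powE; apply: le_trans (hY n n0).
  by apply: le_trans (le_entry_norm _ i j); rewrite !mxE.
split.
  apply/matrixP => i j; rewrite mxE; apply/eqP; rewrite -subr_eq0 -normr_le0.
  apply: (@le0_of_le_powR _ _ (2 * C4) (b' - 1)); first by rewrite subr_gt0.
  move=> n n0; have n1 : (0 : R) < n%:R by rewrite ltr0n.
  have /matrixP /(_ i j) YT := (Ysemi n).1; rewrite mxE in YT.
  have hij := le_trans (le_entry_norm _ i j) (hY n n0).
  have hji := le_trans (le_entry_norm _ j i) (hY n n0).
  rewrite inv_pow// in hij hji; rewrite !mxE in hij hji.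
  rewrite -(ler_pM2l (_ : 0 < n%:R^-1 :> R)) ?invr_gt0//.
  rewrite -[X in X * `|_|]gtr0_norm ?invr_gt0// -normrM mulrBr.
  have -> : n%:R^-1 * Sigma j i - n%:R^-1 * Sigma i j =
    (Y n i j - n%:R^-1 * Sigma i j) - (Y n j i - n%:R^-1 * Sigma j i).
    by rewrite YT; ring.
  apply: le_trans (ler_normB _ _) _; move: hij hji; lra.
move=> x; rewrite -oppr_le0.
apply: (@le0_of_le_powR _ _ ((\sum_i `|x i 0|) ^+ 2 * C4) (b' - 1)).
  by rewrite subr_gt0.
move=> n n0; have n1 : (0 : R) < n%:R by rewrite ltr0n.
rewrite -(ler_pM2l (_ : 0 < n%:R^-1 :> R)) ?invr_gt0//.
rewrite mulrN mulrCA -inv_pow// -mulrA.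
have hx := (Ysemi n).2 x.
have := quadratic_form_le x (Y n - n%:R^-1 *: Sigma).
have := ler_wpM2l (sqr_ge0 (\sum_i `|x i 0|)) (hY n n0).
have -> : (x^T *m (Y n - n%:R^-1 *: Sigma) *m x) 0 0 =
    (x^T *m Y n *m x) 0 0 - n%:R^-1 * (x^T *m Sigma *m x) 0 0.
  rewrite mulmxBr mulmxBl -scalemxAr -scalemxAl.
  by rewrite [LHS]mxE [X in _ + X = _]mxE [X in _ - X = _]mxE.
move: hx; set y := (_ *m Y n *m _) 0 0; set z := (_ *m Sigma *m _) 0 0.
move=> y0 h1 h2; have := le_trans h2 h1.
rewrite ler_norml => /andP[_ h]; move: h y0; lra.
Qed.

End lyapunov_equation.

(** * Exact rates and slow modes *)

Section rate_from_bounds.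
Context {R : realType}.

Lemma powR_natN_small (p e : R) : 0 < p -> 0 < e ->
  exists2 N : nat, (0 < N)%N & forall n, (N <= n)%N -> n%:R `^ (- p) <= e.
Proof.
move=> p0 e0.
have /cvgrPdist_le /(_ e e0)[N _ hN] := @powR_natN_cvg0 R p p0.
exists N.+1 => // n Nn; have := hN n (ltnW Nn).
by rewrite sub0r normrN ger0_norm ?powR_ge0.
Qed.

(** Against a sequence of exact order n^-rho1, any other power of n wins or loses by a
factor that tends to infinity. *)
Lemma converges_at_rate_of_bounds (z : nat -> R) (rho1 c C : R) (N : nat) :
  0 < c -> (0 < N)%N ->
  (forall n, (N <= n)%N ->
     c * n%:R `^ (- rho1) <= z n /\ z n <= C * n%:R `^ (- rho1)) ->
  converges_at_rate (fun n => (z n)%:E) rho1.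
Proof.
move=> c0 N0 h.
have z0 n : (N <= n)%N -> 0 <= z n.
  by move=> /h[+ _]; apply: le_trans; rewrite mulr_ge0 ?powR_ge0 ?ltW.
have E rho : (fun n => (n%:R `^ rho)%:E * `|(z n)%:E|)%E =
    EFin \o (fun n => n%:R `^ rho * `|z n|).
  by apply/funext => n /=; rewrite EFinM.
have powE rho n : (0 < n)%N -> n%:R `^ rho * n%:R `^ (- rho1) = n%:R `^ (rho - rho1) :> R.
  by move=> n0; rewrite -powRD// pnatr_eq0 -lt0n n0 implybT.
split=> rho hrho; rewrite E.
  apply: cvg_EFin; first by near=> n.
  apply: (@squeeze_cvgr _ _ _ _ (cst 0) (fun n => C * n%:R `^ (- (rho1 - rho)))).
  - near=> n; have Nn : (N <= n)%N by near: n; exists N.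
    rewrite mulr_ge0 ?powR_ge0//= ger0_norm ?z0//.
    have [_ h2] := h n Nn; apply: le_trans (ler_wpM2l (powR_ge0 _ _) h2) _.
    by rewrite mulrCA powE ?opprB// (leq_trans N0).
  - exact: cvg_cst.
  - rewrite -(mulr0 C); apply: cvgMr; apply: powR_natN_cvg0.
    by rewrite subr_gt0.
apply/cvgeryP/cvgryPge => M; near=> n.
have Nn : (N <= n)%N by near: n; exists N.
have n0 : (0 < n)%N by exact: leq_trans Nn.
have [h1 _] := h n Nn; rewrite ger0_norm ?z0//.
apply: le_trans (ler_wpM2l (powR_ge0 _ _) h1).
rewrite mulrCA powE//.
have small : n%:R `^ (- (rho - rho1)) <= c / (`|M| + 1).
  near: n; have [||N' _ hN'] := @powR_natN_small (rho - rho1) (c / (`|M| + 1)).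
  - by rewrite subr_gt0.
  - by rewrite divr_gt0// ltr_wpDl.
  by exists N' => // m /=; exact: hN'.
move: small; rewrite powRN => small.
have P0 : 0 < n%:R `^ (rho - rho1) :> R by rewrite powR_gt0 ?ltr0n.
have M1 : 0 < `|M| + 1 by rewrite ltr_wpDl.
apply: (@le_trans _ _ (`|M| + 1)).
  by apply: le_trans (ler_norm _) _; rewrite lerDl.
move: small; rewrite ler_pdivlMr// mulrC ler_pdivrMr//.
Unshelve. all: by end_near. Qed.

End rate_from_bounds.

Section mode_decay.
Context {R : realType} {d : nat}.
Implicit Types (M Sg : 'M[R]_d) (x y w : 'cV[R]_d).

Definition qform M x : R := (x^T *m M *m x) 0 0.
Definition bform M x y : R := (x^T *m M *m y) 0 0.

Lemma bformDl M x y w : bform M (x + y) w = bform M x w + bform M y w.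
Proof. by rewrite /bform linearD/= mulmxDl mulmxDl mxE. Qed.

Lemma bformDr M x y w : bform M w (x + y) = bform M w x + bform M w y.
Proof. by rewrite /bform mulmxDr mxE. Qed.

Lemma bformZl M t x w : bform M (t *: x) w = t * bform M x w.
Proof. by rewrite /bform linearZ/= -!scalemxAl mxE. Qed.

Lemma bformZr M t x w : bform M w (t *: x) = t * bform M w x.
Proof. by rewrite /bform -scalemxAr mxE. Qed.

Lemma bform_trC M x y : M^T = M -> bform M x y = bform M y x.
Proof.
move=> MT; rewrite /bform -[in LHS](trmxK (x^T *m M *m y)) mxE.
by rewrite !trmx_mul trmxK MT mulmxA.
Qed.

Lemma qformD M N x : qform (M + N) x = qform M x + qform N x.
Proof. by rewrite /qform mulmxDr mulmxDl mxE. Qed.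

Lemma qformZ M t x : qform (t *: M) x = t * qform M x.
Proof. by rewrite /qform -scalemxAr -scalemxAl mxE. Qed.

Lemma qform_congruence M G x : qform (G *m M *m G^T) x = qform M (G^T *m x).
Proof. by rewrite /qform trmx_mul trmxK !mulmxA. Qed.

(** If x^T M x = 0, then x minimizes the quadratic form of M, hence M x = 0: the test
direction is w = M x. *)
Lemma possemidef_qform_gt0 M x : possemidef M -> M *m x <> 0 -> 0 < qform M x.
Proof.
move=> [MT M0] Mx; rewrite lt_neqAle M0 andbT; apply/eqP => q0.
apply: Mx; pose w := M *m x.
have qE : qform M x = bform M x x by [].
have wx : bform M w x = (w^T *m w) 0 0 by rewrite /bform -mulmxA.
have pos t : 0 <= 2 * t * bform M w x + t ^+ 2 * bform M w w.
  have := M0 (x + t *: w); rewrite -/(bform M _ _).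
  rewrite bformDl !bformDr !bformZl !bformZr -qE -q0 add0r.
  by rewrite (bform_trC x w)//; set u := bform _ _ _; set v := bform _ _ _; lra.
have wx0 : 0 <= bform M w x.
  by rewrite wx mxE sumr_ge0// => i _; rewrite mxE -expr2 sqr_ge0.
have ww0 : 0 <= bform M w w by exact: M0.
have wx_eq0 : bform M w x = 0.
  apply/eqP; rewrite eq_le wx0 andbT leNgt; apply/negP => wxp.
  have D0 : 0 < bform M w w + 1 by rewrite ltr_wpDl.
  have := pos (- (bform M w x / (bform M w w + 1))).
  set s := bform M w x / _.
  have s0 : 0 < s by rewrite divr_gt0.
  have sE : bform M w x = s * (bform M w w + 1) by rewrite mulfVK// gt_eqF.
  rewrite sE; move: ww0; set u := bform M w w; nra.
move: wx_eq0; rewrite wx mxE => /eqP; rewrite psumr_eq0; last first.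
  by move=> i _; rewrite mxE -expr2 sqr_ge0.
move=> /allP w0; apply/matrixP => i j; rewrite ord1 [RHS]mxE.
have := w0 i; rewrite mem_index_enum => /(_ isT) /=.
by rewrite mxE -expr2 sqrf_eq0 => /eqP.
Qed.

(** A complex factor p + i s acts on the pair (x, y) as a rotation and a dilation. *)
Lemma qform_rotation M x y (p s : R) :
  qform M (p *: x - s *: y) + qform M (s *: x + p *: y) =
  (p ^+ 2 + s ^+ 2) * (qform M x + qform M y).
Proof.
rewrite -[qform M (_ - _)]/(bform M _ _) -[qform M (_ + _)]/(bform M _ _).
rewrite -scaleNr !bformDl !bformDr !bformZl !bformZr.
by rewrite -[qform M x]/(bform M x x) -[qform M y]/(bform M y y); ring.
Qed.

End mode_decay.

Section mode_rate.
Context {R : realType} {d : nat}.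

(** On the plane spanned by x and y, a step multiplies the form by
kap n = |1 + lambda / (n+1)|^2, hence the exact exponent 2 rho0. *)
Lemma mode_rate (A Sg : 'M[R]_d) (Y : nat -> 'M[R]_d) (b K : R) nu
    (x y : 'cV[R]_d) (rho0 om : R) :
  contracting_norm A b K nu -> 0 <= K -> 0 < b ->
  moment_data A Sg Y -> possemidef Sg ->
  0 < rho0 -> rho0 < 1 / 2 ->
  A^T *m x = - rho0 *: x - om *: y -> A^T *m y = om *: x + - rho0 *: y ->
  Sg *m x <> 0 \/ Sg *m y <> 0 ->
  converges_at_rate (fun n => (qform (Y n) x + qform (Y n) y)%:E) (2 * rho0).
Proof.
move=> nuA K0 b0 dataY Sg0 r0 r12 Ax Ay Sxy.
have [U [K1 [K10 UY]]] := corrected_moments dataY.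
have Ysemi : forall n, possemidef (Y n).
  by case: dataY => [T [c [Rk [C [r [_ []]]]]]].
have Y0 n : 0 <= \tr (Y n).
  apply: sumr_ge0 => i _; have [_ /(_ (delta_mx i 0))] := Ysemi n.
  by rewrite trmx_delta -rowE -colE !mxE.
pose q M := qform M x + qform M y.
have qD M N : q (M + N) = q M + q N by rewrite /q !qformD; ring.
have qZ t M : q (t *: M) = t * q M by rewrite /q !qformZ; ring.
have qB M N : q (M - N) = q M - q N by rewrite -scaleN1r qD qZ mulN1r.
pose L := (\sum_i `|x i 0|) ^+ 2 + (\sum_i `|y i 0|) ^+ 2.
have L0 : 0 <= L by rewrite addr_ge0 ?sqr_ge0.
have qL M : `|q M| <= L * entry_norm M.
  by rewrite mulrDl (le_trans (ler_normD _ _))// lerD// quadratic_form_le.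
have s2 : 0 < q Sg.
  have [_ Sgx] := Sg0.
  case: Sxy => /(possemidef_qform_gt0 Sg0) h.
    by rewrite ltr_wpDr// Sgx.
  by rewrite ltr_wpDl// Sgx.
set sigma2 := q Sg in s2.
pose e : R := Num.min b (1 / 2).
have e0 : 0 < e by rewrite lt_min b0/=; lra.
have eb : e <= b by rewrite ge_min lexx.
have e1 : e < 1 by rewrite gt_min; apply/orP; right; lra.
have [C C0 hC] := remainder_decay nuA K0 Y0 K10 UY (ltW e0) eb e1.
pose p := e / 2; have p0 : 0 < p by rewrite divr_gt0.
pose X n := q (U n).
pose kap (n : nat) : R := (1 - rho0 * n.+1%:R^-1) ^+ 2 + (om * n.+1%:R^-1) ^+ 2.
have GE n M : q (euler_mx A n *m M *m (euler_mx A n)^T) = kap n * q M.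
  have GTE (z : 'cV[R]_d) : (euler_mx A n)^T *m z = z + n.+1%:R^-1 *: (A^T *m z).
    by rewrite /euler_mx linearD/= trmx1 linearZ/= mulmxDl mul1mx -scalemxAl.
  rewrite /q !qform_congruence !GTE Ax Ay.
  rewrite -(qform_rotation _ _ _ (1 - rho0 * n.+1%:R^-1)); congr (qform M _ + qform M _).
    by apply/matrixP => i j; rewrite !mxE; ring.
  by apply/matrixP => i j; rewrite !mxE; ring.
have recX n : (0 < n)%N -> exists2 r : R,
    X n.+1 = kap n * X n + n.+1%:R^-1 ^+ 2 * sigma2 + r &
    `|r| <= L * C * (n.+1%:R^-1 ^+ 2 * n.+1%:R `^ (- p)).
  move=> n0; have [_ _ hE] := hC n n0.
  exists (q (U n.+1 - euler_mx A n *m U n *m (euler_mx A n)^T - n.+1%:R^-1 ^+ 2 *: Sg)).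
    by rewrite !qB qZ GE /X /sigma2; ring.
  apply: le_trans (qL _) _; rewrite -mulrA ler_wpM2l// (le_trans hE)//.
  by rewrite powR_sub2.
have zX n : (0 < n)%N -> `|X n - q (Y n)| <= L * C * (n%:R^-1 * n%:R `^ (- p)).
  move=> n0; have [_ hU _] := hC n n0.
  have -> : X n - q (Y n) = q (U n - Y n) by rewrite qB.
  by apply: le_trans (qL _) _; rewrite -mulrA ler_wpM2l.
have kapE n : kap n = 1 - 2 * rho0 / n.+1%:R + (rho0 ^+ 2 + om ^+ 2) / n.+1%:R ^+ 2.
  by rewrite /kap -exprVn; ring.
have r21 : 2 * rho0 < 1 by lra.
have r20 : 0 <= 2 * rho0 by lra.
have LC0 : 0 <= L * C by rewrite mulr_ge0.
have [CX CX0 hX] : exists2 CX : R, 0 <= CX &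
    forall n, (0 < n)%N -> `|X n| <= CX * n%:R `^ (- (2 * rho0)).
  pose KX := rho0 ^+ 2 + om ^+ 2 + (sigma2 + L * C).
  have ro0 : 0 <= rho0 ^+ 2 + om ^+ 2 by rewrite addr_ge0 ?sqr_ge0.
  have sL : 0 <= sigma2 + L * C by rewrite addr_ge0// ltW.
  have KX0 : 0 <= KX by rewrite addr_ge0.
  apply: (rate_upper r20 r21 KX0) => // n n0.
  have [r -> hr] := recX n n0.
  have kap0 : 0 <= kap n by rewrite addr_ge0 ?sqr_ge0.
  rewrite -[X in _ `^ (- X)]addr0 powR_sub2 oppr0 powRr0 mulr1.
  rewrite -addrA; apply: le_trans (ler_normD _ _) _; rewrite lerD//.
    rewrite normrM ger0_norm// ler_wpM2r// kapE lerD2l ler_wpM2r ?invr_ge0 ?exprn_ge0//.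
    by rewrite /KX lerDl.
  apply: le_trans (ler_normD _ _) _.
  rewrite ger0_norm; last by rewrite mulr_ge0 ?sqr_ge0// ltW.
  have a20 : 0 <= n.+1%:R^-1 ^+ 2 :> R by rewrite sqr_ge0.
  have hr' : `|r| <= L * C * n.+1%:R^-1 ^+ 2.
    apply: le_trans hr _; rewrite ler_wpM2l// ler_piMr//.
    by rewrite powR_natN_le1// ltW.
  apply: le_trans (lerD (lexx _) hr') _.
  have := mulr_ge0 ro0 a20; rewrite /KX; move: (n.+1%:R^-1 ^+ 2) => a2; lra.
(* X n need not be nonnegative, since U is only a correction of Y. The shift by
   eps / n repairs this for large n, and costs at most a quarter of the forcing. *)
pose eps := sigma2 / 8; have eps0 : 0 < eps by rewrite divr_gt0.
pose X' n := X n + eps * n%:R^-1.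
have LC1 : 0 < L * C + 1 by rewrite ltr_wpDl.
have [N1 N10 hN1] := powR_natN_small p0 (divr_gt0 eps0 LC1).
have small n : (N1 <= n)%N -> L * C * n%:R `^ (- p) <= eps.
  move=> Nn; have := hN1 n Nn; rewrite ler_pdivlMr// => h.
  apply: le_trans h; rewrite mulrC ler_wpM2l ?powR_ge0// lerDl//.
have ro1 : 0 < rho0 ^+ 2 + om ^+ 2 by rewrite ltr_pwDl ?sqr_ge0// exprn_gt0.
have rr0 : 0 < 2 * rho0 by rewrite mulr_gt0.
have [N2 N20 hN2] := powR_natN_small ltr01 (divr_gt0 rr0 ro1).
have kap1 n : (N2 <= n)%N -> kap n <= 1.
  move=> Nn; rewrite kapE -addrA gerDl addrC subr_le0.
  have := hN2 n.+1 (leq_trans Nn (leqnSn n)).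
  rewrite powR_inv1// ler_pdivlMr// => h.
  rewrite expr2 invfM mulrA ler_wpM2r ?invr_ge0//.
  by rewrite mulrC.
pose N := maxn N1 N2.
have N_N1 : (N1 <= N)%N by rewrite leq_maxl.
have N_N2 : (N2 <= N)%N by rewrite leq_maxr.
have N0 : (0 < N)%N by exact: leq_trans N_N1.
have X'0 n : (N <= n)%N -> 0 <= X' n.
  move=> Nn; have n0 : (0 < n)%N by exact: leq_trans Nn.
  have z0 : 0 <= q (Y n) by rewrite addr_ge0//; have [_ ->] := Ysemi n.
  have := zX n n0; rewrite ler_norml => /andP[h _].
  have q0 : 0 <= n%:R^-1 :> R by rewrite invr_ge0.
  have := ler_wpM2r q0 (small n (leq_trans N_N1 Nn)).
  by move: h; rewrite /X'; lra.
have rec' n : (N <= n)%N ->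
    (1 - 2 * rho0 / n.+1%:R) * X' n + n.+1%:R^-1 ^+ 2 * (sigma2 / 4) <= X' n.+1.
  move=> Nn; have n0 : (0 < n)%N by exact: leq_trans Nn.
  have n1 : (0 : R) < n%:R by rewrite ltr0n.
  have [r rE hr] := recX n n0.
  have := X'0 n Nn; have := kap1 n (leq_trans N_N2 Nn).
  have sm : L * C * n.+1%:R `^ (- p) <= eps.
    by apply: small; rewrite (leq_trans N_N1)// (leq_trans Nn).
  have kE : 1 - 2 * rho0 / n.+1%:R <= kap n.
    by rewrite kapE lerDl divr_ge0 ?exprn_ge0// ltW.
  rewrite /X' rE; set a := n.+1%:R^-1 in rE hr kE *; set qq := n%:R^-1.
  have a0 : 0 <= a by rewrite invr_ge0.
  have aq : a - qq + qq * a = 0.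
    by rewrite /a /qq -natr1; field; rewrite natr1 !gt_eqF.
  have qa : qq <= 2 * a.
    rewrite /qq /a -ler_pdivrMr ?invr_gt0// invrK ler_pdivrMl//.
    by rewrite mulr_natr mulr2n -natr1 lerD2l ler1n.
  have qq0 : 0 <= qq by rewrite invr_ge0.
  move=> k1 x0.
  have h1 := ler_wpM2r x0 kE.
  have h2 : - (a ^+ 2 * eps) <= r.
    move: hr; rewrite ler_norml => /andP[+ _]; apply: le_trans; rewrite lerN2.
    by rewrite mulrCA ler_wpM2l// sqr_ge0.
  have h3 : eps * (kap n * qq - a) <= eps * (2 * a ^+ 2).
    apply: ler_wpM2l; first exact: ltW.
    have e1' : kap n * qq <= 1 * qq by rewrite ler_wpM2r.
    have e2 : qq * a <= 2 * a * a by rewrite ler_wpM2r.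
    by move: e1' e2 aq; lra.
  have s8 : sigma2 = 8 * eps by rewrite /eps; field.
  apply: le_trans (lerD h1 (lexx _)) _.
  have a20 : 0 <= a ^+ 2 * eps by rewrite mulr_ge0 ?sqr_ge0// ltW.
  rewrite s8 in rE *; move: h2 h3 a20; set xn := X n; set kn := kap n; lra.
have b01 : 0 <= 2 * rho0 <= 1 by rewrite r20 ltW.
have [c c0 hc] : exists2 c : R, 0 < c &
    forall n, (N.+1 <= n)%N -> c * n%:R `^ (- (2 * rho0)) <= X' n.
  apply: (rate_lower b01) => // [n Nn|].
    apply: le_trans (rec' n (ltnW Nn)); rewrite lerDl mulr_ge0 ?sqr_ge0//.
    by rewrite divr_ge0// ltW.
  apply: lt_le_trans (rec' N (leqnn N)).
  apply: ltr_wpDl; last by rewrite mulr_gt0 ?divr_gt0// exprn_gt0// invr_gt0.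
  rewrite mulr_ge0 ?X'0// subr_ge0 ler_pdivrMr// mul1r.
  by rewrite (le_trans (ltW r21))// ler1n.
have [N3 N30 hN3] : exists2 N3 : nat, (0 < N3)%N &
    forall n, (N3 <= n)%N -> n%:R `^ (- (1 - 2 * rho0)) <= c / (4 * eps).
  by apply: powR_natN_small; [lra|rewrite divr_gt0// mulr_gt0].
apply: (@converges_at_rate_of_bounds _ _ _ (c / 2) (CX + L * C) (maxn N.+1 N3)).
- by rewrite divr_gt0.
- by rewrite leq_max N30 orbT.
move=> n; rewrite geq_max => /andP[Nn N3n].
have n0 : (0 < n)%N by exact: leq_trans Nn.
have q0 : 0 <= n%:R^-1 :> R by rewrite invr_ge0.
have qr : n%:R^-1 <= n%:R `^ (- (2 * rho0)) :> R by rewrite inv_le_powR// ltW.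
have P0 : 0 <= n%:R `^ (- (2 * rho0)) :> R by exact: powR_ge0.
have := zX n n0; rewrite -/(q (Y n)) distrC ler_norml => /andP[zl zu].
split.
  have h1 := hc n Nn.
  have h2 := ler_wpM2r q0 (small n (leq_trans N_N1 (ltnW Nn))).
  have h3 : n%:R^-1 <= c / (4 * eps) * n%:R `^ (- (2 * rho0)).
    have -> : n%:R^-1 = n%:R `^ (- (1 - 2 * rho0)) * n%:R `^ (- (2 * rho0)) :> R.
      rewrite -powRD ?pnatr_eq0 -?lt0n ?n0 ?implybT// -powR_inv1//.
      by congr powR; ring.
    by rewrite ler_wpM2r// hN3.
  have h4 : eps * n%:R^-1 <= c / 4 * n%:R `^ (- (2 * rho0)).
    apply: le_trans (ler_wpM2l (ltW eps0) h3) _.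
    rewrite le_eqVlt; apply/orP; left; apply/eqP; field.
    by rewrite gt_eqF.
  by move: h1 h2 h4 zl; rewrite /X'; set P := _ `^ _; lra.
have h1 := le_trans (ler_norm _) (hX n n0).
have h2 : L * C * (n%:R^-1 * n%:R `^ (- p)) <= L * C * n%:R `^ (- (2 * rho0)).
  rewrite ler_wpM2l//; apply: le_trans qr; rewrite ler_piMr//.
  by rewrite powR_natN_le1// ltW.
by move: h1 h2 zu; rewrite mulrDl; lra.
Qed.

End mode_rate.

(** * Monotone linear functionals on nonnegative functions *)

Section positive_functionals.
Local Open Scope ereal_scope.
Context {d : measure_display} {Z : measurableType d} {R : realType}.

(** The properties shared by h |-> int h(X) u and h |-> int (int h d(kernel)); such
functionals agree as soon as they agree on indicators. *)
Definition monotone_linear (I : (Z -> \bar R) -> \bar R) : Prop :=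
  [/\ forall (h1 h2 : Z -> \bar R), (forall z, 0 <= h1 z) -> measurable_fun setT h1 ->
        (forall z, 0 <= h2 z) -> measurable_fun setT h2 ->
        I (fun z => h1 z + h2 z) = I h1 + I h2,
      forall (k : R) (h : Z -> \bar R), (0 <= k)%R -> (forall z, 0 <= h z) ->
        measurable_fun setT h -> I (fun z => k%:E * h z) = k%:E * I h
    & forall (g : nat -> Z -> R) (h : Z -> \bar R),
        (forall n z, (0 <= g n z)%R) -> (forall n, measurable_fun setT (g n)) ->
        (forall z, {homo g ^~ z : m n / (m <= n)%N >-> (m <= n)%R}) ->
        (forall z, (g n z)%:E @[n --> \oo] --> h z) ->
        measurable_fun setT h ->
        I h = limn (fun n => I (fun z => (g n z)%:E))].

Import HBNNSimple.

(** Indicators, then simple functions, then increasing limits. *)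
Lemma monotone_linear_eq (I J : (Z -> \bar R) -> \bar R) :
  monotone_linear I -> monotone_linear J ->
  (forall B, measurable B -> I (fun z => (\1_B z)%:E) = J (fun z => (\1_B z)%:E)) ->
  forall h, (forall z, 0 <= h z) -> measurable_fun setT h -> I h = J h.
Proof.
move=> [ID IZ IM] [JD JZ JM] IJ h h0 mh.
have IJ0 : I (fun=> 0) = J (fun=> 0).
  have := IJ set0 measurable0.
  by under eq_fun do rewrite indic0.
have indic_ge0 (B : set Z) z : 0 <= (\1_B z)%:E :> \bar R by rewrite lee_fin.
have mindic (B : set Z) : measurable B -> measurable_fun setT (fun z => (\1_B z)%:E : \bar R).
  by move=> mB; exact/measurable_EFinP.
have IJsimple (f : {nnsfun Z >-> R}) : I (fun z => (f z)%:E) = J (fun z => (f z)%:E).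
  pose s : seq R := finmap.enum_fset (fset_set (range f)).
  pose t r (z : Z) : \bar R := r%:E * (\1_(f @^-1` [set r]) z)%:E.
  have -> : (fun z => (f z)%:E) = (fun z => \sum_(r <- s) t r z).
    apply/funext => z; rewrite fimfunE fsbig_finite//= -sumEFin.
    by apply: eq_bigr => r _; rewrite EFinM.
  have : forall r, r \in s -> (0 <= r)%R.
    by move=> r; rewrite in_fset_set// inE => -[z _ <-].
  elim: s => [_|r s IH s0].
    by under eq_fun do rewrite big_nil.
  have r0 : (0 <= r)%R by rewrite s0// mem_head.
  have s0' r' : r' \in s -> (0 <= r')%R by move=> rs; rewrite s0// in_cons rs orbT.
  have mf : measurable (f @^-1` [set r]) by [].
  under eq_fun do rewrite big_cons.
  have t0 z : 0 <= t r z by rewrite mule_ge0.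
  have mt r' : measurable_fun setT (t r') by apply: measurable_funeM; exact: mindic.
  have sum0 z : 0 <= \sum_(j <- s) t j z.
    rewrite big_seq_cond sume_ge0// => j; rewrite andbT => js.
    by rewrite mule_ge0// lee_fin s0'.
  have msum : measurable_fun setT (fun z => \sum_(j <- s) t j z) by exact: emeasurable_sum.
  by rewrite ID// JD// IH// IZ ?JZ ?IJ//; exact: mindic.
pose h_ := nnsfun_approx measurableT mh.
have hcvg z : (h_ n z)%:E @[n --> \oo] --> h z by exact: cvg_nnsfun_approx.
have hnd z : {homo (fun n => h_ n z) : m n / (m <= n)%N >-> (m <= n)%R}.
  by move=> m n mn; exact/lefP/nd_nnsfun_approx.
rewrite (IM _ _ _ _ hnd hcvg mh)//.
rewrite (JM _ _ _ _ hnd hcvg mh)//.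
by congr (limn _); apply/funext => n; exact: IJsimple.
Qed.

End positive_functionals.

Section positive_functional_instances.
Local Open Scope ereal_scope.
Context {d d' : measure_display} {Z : measurableType d} {W : measurableType d'}
  {R : realType}.
Variables (mu : {measure set W -> \bar R}) (D : set W) (mD : measurable D).

Lemma monotone_linear_weighted (X : W -> Z) (u : W -> R) :
  measurable_fun setT X -> measurable_fun setT u -> (forall w, (0 <= u w)%R) ->
  monotone_linear (fun h => \int[mu]_(w in D) (h (X w) * (u w)%:E)).
Proof.
move=> mX mu_ u0.
have mh (h : Z -> \bar R) : measurable_fun setT h ->
    measurable_fun D (fun w => h (X w) * (u w)%:E).
  move=> mh; apply: (measurable_funS measurableT) => //.
  apply: emeasurable_funM; first exact: measurableT_comp.
  exact/measurable_EFinP.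
have h_ge0 (h : Z -> \bar R) : (forall z, 0 <= h z) ->
    forall w, D w -> 0 <= h (X w) * (u w)%:E.
  by move=> h0 w _; rewrite mule_ge0// lee_fin.
split.
- move=> h1 h2 h10 mh1 h20 mh2.
  rewrite -ge0_integralD//; [|exact: h_ge0|exact: mh|exact: h_ge0|exact: mh].
  by apply: eq_integral => w _; rewrite ge0_muleDl.
- move=> k h k0 h0 mh'.
  rewrite -ge0_integralZl_EFin//; [|exact: h_ge0|exact: mh].
  by apply: eq_integral => w _; rewrite muleA.
- move=> g h g0 mg ndg gh mh'.
  rewrite -monotone_convergence//.
  + apply: eq_integral => w _; apply/esym/cvg_lim => //.
    by apply: cvgeZr => //; exact: gh.
  + by move=> n; apply: (mh (fun z => (g n z)%:E)); exact/measurable_EFinP.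
  + by move=> n w Dw; rewrite mule_ge0// lee_fin.
  + by move=> w Dw m n mn; rewrite lee_wpmul2r// lee_fin//; exact: ndg.
Qed.

Lemma monotone_linear_kernel {d2 : measure_display} {Z2 : measurableType d2}
    (kap : R.-ker Z2 ~> Z) (X : W -> Z2) : measurable_fun setT X ->
  monotone_linear (fun h => \int[mu]_(w in D) \int[kap (X w)]_y h y).
Proof.
move=> mX.
have mh (h : Z -> \bar R) : (forall z, 0 <= h z) -> measurable_fun setT h ->
    measurable_fun D (fun w => \int[kap (X w)]_y h y).
  move=> h0 mh; apply: (measurable_funS measurableT) => //.
  apply: (@measurable_fun_integral_kernel _ _ _ _ _ (fun w => kap (X w))) => // U mU.
  exact: measurableT_comp (measurable_kernel kap _ mU) _.
split.
- move=> h1 h2 h10 mh1 h20 mh2.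
  rewrite -ge0_integralD//; [|by move=> *; exact: integral_ge0|exact: mh
    |by move=> *; exact: integral_ge0|exact: mh].
  by apply: eq_integral => w _; rewrite ge0_integralD.
- move=> k h k0 h0 mh'.
  rewrite -ge0_integralZl_EFin//; [|by move=> *; exact: integral_ge0|exact: mh].
  by apply: eq_integral => w _; rewrite ge0_integralZl_EFin.
- move=> g h g0 mg ndg gh mh'.
  have mgn n : measurable_fun setT (fun z => (g n z)%:E) by exact/measurable_EFinP.
  have gn0 n z : 0 <= (g n z)%:E by rewrite lee_fin.
  have ndgn n : forall m, (n <= m)%N -> forall z, (g n z)%:E <= (g m z)%:E.
    by move=> m nm z; rewrite lee_fin; exact: ndg.
  rewrite -monotone_convergence//.
  + apply: eq_integral => w _.
    rewrite -monotone_convergence//.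
    by apply: eq_integral => z _; apply/esym/cvg_lim => //; exact: gh.
    by move=> z _ m n mn; exact: ndgn.
  + by move=> n; exact: mh.
  + by move=> n w Dw; exact: integral_ge0.
  + move=> w Dw m n mn; apply: ge0_le_integral => //.
    by move=> z _; exact: ndgn.
Qed.

End positive_functional_instances.

(** * The Markov property for functions *)

Section markov_property.
Local Open Scope ereal_scope.
Context {dZ dO : measure_display} {Z : measurableType dZ} {Omega : measurableType dO}
  {R : realType}.
Variables (P : R.-pker Z ~> Z).

Lemma sigma_of_measurable (X : nat -> {mfun Omega >-> Z}) (J : set nat) :
  sigma_of X J `<=` measurable.
Proof.
apply: smallest_sub; first exact: sigma_algebra_measurable.
move=> C [i Ji [B mB <-]]; exact: (measurable_funP (X i)).
Qed.

Lemma sigma_of_mono (X : nat -> {mfun Omega >-> Z}) (J J' : set nat) :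
  J `<=` J' -> sigma_of X J `<=` sigma_of X J'.
Proof.
move=> JJ'; apply: sub_sigma_algebra2 => C [i Ji XC].
by exists i => //; exact: JJ'.
Qed.

Lemma sigma_of_preimage (X : nat -> {mfun Omega >-> Z}) (J : set nat) i B :
  J i -> measurable B -> sigma_of X J (X i @^-1` B).
Proof.
move=> Ji mB; apply: sub_sigma_algebra; exists i => //.
by exists B => //; rewrite setTI.
Qed.

(** Chapman-Kolmogorov for functions: the last step is integrated first. *)
Lemma integral_nstepS (n : nat) (z : Z) (h : Z -> \bar R) :
  (forall y, 0 <= h y) -> measurable_fun setT h ->
  \int[nstep P n.+1 z]_y h y = \int[nstep P n z]_y \int[P y]_x h x.
Proof.
move=> h0 mh.
have m1 := monotone_linear_weighted (nstep P n.+1 z) measurableT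
  (@measurable_id _ Z setT) (@measurable_cst _ _ Z R setT 1%R) (fun=> ler01).
have m2 := monotone_linear_kernel (nstep P n z) measurableT P (@measurable_id _ Z setT).
have := monotone_linear_eq m1 m2 _ h0 mh.
under eq_integral do rewrite /cst mule1; apply => B mB.
under eq_integral do rewrite /cst mule1; rewrite integral_indic// setIT.
under [in RHS]eq_integral do rewrite integral_indic// setIT.
by [].
Qed.

Lemma integral_nstep0 (z : Z) (h : Z -> \bar R) :
  measurable_fun setT h -> \int[nstep P 0 z]_y h y = h z.
Proof. by move=> mh; rewrite /= /kdirac integral_dirac// diracT mul1e. Qed.

Lemma measurable_integral_kernel (k : R.-ker Z ~> Z) (h : Z -> \bar R) :
  (forall y, 0 <= h y) -> measurable_fun setT h ->
  measurable_fun setT (fun z => \int[k z]_y h y).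
Proof.
move=> h0 mh; apply: measurable_fun_integral_kernel => // U mU.
exact: measurable_kernel.
Qed.

Variables (Pr : probability Omega R) (Phi : nat -> {mfun Omega >-> Z}).
Hypothesis chain : markov_chain Pr P Phi.

Lemma markov_step (n : nat) (C : set Omega) (h : Z -> \bar R) :
  sigma_of Phi [set i | (i <= n)%N] C ->
  (forall y, 0 <= h y) -> measurable_fun setT h ->
  \int[Pr]_(w in C) h (Phi n.+1 w) = \int[Pr]_(w in C) \int[P (Phi n w)]_y h y.
Proof.
move=> sC h0 mh; have mC := sigma_of_measurable sC.
have m1 := monotone_linear_weighted Pr mC
  (measurable_funPT (Phi n.+1)) (@measurable_cst _ _ Omega R setT 1%R) (fun=> ler01).
have m2 := monotone_linear_kernel Pr mC P (measurable_funPT (Phi n)).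
have := monotone_linear_eq m1 m2 _ h0 mh.
under eq_integral do rewrite /cst mule1; apply => B mB.
under eq_integral do rewrite /cst mule1.
under [in RHS]eq_integral do rewrite integral_indic// setIT.
have := chain mB sC.
rewrite setIC => <-.
have -> : (fun w => (\1_B (Phi n.+1 w))%:E) =
  (fun w => (\1_(Phi n.+1 @^-1` B) w)%:E) :> (Omega -> \bar R) by [].
by rewrite integral_indic// -[X in measurable X]setTI; exact: measurable_funPT.
Qed.

(** Induction on k: an event known at time n is still known at time n + k, so that the
last step can be replaced by its conditional expectation. *)
Lemma markov_steps (k n : nat) (C : set Omega) (h : Z -> \bar R) :
  sigma_of Phi [set i | (i <= n)%N] C ->
  (forall y, 0 <= h y) -> measurable_fun setT h ->
  \int[Pr]_(w in C) h (Phi (n + k)%N w) =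
  \int[Pr]_(w in C) \int[nstep P k (Phi n w)]_y h y.
Proof.
elim: k h => [|k IH] h sC h0 mh.
  by rewrite addn0; apply: eq_integral => w _; rewrite integral_nstep0.
rewrite addnS markov_step//; last first.
  by apply: sigma_of_mono sC => i /=; move=> /leq_trans; apply; exact: leq_addr.
rewrite (IH (fun z => \int[P z]_y h y))//.
- by apply: eq_integral => w _; rewrite integral_nstepS.
- by move=> z; exact: integral_ge0.
- exact: measurable_integral_kernel.
Qed.

(** Extends [markov_steps] from past events to functions of a past state. The function
hk stands for the iterate of h and keeps the identity among finite values. *)
Lemma markov_property_ge0 (k n l : nat) (g : Z -> R) (h : Z -> R) (hk : Z -> R) :
  (l <= n)%N ->
  (forall y, (0 <= g y)%R) -> measurable_fun setT g ->
  (forall y, (0 <= h y)%R) -> measurable_fun setT h ->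
  (forall z, \int[nstep P k z]_y (h y)%:E = (hk z)%:E) ->
  \int[Pr]_w ((g (Phi l w) * h (Phi (n + k)%N w))%R)%:E =
  \int[Pr]_w ((g (Phi l w) * hk (Phi n w))%R)%:E.
Proof.
move=> ln g0 mg h0 mh hkE.
have hk0 z : (0 <= hk z)%R.
  by rewrite -lee_fin -hkE integral_ge0// => y _; rewrite lee_fin.
have mEh : measurable_fun setT (fun y => (h y)%:E) by exact/measurable_EFinP.
have Eh0 y : 0 <= (h y)%:E by rewrite lee_fin.
have mhk : measurable_fun setT hk.
  apply/measurable_EFinP; rewrite (_ : _ \o _ = fun z => \int[nstep P k z]_y (h y)%:E).
    exact: measurable_integral_kernel.
  by apply/funext => z; rewrite hkE.
have m1 := monotone_linear_weighted Pr measurableT (measurable_funPT (Phi l))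
  (measurableT_comp mh (measurable_funPT (Phi (n + k)%N))) (fun w => h0 _).
have m2 := monotone_linear_weighted Pr measurableT (measurable_funPT (Phi l))
  (measurableT_comp mhk (measurable_funPT (Phi n))) (fun w => hk0 _).
have H := monotone_linear_eq m1 m2 _ (h := fun y => (g y)%:E).
under eq_integral do rewrite EFinM; under [in RHS]eq_integral do rewrite EFinM.
apply: H => [B mB|y|]; [|by rewrite lee_fin|exact/measurable_EFinP].
have sC : sigma_of Phi [set i | (i <= n)%N] (Phi l @^-1` B).
  exact: sigma_of_preimage.
have mC := sigma_of_measurable sC.
have E (u : Omega -> R) : \int[Pr]_w ((\1_B (Phi l w))%:E * (u w)%:E) =
    \int[Pr]_(w in Phi l @^-1` B) (u w)%:E.
  rewrite [RHS]integral_mkcond; apply: eq_integral => w _.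
  rewrite /patch; case: ifPn => [|]; rewrite ?inE => wB.
    by rewrite indicE mem_set// mul1e.
  by rewrite indicE memNset ?mul0e// => Bw; move: wB; rewrite notin_setE.
rewrite !E/=; rewrite (markov_steps k sC Eh0 mEh).
by apply: eq_integral => w _; rewrite hkE.
Qed.

End markov_property.

(** * Ergodicity in the norms of V and sqrt V *)

Section dominated_functions.
Context {d : measure_display} {Z : measurableType d} {R : realType}.

Definition dominated_by (W f : Z -> R) : Prop :=
  measurable_fun setT f /\ exists2 c : R, 0 <= c & forall z, `|f z| <= c * W z.

Lemma dominated_integrable (mu : {measure set Z -> \bar R}) (W f : Z -> R) :
  (forall z, 0 <= W z) -> mu.-integrable setT (EFin \o W) -> dominated_by W f ->
  mu.-integrable setT (EFin \o f).
Proof.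
move=> W0 iW [mf [c c0 fW]].
apply: (@le_integrable _ _ _ mu setT measurableT _ (fun z => c%:E * (W z)%:E)%E).
- exact/measurable_EFinP.
- move=> z _ /=; rewrite lee_fin (le_trans (fW z))// ger0_norm// mulr_ge0//.
- exact: integrableZl.
Qed.

Lemma VnormP (V g : Z -> R) : (forall z, 1 <= V z) -> (Vnorm V g < +oo)%E ->
  exists2 c : R, 0 <= c & forall z, `|g z| <= c * V z.
Proof.
move=> V1 gV; have V0 z : 0 < V z by exact: lt_le_trans (V1 z).
have ub z : ((`|g z| / V z)%:E <= Vnorm V g)%E.
  by apply: ereal_sup_ubound; exists z.
have Vn0 : (0 <= Vnorm V g)%E.
  by apply: le_trans (ub point); rewrite lee_fin divr_ge0// ltW.
have Vfin : Vnorm V g \is a fin_num by rewrite ge0_fin_numE.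
exists (fine (Vnorm V g)); first exact: fine_ge0.
move=> z; rewrite -ler_pdivrMr//; have := ub z.
by rewrite -[Vnorm V g]fineK// lee_fin.
Qed.

Lemma Vnorm_le (V g : Z -> R) (c : R) : (forall z, 1 <= V z) ->
  (forall z, `|g z| <= c * V z) -> (Vnorm V g <= c%:E)%E.
Proof.
move=> V1 gV; apply: ge_ereal_sup => _ [z _ <-].
by rewrite lee_fin ler_pdivrMr// (lt_le_trans _ (V1 z)).
Qed.

End dominated_functions.

Section ergodic_kernel.
Context {d : measure_display} {Z : measurableType d} {R : realType}.
Variables (V : Z -> R) (P : R.-pker Z ~> Z) (pi : probability Z R).
Hypotheses (mV : measurable_fun setT V) (V1 : forall z, 1 <= V z).

Let V0 z : 0 <= V z. Proof. exact: le_trans (V1 z). Qed.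

Definition kernel_power (n : nat) (f : Z -> R) (z : Z) : R :=
  \int[nstep P n z]_y f y.

Definition ergodic_bounds (rho B M : R) : Prop :=
  [/\ 0 < rho < 1, 0 <= B, 0 <= M,
      pi.-integrable setT (EFin \o V) &
      forall n z, (nstep P n z).-integrable setT (EFin \o V) /\
                  kernel_power n V z <= M * V z] /\
  forall (g : Z -> R) c, 0 <= c -> measurable_fun setT g -> (forall z, `|g z| <= c * V z) ->
    forall n z, `|kernel_power n g z - \int[pi]_y g y| <= B * c * rho ^+ n * V z.

(** For g = V the definition implies that V is integrable for pi and for each law
P^n(z, .): if one of the integrals were infinite, so would be the difference. Everything
dominated by V is then integrable, and the bound becomes one between real numbers. *)
Lemma V_uniformly_ergodic_bounds : V_uniformly_ergodic V P pi ->
  exists rho B M : R, ergodic_bounds rho B M.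
Proof.
move=> [rho [B [rho0 rho1 erg]]].
have mEV : measurable_fun setT (EFin \o V) by exact/measurable_EFinP.
have VV z : `|V z| <= 1 * V z by rewrite mul1r ger0_norm.
have LV : LVinfty V V by split=> //; rewrite (le_lt_trans (Vnorm_le V1 VV))// ltry.
have Vn0 g : (0 <= Vnorm V g)%E.
  apply: (@le_trans _ _ (`|g point| / V point)%:E).
    by rewrite lee_fin divr_ge0.
  by apply: ereal_sup_ubound; exists point.
have errbd (g : Z -> R) c : (forall z, `|g z| <= c * V z) -> forall n z,
    (B%:E * Vnorm V g * (rho ^+ n * V z)%:E <= (`|B| * c * rho ^+ n * V z)%:E)%E.
  move=> gc n z; have gn := Vnorm_le V1 gc.
  have gfin : Vnorm V g \is a fin_num.
    by rewrite ge0_fin_numE// (le_lt_trans gn)// ltry.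
  have g0 := Vn0 g.
  rewrite -[Vnorm V g]fineK// in gn g0 *; rewrite -!EFinM lee_fin.
  rewrite lee_fin in gn; rewrite lee_fin in g0.
  rewrite mulrA ler_wpM2r// ler_wpM2r ?exprn_ge0 ?(ltW rho0)//.
  by apply: le_trans (ler_wpM2l (normr_ge0 B) gn); rewrite ler_wpM2r ?ler_norm.
have EV0 z : (0 <= (V z)%:E)%E by rewrite lee_fin.
have iV0 (mu : {measure set Z -> \bar R}) : (0 <= \int[mu]_y (V y)%:E)%E.
  by apply: integral_ge0.
have finV n z : ((\int[nstep P n z]_y (V y)%:E < +oo) /\ (\int[pi]_y (V y)%:E < +oo))%E.
  have := le_trans (erg V LV z n) (errbd V 1 VV n z).
  move: (iV0 (nstep P n z)) (iV0 pi).
  case: (\int[nstep P n z]_y (V y)%:E)%E => [x| |]//;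
  by case: (\int[pi]_y (V y)%:E)%E => [y| |]//; rewrite !ltry.
have ipi : pi.-integrable setT (EFin \o V).
  apply/integrableP; split=> //.
  rewrite (eq_integral (fun z => (V z)%:E))//; last first.
    by move=> y _; exact: gee0_abs (EV0 y).
  by have [_] := finV 0%N point.
have iP n z : (nstep P n z).-integrable setT (EFin \o V).
  apply/integrableP; split=> //.
  rewrite (eq_integral (fun z => (V z)%:E))//; last first.
    by move=> y _; exact: gee0_abs (EV0 y).
  by have [] := finV n z.
have bound (g : Z -> R) c : 0 <= c -> measurable_fun setT g -> (forall z, `|g z| <= c * V z) ->
    forall n z, `|kernel_power n g z - \int[pi]_y g y| <= `|B| * c * rho ^+ n * V z.
  move=> c0 mg gc n z.
  have Lg : LVinfty V g by split=> //; rewrite (le_lt_trans (Vnorm_le V1 gc))// ltry.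
  have dg : dominated_by V g by split=> //; exists c.
  have := le_trans (erg g Lg z n) (errbd g c gc n z).
  have fin1 := integrable_fin_num measurableT (dominated_integrable V0 (iP n z) dg).
  have fin2 := integrable_fin_num measurableT (dominated_integrable V0 ipi dg).
  rewrite /kernel_power /Rintegral.
  by rewrite -(fineK fin1) -(fineK fin2) -EFinB abse_EFin lee_fin.
have piV0 : 0 <= \int[pi]_y V y by exact: Rintegral_ge0.
exists rho, `|B|, (`|B| + \int[pi]_y V y); split=> //; split=> //.
- by rewrite rho0.
- by rewrite addr_ge0.
- move=> n z; split=> //.
  have := bound V 1 ler01 mV VV n z; rewrite ler_norml => /andP[_ h].
  have rn : rho ^+ n <= 1 by rewrite exprn_ile1// ltW.
  have h1 : `|B| * 1 * rho ^+ n * V z <= `|B| * V z.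
    by rewrite mulr1 ler_wpM2r// ler_piMr.
  have h2 : \int[pi]_y V y <= (\int[pi]_y V y) * V z by rewrite ler_peMr.
  by move: h h1 h2; rewrite mulrDl; lra.
Qed.

End ergodic_kernel.

Section sqrt_ergodicity.
Context {d : measure_display} {Z : measurableType d} {R : realType}.

Lemma Rintegral_bound (mu : {measure set Z -> \bar R}) (g : Z -> R) (T : R) :
  (mu setT <= 1)%E -> 0 <= T -> measurable_fun setT g -> (forall z, `|g z| <= T) ->
  `|\int[mu]_y g y| <= T.
Proof.
move=> mu1 T0 mg gT.
have iT : mu.-integrable setT (EFin \o cst T).
  apply/integrableP; split; first exact/measurable_EFinP.
  rewrite /= integral_cst// (le_lt_trans _ (ltry (`|T| * 1)))//.
  by rewrite EFinM lee_wpmul2l// lee_fin.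
have ig : mu.-integrable setT (EFin \o g).
  apply: (le_integrable measurableT _ _ iT); first exact/measurable_EFinP.
  by move=> z _ /=; rewrite lee_fin (le_trans (gT z))// ler_norm.
apply: le_trans (le_normr_Rintegral measurableT ig) _.
apply: (@le_trans _ _ (\int[mu]_y cst T y)).
  by apply: le_Rintegral => //; exact: integrable_norm.
rewrite /= Rintegral_cst// ler_piMr//.
have muf : mu setT \is a fin_num by rewrite ge0_fin_numE// (le_lt_trans mu1)// ltry.
by rewrite -lee_fin fineK.
Qed.

Lemma dominated_byZ (W f : Z -> R) (t : R) :
  dominated_by W f -> dominated_by W (fun z => t * f z).
Proof.
move=> [mf [c c0 fc]]; split; first exact: measurable_funM.
exists (`|t| * c) => [|z]; first exact: mulr_ge0.
by rewrite normrM -mulrA ler_wpM2l.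
Qed.

Lemma dominated_by_pos (W f : Z -> R) : dominated_by W f ->
  dominated_by W (fun z => Num.max (f z) 0).
Proof.
move=> [mf [c c0 fc]]; split; first exact: measurable_maxr.
exists c => // z; apply: le_trans (fc z).
by rewrite ger0_norm ?le_max ?lexx ?orbT// ge_max ler_norm normr_ge0.
Qed.

Variables (V : Z -> R) (P : R.-pker Z ~> Z) (pi : probability Z R).
Hypotheses (mV : measurable_fun setT V) (V1 : forall z, 1 <= V z).
Variables (rho B M : R).
Hypothesis erg : ergodic_bounds V P pi rho B M.

Let V0 z : 0 <= V z. Proof. exact: le_trans (V1 z). Qed.
Let W z := Num.sqrt (V z).
Let W0 z : 0 <= W z. Proof. exact: sqrtr_ge0. Qed.
Let WW z : W z * W z = V z. Proof. by rewrite -expr2 sqr_sqrtr. Qed.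
Let W1 z : 1 <= W z. Proof. by rewrite -sqrtr1 ler_wsqrtr. Qed.
Let WV z : W z <= V z. Proof. by rewrite -WW ler_peMl. Qed.

Lemma dominated_sqrt (f : Z -> R) : dominated_by W f -> dominated_by V f.
Proof.
move=> [mf [c c0 fc]]; split=> //; exists c => // z.
by rewrite (le_trans (fc z))// ler_wpM2l.
Qed.

Lemma dominated_sqrtM (f g : Z -> R) : dominated_by W f -> dominated_by W g ->
  dominated_by V (fun z => f z * g z).
Proof.
move=> [mf [c c0 fc]] [mg [e e0 ge]]; split; first exact: measurable_funM.
exists (c * e) => [|z]; first exact: mulr_ge0.
by rewrite normrM -WW mulrACA ler_pM.
Qed.

Lemma kernel_power_integrable n z (f : Z -> R) : dominated_by V f ->
  (nstep P n z).-integrable setT (EFin \o f).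
Proof.
move=> df; apply: dominated_integrable df => //.
by have [[_ _ _ _ h] _] := erg; have [] := h n z.
Qed.

Lemma invariant_integrable (f : Z -> R) : dominated_by V f ->
  pi.-integrable setT (EFin \o f).
Proof.
by move=> df; apply: dominated_integrable df => //; have [[]] := erg.
Qed.

Lemma kernel_powerE n z (f : Z -> R) : dominated_by V f ->
  (\int[nstep P n z]_y (f y)%:E = (kernel_power P n f z)%:E)%E.
Proof.
move=> df; rewrite /kernel_power /Rintegral fineK//.
exact: integrable_fin_num (kernel_power_integrable n z df).
Qed.

Lemma kernel_powerB n (f g : Z -> R) z : dominated_by V f -> dominated_by V g ->
  kernel_power P n (fun y => f y - g y) z = kernel_power P n f z - kernel_power P n g z.
Proof.
by move=> df dg; rewrite /kernel_power RintegralB//; exact: kernel_power_integrable.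
Qed.

(** The negative part is the positive part of - f, so that [dominated_by_pos] covers both. *)
Lemma pos_negE (f : Z -> R) z : f z = Num.max (f z) 0 - Num.max (- 1 * f z) 0.
Proof.
rewrite mulN1r; have [f0|f0] := leP 0 (f z).
  by rewrite (max_r (_ : - f z <= 0)) ?oppr_le0// subr0.
by rewrite (max_l (_ : 0 <= - f z)) ?oppr_ge0 ?(ltW f0)// sub0r opprK.
Qed.

Lemma measurable_kernel_power n (f : Z -> R) : dominated_by V f ->
  measurable_fun setT (kernel_power P n f).
Proof.
move=> df.
have dp := dominated_by_pos df.
have dn := dominated_by_pos (dominated_byZ (- 1) df).
have mpos (g : Z -> R) : (forall z, 0 <= g z) -> dominated_by V g ->
    measurable_fun setT (kernel_power P n g).
  move=> g0 dg; apply/measurable_EFinP.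
  rewrite (_ : _ \o _ = fun z => (\int[nstep P n z]_y (g y)%:E)%E).
    apply: measurable_integral_kernel => [y|]; first by rewrite lee_fin.
    by apply/measurable_EFinP; case: dg.
  by apply/funext => z; rewrite kernel_powerE.
rewrite (_ : kernel_power P n f = fun z =>
  kernel_power P n (fun z => Num.max (f z) 0) z -
  kernel_power P n (fun z => Num.max (- 1 * f z) 0) z).
  by apply: measurable_funB; apply: mpos => // z; rewrite le_max lexx orbT.
apply/funext => z; rewrite -kernel_powerB//; congr (kernel_power P n _ z).
by apply/funext => y; exact: pos_negE.
Qed.

Let r := Num.sqrt rho.

Lemma sqrt_rate_bounds : [/\ 0 < r, r < 1, rho = r ^+ 2 & rho <= r].
Proof.
have [[/andP[rho0 rho1] _ _ _ _] _] := erg.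
have r0 : 0 < r by rewrite sqrtr_gt0.
have rE : rho = r ^+ 2 by rewrite sqr_sqrtr// ltW.
have r1 : r < 1 by rewrite -sqrtr1 ltr_sqrt.
by split=> //; rewrite {1}rE expr2 ler_piMl ?ltW.
Qed.

(** The height T = r^n sqrt (V z) balances the two errors: 2 T for the truncated
function, and B c^2 rho^n V z / T = B c^2 T for the rest, because a function cut at
height T loses at most f^2 / T. *)
Lemma sqrt_decay (f : Z -> R) (c : R) : 0 <= c -> measurable_fun setT f ->
  (forall z, `|f z| <= c * W z) -> forall n z,
  `|kernel_power P n f z - \int[pi]_y f y| <= (2 + B * c ^+ 2) * r ^+ n * W z.
Proof.
move=> c0 mf fW n z; have [[_ B0 _ _ _] bnd] := erg.
have [r0 r1 rE _] := sqrt_rate_bounds.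
have Wz0 : 0 < W z by exact: lt_le_trans (W1 z).
pose T := r ^+ n * W z; have T0 : 0 < T by rewrite mulr_gt0// exprn_gt0.
pose f1 y := Num.max (Num.min (f y) T) (- T).
pose f2 y := f y - f1 y.
have mf1 : measurable_fun setT f1 by apply: measurable_maxr => //; exact: measurable_minr.
have mf2 : measurable_fun setT f2 by exact: measurable_funB.
have f1T y : `|f1 y| <= T.
  rewrite ler_norml /f1 le_max lexx orbT ge_max ge_min lexx orbT/=.
  by rewrite (le_trans _ (ltW T0))// oppr_le0 ltW.
have f2V y : `|f2 y| <= (c ^+ 2 / T) * V y.
  have fy2 : f y ^+ 2 <= c ^+ 2 * V y.
    rewrite -WW -expr2 -exprMn -[f y ^+ 2]real_normK ?num_real//.
    by rewrite ler_pXn2r ?nnegrE ?mulr_ge0.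
  rewrite mulrAC ler_pdivlMr//; apply: le_trans fy2.
  rewrite /f2 /f1; have [h1|h1] := leP (f y) T.
    have [h2|h2] := leP (- T) (f y).
      by rewrite subrr normr0 mul0r sqr_ge0.
    by rewrite ler0_norm; [|lra]; nra.
  rewrite max_l; last by rewrite (le_trans _ (ltW T0))// oppr_le0 ltW.
  by rewrite gtr0_norm ?subr_gt0//; nra.
have d1 : dominated_by V f1.
  split=> //; exists T => [|y]; first exact: ltW.
  by rewrite (le_trans (f1T y))// ler_peMr// ltW.
have cT0 : 0 <= c ^+ 2 / T by rewrite divr_ge0 ?sqr_ge0// ltW.
have d2 : dominated_by V f2 by split=> //; exists (c ^+ 2 / T).
have fE : f = (fun y => f1 y + f2 y) by apply/funext => y; rewrite /f2 addrC subrK.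
have -> : kernel_power P n f z - \int[pi]_y f y =
   kernel_power P n f1 z - \int[pi]_y f1 y +
   (kernel_power P n f2 z - \int[pi]_y f2 y).
  rewrite {1 2}fE /kernel_power RintegralD//; [|exact: kernel_power_integrable..].
  by rewrite RintegralD//; [ring|exact: invariant_integrable..].
apply: le_trans (ler_normD _ _) _; rewrite -mulrA mulrDl lerD//.
  rewrite -/T mulr_natl mulr2n (le_trans (ler_normB _ _))// lerD//.
    exact: (Rintegral_bound (sprob_kernel_le1 _ _) (ltW T0)).
  exact: (Rintegral_bound (probability_le1 _ measurableT) (ltW T0)).
apply: le_trans (bnd f2 _ cT0 mf2 f2V n z) _.
rewrite le_eqVlt; apply/orP; left; apply/eqP.
rewrite -WW rE -exprM mulnC exprM /T; field.
by rewrite !gt_eqF ?exprn_gt0.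
Qed.

Lemma kernel_power_dominated n (f : Z -> R) : dominated_by W f ->
  dominated_by W (kernel_power P n f).
Proof.
move=> df; split; first exact/measurable_kernel_power/dominated_sqrt.
have [mf [c c0 fc]] := df; have [[_ B0 _ _ _] _] := erg.
have [r0 r1 _ _] := sqrt_rate_bounds.
have h0 : 0 <= 2 + B * c ^+ 2 by rewrite addr_ge0// mulr_ge0// sqr_ge0.
exists (2 + B * c ^+ 2 + `|\int[pi]_y f y|) => [|z]; first by rewrite addr_ge0.
have h := sqrt_decay c0 mf fc n z.
have h1 : (2 + B * c ^+ 2) * r ^+ n * W z <= (2 + B * c ^+ 2) * W z.
  by rewrite ler_wpM2r// ler_piMr// exprn_ile1// ltW.
have h2 : `|\int[pi]_y f y| <= `|\int[pi]_y f y| * W z by rewrite ler_peMr.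
rewrite -[kernel_power P n f z](subrK (\int[pi]_y f y)).
apply: le_trans (ler_normD _ _) _; rewrite mulrDl lerD//.
exact: le_trans h h1.
Qed.

End sqrt_ergodicity.

(** * Square-integrable functions along the chain *)

Section square_integrable.
Context {d : measure_display} {W : measurableType d} {R : realType}.
Variable (Pr : probability W R).
Implicit Types F G : W -> R.

Definition square_integrable F : Prop :=
  measurable_fun setT F /\ Pr.-integrable setT (EFin \o (fun w => F w ^+ 2)).

Lemma integrableD_fin F G : Pr.-integrable setT (EFin \o F) ->
  Pr.-integrable setT (EFin \o G) -> Pr.-integrable setT (EFin \o (fun w => F w + G w)).
Proof.
move=> iF iG; have := integrableD measurableT iF iG.
by apply: eq_integrable => // w _ /=; rewrite EFinD.
Qed.

Lemma integrableZ_fin F t : Pr.-integrable setT (EFin \o F) ->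
  Pr.-integrable setT (EFin \o (fun w => t * F w)).
Proof.
move=> iF; have := integrableZl measurableT t iF.
by apply: eq_integrable => // w _ /=; rewrite EFinM.
Qed.

Lemma square_integrableM F G : square_integrable F -> square_integrable G ->
  Pr.-integrable setT (EFin \o (fun w => F w * G w)).
Proof.
move=> [mF iF] [mG iG].
have iFG := integrableD measurableT iF iG.
apply: (le_integrable measurableT _ _ iFG).
  by apply/measurable_EFinP; exact: measurable_funM.
move=> w _; rewrite /= lee_fin [leRHS]ger0_norm ?addr_ge0 ?sqr_ge0// ler_norml.
have h1 := sqr_ge0 (F w + G w); have h2 := sqr_ge0 (F w - G w).
by apply/andP; split; nra.
Qed.

Lemma square_integrableD F G : square_integrable F -> square_integrable G ->
  square_integrable (fun w => F w + G w).
Proof.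
move=> sF sG; have [mF iF] := sF; have [mG iG] := sG.
split; first exact: measurable_funD.
have iFG := square_integrableM sF sG.
have := integrableD measurableT (integrableD measurableT iF iG)
  (integrableD measurableT iFG iFG).
apply: eq_integrable => // w _ /=; rewrite -!EFinD; congr EFin; ring.
Qed.

Lemma square_integrableZ F t : square_integrable F ->
  square_integrable (fun w => t * F w).
Proof.
move=> [mF iF]; split; first exact: measurable_funM.
have := integrableZl measurableT (t ^+ 2) iF.
by apply: eq_integrable => // w _ /=; rewrite -EFinM exprMn.
Qed.

Lemma square_integrable_cst t : square_integrable (fun=> t).
Proof.
split; first exact: measurable_cst.
by apply: (@finite_measure_integrable_cst _ _ _ Pr setT (t ^+ 2)).
Qed.

Lemma RintegralDl F G H : square_integrable F -> square_integrable G ->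
  square_integrable H ->
  \int[Pr]_w ((F w + G w) * H w) = \int[Pr]_w (F w * H w) + \int[Pr]_w (G w * H w).
Proof.
move=> sF sG sH; rewrite -RintegralD//; [|exact: square_integrableM..].
by apply: eq_Rintegral => w _; rewrite mulrDl.
Qed.

Lemma RintegralZll F H t : square_integrable F -> square_integrable H ->
  \int[Pr]_w (t * F w * H w) = t * \int[Pr]_w (F w * H w).
Proof.
move=> sF sH; rewrite -RintegralZl//; last exact: square_integrableM.
by apply: eq_Rintegral => w _; rewrite mulrA.
Qed.

Lemma discriminant_le (a b c : R) : 0 <= a -> 0 <= c ->
  (forall t, 0 <= a + 2 * b * t + c * t ^+ 2) -> b ^+ 2 <= a * c.
Proof.
move=> a0 c0 h; have [c_eq0|cn0] := eqVneq c 0.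
  have [->|bn0] := eqVneq b 0; first by rewrite expr0n mulr_ge0.
  (* the affine polynomial a + 2 b t takes the value -1 here *)
  have := h (- (a + 1) / (2 * b)); rewrite c_eq0 mul0r addr0.
  rewrite [X in a + X](_ : _ = - (a + 1)); first by rewrite opprD addrA subrr; lra.
  by field.
have cp : 0 < c by rewrite lt_neqAle eq_sym cn0.
(* the minimum of the polynomial *)
have := h (- b / c).
rewrite (_ : _ + _ = (a * c - b ^+ 2) / c); last by field.
by rewrite pmulr_lge0 ?invr_gt0// subr_ge0.
Qed.

Lemma cauchy_schwarz_Rintegral F G : square_integrable F -> square_integrable G ->
  `|\int[Pr]_w (F w * G w)| <=
  Num.sqrt (\int[Pr]_w (F w ^+ 2)) * Num.sqrt (\int[Pr]_w (G w ^+ 2)).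
Proof.
move=> sF sG; have [_ iF] := sF; have [_ iG] := sG.
set a := \int[Pr]_w (F w ^+ 2); set c := \int[Pr]_w (G w ^+ 2).
have a0 : 0 <= a by apply: Rintegral_ge0 => w _; exact: sqr_ge0.
have c0 : 0 <= c by apply: Rintegral_ge0 => w _; exact: sqr_ge0.
rewrite -sqrtrM// -sqrtr_sqr ler_wsqrtr//; apply: discriminant_le => // t.
have -> : a + 2 * \int[Pr]_w (F w * G w) * t + c * t ^+ 2 =
   \int[Pr]_w ((F w + t * G w) ^+ 2).
  have iFG := square_integrableM sF sG.
  transitivity (\int[Pr]_w (F w ^+ 2 + (2 * t * (F w * G w) + t ^+ 2 * G w ^+ 2))).
    have i1 := integrableZ_fin (2 * t) iFG.
    have i2 := integrableZ_fin (t ^+ 2) iG.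
    rewrite (RintegralD measurableT iF (integrableD_fin i1 i2)).
    rewrite (RintegralD measurableT i1 i2).
    rewrite (RintegralZl _ measurableT iFG) (RintegralZl _ measurableT iG).
    by rewrite /a /c; ring.
  by apply: eq_Rintegral => w _; ring.
by apply: Rintegral_ge0 => w _; exact: sqr_ge0.
Qed.

End square_integrable.

Section chain_moments.
Context {dZ dO : measure_display} {Z : measurableType dZ} {Omega : measurableType dO}
  {R : realType}.
Variables (V : Z -> R) (P : R.-pker Z ~> Z) (pi : probability Z R).
Hypotheses (mV : measurable_fun setT V) (V1 : forall z, 1 <= V z).
Variables (rho B M : R).
Hypothesis erg : ergodic_bounds V P pi rho B M.
Let W z := Num.sqrt (V z).

Variables (Pr : probability Omega R) (X : nat -> {mfun Omega >-> Z}).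
Hypothesis chain : markov_chain Pr P X.
Hypothesis iVX : forall n, Pr.-integrable setT (EFin \o (V \o X n)).

Let V0 z : 0 <= V z. Proof. exact: le_trans (V1 z). Qed.
Let WW z : W z * W z = V z. Proof. by rewrite -expr2 sqr_sqrtr. Qed.

Lemma square_integrable_comp n (f : Z -> R) : dominated_by W f ->
  square_integrable Pr (fun w => f (X n w)).
Proof.
move=> [mf [c c0 fc]].
have mfX : measurable_fun setT (fun w => f (X n w)).
  exact: (measurableT_comp mf (measurable_funPT (X n))).
split=> //.
have icV := integrableZ_fin (c ^+ 2) (iVX n).
apply: (le_integrable measurableT _ _ icV).
  by apply/measurable_EFinP; exact: measurable_funX.
move=> w _; rewrite /= lee_fin !ger0_norm ?sqr_ge0 ?mulr_ge0 ?sqr_ge0//.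
rewrite -WW -expr2 -exprMn -[f _ ^+ 2]real_normK ?num_real//.
by rewrite ler_pXn2r ?nnegrE ?mulr_ge0 ?sqrtr_ge0.
Qed.

Lemma markov_pair_ge0 k n l (g f : Z -> R) : (l <= n)%N ->
  (forall z, 0 <= g z) -> (forall z, 0 <= f z) ->
  dominated_by W g -> dominated_by W f ->
  \int[Pr]_w (g (X l w) * f (X (n + k)%N w)) =
  \int[Pr]_w (g (X l w) * kernel_power P k f (X n w)).
Proof.
move=> ln g0 f0 dg df; congr fine.
apply: (markov_property_ge0 chain ln g0 dg.1 f0 df.1) => z.
exact: (kernel_powerE V1 erg) (dominated_sqrt V1 df).
Qed.

Lemma markov_pair k n l (g f : Z -> R) : (l <= n)%N ->
  dominated_by W g -> dominated_by W f ->
  \int[Pr]_w (g (X l w) * f (X (n + k)%N w)) =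
  \int[Pr]_w (g (X l w) * kernel_power P k f (X n w)).
Proof.
move=> ln.
have max0 (h : Z -> R) z : 0 <= Num.max (h z) 0 by rewrite le_max lexx orbT.
have gpos (g' f' : Z -> R) : (forall z, 0 <= g' z) -> dominated_by W g' -> dominated_by W f' ->
  \int[Pr]_w (g' (X l w) * f' (X (n + k)%N w)) =
  \int[Pr]_w (g' (X l w) * kernel_power P k f' (X n w)).
  move=> g0 dg df.
  have dp := dominated_by_pos df; have dn := dominated_by_pos (dominated_byZ (- 1) df).
  have kp := kernel_power_dominated V1 erg k dp.
  have kn := kernel_power_dominated V1 erg k dn.
  have sg := square_integrable_comp l dg.
  transitivity (\int[Pr]_w (g' (X l w) * Num.max (f' (X (n + k)%N w)) 0 -
     g' (X l w) * Num.max (- 1 * f' (X (n + k)%N w)) 0)).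
    by apply: eq_Rintegral => w _; rewrite -mulrBr -pos_negE.
  have i1 := square_integrableM sg (square_integrable_comp (n + k)%N dp).
  have i2 := square_integrableM sg (square_integrable_comp (n + k)%N dn).
  rewrite (RintegralB measurableT i1 i2).
  rewrite (markov_pair_ge0 k ln g0 (max0 _) dg dp) (markov_pair_ge0 k ln g0 (max0 _) dg dn).
  have i3 := square_integrableM sg (square_integrable_comp n kp).
  have i4 := square_integrableM sg (square_integrable_comp n kn).
  rewrite -(RintegralB measurableT i3 i4).
  apply: eq_Rintegral => w _; rewrite -mulrBr; congr (_ * _).
  rewrite -(kernel_powerB V1 erg); [|exact: (dominated_sqrt V1)..].
  by congr (kernel_power P k _ _); apply/funext => z; rewrite -pos_negE.
move=> dg df.
have dp := dominated_by_pos dg; have dn := dominated_by_pos (dominated_byZ (- 1) dg).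
have E (h : Omega -> R) : square_integrable Pr h ->
  \int[Pr]_w (g (X l w) * h w) = \int[Pr]_w (Num.max (g (X l w)) 0 * h w) -
    \int[Pr]_w (Num.max (- 1 * g (X l w)) 0 * h w).
  move=> sh.
  rewrite -(RintegralB measurableT
    (square_integrableM (square_integrable_comp l dp) sh)
    (square_integrableM (square_integrable_comp l dn) sh)).
  by apply: eq_Rintegral => w _; rewrite -mulrBl -pos_negE.
rewrite (E _ (square_integrable_comp (n + k)%N df)).
rewrite (E _ (square_integrable_comp n (kernel_power_dominated V1 erg k df))).
by rewrite (gpos _ f (max0 g) dp df) (gpos _ f (max0 (fun z => - 1 * g z)) dn df).
Qed.

(** The consequence of measurability with respect to the past that matters here: in a
product with F, future noise may be replaced by its conditional expectation. In this
form it is visibly stable under linear combinations. *)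
Definition adapted (n : nat) (F : Omega -> R) : Prop :=
  square_integrable Pr F /\
  forall (m k : nat) (f : Z -> R), (n <= m)%N -> dominated_by W f ->
    \int[Pr]_w (F w * f (X (m + k)%N w)) =
    \int[Pr]_w (F w * kernel_power P k f (X m w)).

Lemma adapted_mono n n' F : (n <= n')%N -> adapted n F -> adapted n' F.
Proof.
move=> nn' [sF aF]; split=> // m k f n'm; apply: aF; exact: leq_trans n'm.
Qed.

Lemma adapted_comp n (g : Z -> R) : dominated_by W g ->
  adapted n (fun w => g (X n w)).
Proof.
move=> dg; split; first exact: square_integrable_comp.
by move=> m k f nm df; exact: markov_pair.
Qed.

Lemma adaptedD n F G : adapted n F -> adapted n G -> adapted n (fun w => F w + G w).
Proof.
move=> [sF aF] [sG aG]; split; first exact: square_integrableD.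
move=> m k f nm df.
have s1 := square_integrable_comp (m + k)%N df.
have s2 := square_integrable_comp m (kernel_power_dominated V1 erg k df).
by rewrite (RintegralDl sF sG s1) (RintegralDl sF sG s2) aF// aG.
Qed.

Lemma adaptedZ n F t : adapted n F -> adapted n (fun w => t * F w).
Proof.
move=> [sF aF]; split; first exact: square_integrableZ.
move=> m k f nm df.
have s1 := square_integrable_comp (m + k)%N df.
have s2 := square_integrable_comp m (kernel_power_dominated V1 erg k df).
by rewrite (RintegralZll _ sF s1) (RintegralZll _ sF s2) aF.
Qed.

Lemma dominated_cst t : dominated_by W (fun=> t).
Proof.
split; first exact: measurable_cst.
exists `|t| => // z; rewrite ler_peMr//.
by rewrite -sqrtr1 ler_wsqrtr.
Qed.

Lemma adapted_cst n t : adapted n (fun=> t).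
Proof.
have := adapted_comp n (dominated_cst t).
exact.
Qed.

Lemma adapted_sum n (I : Type) (s : seq I) (F : I -> Omega -> R) :
  (forall i, adapted n (F i)) -> adapted n (fun w => \sum_(i <- s) F i w).
Proof.
move=> aF; elim: s => [|i s IH].
  by under eq_fun do rewrite big_nil; exact: adapted_cst.
by under eq_fun do rewrite big_cons; exact: adaptedD.
Qed.

End chain_moments.

(** * Second-moment matrices *)

Section second_moments.
Context {dW : measure_display} {W : measurableType dW} {R : realType}.
Variable (Pr : probability W R).

Definition square_integrable_vec {p : nat} (F : W -> 'cV[R]_p) : Prop :=
  forall i, square_integrable Pr (fun w => F w i 0).

Definition second_moment {p q : nat} (F : W -> 'cV[R]_p) (G : W -> 'cV[R]_q) :
  'M[R]_(p, q) := \matrix_(i, j) \int[Pr]_w (F w i 0 * G w j 0).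

Lemma square_integrable_sum (I : Type) (s : seq I) (F : I -> W -> R) :
  (forall i, square_integrable Pr (F i)) ->
  square_integrable Pr (fun w => \sum_(i <- s) F i w).
Proof.
move=> sF; elim: s => [|i s IH].
  by under eq_fun do rewrite big_nil; exact: square_integrable_cst.
by under eq_fun do rewrite big_cons; exact: square_integrableD.
Qed.

Lemma Rintegral_suml (I : Type) (s : seq I) (F : I -> W -> R) (H : W -> R) :
  (forall i, square_integrable Pr (F i)) -> square_integrable Pr H ->
  \int[Pr]_w ((\sum_(i <- s) F i w) * H w) = \sum_(i <- s) \int[Pr]_w (F i w * H w).
Proof.
move=> sF sH; elim: s => [|i s IH].
  rewrite big_nil; under eq_Rintegral do rewrite big_nil mul0r.
  by rewrite Rintegral_cst// mul0r.
rewrite big_cons -IH -RintegralDl//; last exact: square_integrable_sum.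
by apply: eq_Rintegral => w _; rewrite big_cons.
Qed.

Lemma square_integrable_mulmx {p q : nat} (A : 'M[R]_(p, q)) (F : W -> 'cV[R]_q) :
  square_integrable_vec F -> square_integrable_vec (fun w => A *m F w).
Proof.
move=> sF i; under eq_fun do rewrite mxE.
by apply: square_integrable_sum => j; exact: square_integrableZ.
Qed.

Lemma square_integrable_scale {p : nat} (t : R) (F : W -> 'cV[R]_p) :
  square_integrable_vec F -> square_integrable_vec (fun w => t *: F w).
Proof. by move=> sF i; under eq_fun do rewrite mxE; exact: square_integrableZ. Qed.

Lemma square_integrable_add {p : nat} (F G : W -> 'cV[R]_p) :
  square_integrable_vec F -> square_integrable_vec G ->
  square_integrable_vec (fun w => F w + G w).
Proof. by move=> sF sG i; under eq_fun do rewrite mxE; exact: square_integrableD. Qed.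

Lemma second_momentT {p q : nat} (F : W -> 'cV[R]_p) (G : W -> 'cV[R]_q) :
  second_moment G F = (second_moment F G)^T.
Proof.
by apply/matrixP => i j; rewrite !mxE; apply: eq_Rintegral => w _; rewrite mulrC.
Qed.

Lemma second_moment_mull {p q s : nat} (A : 'M[R]_(p, q)) (F : W -> 'cV[R]_q)
    (G : W -> 'cV[R]_s) : square_integrable_vec F -> square_integrable_vec G ->
  second_moment (fun w => A *m F w) G = A *m second_moment F G.
Proof.
move=> sF sG; apply/matrixP => i j; rewrite !mxE.
under eq_Rintegral do rewrite mxE.
rewrite Rintegral_suml//; last by move=> l; exact: square_integrableZ.
by apply: eq_bigr => l _; rewrite mxE RintegralZll.
Qed.

Lemma second_moment_addl {p s : nat} (F H : W -> 'cV[R]_p) (G : W -> 'cV[R]_s) :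
  square_integrable_vec F -> square_integrable_vec H -> square_integrable_vec G ->
  second_moment (fun w => F w + H w) G = second_moment F G + second_moment H G.
Proof.
move=> sF sH sG; apply/matrixP => i j; rewrite !mxE -RintegralDl//.
by apply: eq_Rintegral => w _; rewrite mxE.
Qed.

Lemma second_moment_scalel {p s : nat} (t : R) (F : W -> 'cV[R]_p) (G : W -> 'cV[R]_s) :
  square_integrable_vec F -> square_integrable_vec G ->
  second_moment (fun w => t *: F w) G = t *: second_moment F G.
Proof.
move=> sF sG; apply/matrixP => i j; rewrite !mxE -RintegralZll//.
by apply: eq_Rintegral => w _; rewrite mxE.
Qed.

(** The cross moments appear only as F against D, the other one being their transpose. *)
Lemma second_moment_step {p : nat} (G : 'M[R]_p) (a : R) (F D : W -> 'cV[R]_p) :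
  square_integrable_vec F -> square_integrable_vec D ->
  second_moment (fun w => G *m F w + a *: D w) (fun w => G *m F w + a *: D w) =
  G *m second_moment F F *m G^T
  + a *: (G *m second_moment F D + (G *m second_moment F D)^T)
  + a ^+ 2 *: second_moment D D.
Proof.
move=> sF sD.
have sGF := square_integrable_mulmx G sF.
have saD := square_integrable_scale a sD.
have sS := square_integrable_add sGF saD.
have left (H : W -> 'cV[R]_p) : square_integrable_vec H ->
    second_moment (fun w => G *m F w + a *: D w) H =
    G *m second_moment F H + a *: second_moment D H.
  move=> sH; rewrite second_moment_addl// second_moment_mull//.
  by rewrite second_moment_scalel.
have e1 : second_moment F (fun w => G *m F w + a *: D w) =
    second_moment F F *m G^T + a *: second_moment F D.
  rewrite second_momentT left// linearD/= linearZ/= trmx_mul.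
  by rewrite -!second_momentT.
have e2 : second_moment D (fun w => G *m F w + a *: D w) =
    (G *m second_moment F D)^T + a *: second_moment D D.
  by rewrite second_momentT left// linearD/= linearZ/= -second_momentT.
rewrite left// e1 e2 mulmxDr mulmxA -scalemxAr !scalerDr scalerA -expr2.
by rewrite !addrA.
Qed.

Lemma qform_second_moment {p : nat} (F : W -> 'cV[R]_p) (x : 'cV[R]_p) :
  square_integrable_vec F ->
  qform (second_moment F F) x = \int[Pr]_w ((x^T *m F w) 0 0 ^+ 2).
Proof.
move=> sF; have sxF := square_integrable_mulmx x^T sF.
rewrite /qform -second_moment_mull// -{2}(trmxK x).
rewrite -[X in X *m _]trmxK -trmx_mul -second_momentT -second_moment_mull//.
rewrite !mxE.
by under eq_Rintegral do rewrite -expr2.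
Qed.

Lemma possemidef_second_moment {p : nat} (F : W -> 'cV[R]_p) :
  square_integrable_vec F -> possemidef (second_moment F F).
Proof.
move=> sF; split; first by rewrite -second_momentT.
move=> x; rewrite -/(qform _ _) qform_second_moment//.
by apply: Rintegral_ge0 => w _; exact: sqr_ge0.
Qed.

End second_moments.

(** * Laws of the chain and its autocovariances *)

Section laws.
Local Open Scope ereal_scope.
Context {dZ dO : measure_display} {Z : measurableType dZ} {Omega : measurableType dO}
  {R : realType}.
Variables (Pr : probability Omega R) (X : {mfun Omega >-> Z}) (mu : {measure set Z -> \bar R}).
Hypothesis law : forall B, measurable B -> Pr (X @^-1` B) = mu B.

Lemma ge0_integral_law (h : Z -> \bar R) : (forall z, 0 <= h z) ->
  measurable_fun setT h -> \int[Pr]_w h (X w) = \int[mu]_z h z.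
Proof.
move=> h0 mh.
have m1 := monotone_linear_weighted Pr measurableT
  (measurable_funPT X) (@measurable_cst _ _ Omega R setT 1%R) (fun=> ler01).
have m2 := monotone_linear_weighted mu measurableT
  (@measurable_id _ Z setT) (@measurable_cst _ _ Z R setT 1%R) (fun=> ler01).
have H := monotone_linear_eq m1 m2 _ h0 mh.
transitivity (\int[Pr]_w (h (X w) * (cst 1%R w)%:E)).
  by apply: eq_integral => w _; rewrite mule1.
rewrite H; first by apply: eq_integral => z _; rewrite mule1.
move=> B mB {H}.
under eq_integral do rewrite /cst mule1; under [in RHS]eq_integral do rewrite /cst mule1.
have -> : (fun w => (\1_B (X w))%:E) = (fun w => (\1_(X @^-1` B) w)%:E) :> (Omega -> \bar R).
  by [].
have mXB : measurable (X @^-1` B).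
  by rewrite -[Y in measurable Y]setTI; exact: measurable_funPT.
rewrite integral_indic// integral_indic// setIT setIT; exact: law.
Qed.

(** Both sides split in the same way into positive and negative parts, so the identity
holds between extended reals. *)
Lemma integral_law (h : Z -> \bar R) : measurable_fun setT h ->
  \int[Pr]_w h (X w) = \int[mu]_z h z.
Proof.
move=> mh; rewrite [LHS]integralE [RHS]integralE; congr (_ - _).
  rewrite -(ge0_integral_law (h := h^\+) (funepos_ge0 _) (measurable_funepos mh)).
  by apply: eq_integral => w _; rewrite !unlock.
rewrite -(ge0_integral_law (h := h^\-) (funeneg_ge0 _) (measurable_funeneg mh)).
by apply: eq_integral => w _; rewrite !unlock.
Qed.

Lemma integrable_law (h : Z -> \bar R) : mu.-integrable setT h ->
  Pr.-integrable setT (fun w => h (X w)).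
Proof.
move=> /integrableP[mh hoo]; apply/integrableP; split.
  exact: (measurableT_comp mh (measurable_funPT X)).
rewrite (ge0_integral_law (h := fun z => `|h z|))//.
exact: measurableT_comp.
Qed.

End laws.

Section start_law.
Context {dZ dO : measure_display} {Z : measurableType dZ} {Omega : measurableType dO}
  {R : realType}.
Variables (P : R.-pker Z ~> Z).
Variables (Pr : probability Omega R) (X : nat -> {mfun Omega >-> Z}).
Hypothesis chain : markov_chain Pr P X.
Variable z0 : Z.
Hypothesis start : forall w, X 0%N w = z0.

Lemma chain_law n B : measurable B -> Pr (X n @^-1` B) = nstep P n z0 B.
Proof.
move=> mB.
have sT : sigma_of X [set i | (i <= 0)%N] setT.
  by rewrite -(@preimage_setT _ _ (X 0%N)); exact: sigma_of_preimage.
have mind : measurable_fun setT (fun z => (\1_B z)%:E : \bar R) by exact/measurable_EFinP.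
have ind0 z : (0 <= (\1_B z)%:E :> \bar R)%E by rewrite lee_fin.
have := markov_steps chain n sT ind0 mind.
rewrite add0n.
have -> : (fun w => (\1_B (X n w))%:E) =
    (fun w => (\1_(X n @^-1` B) w)%:E) :> (Omega -> \bar R).
  by [].
rewrite integral_indic//; last by rewrite -[Y in measurable Y]setTI; exact: measurable_funPT.
rewrite setIT => ->.
under eq_integral do rewrite start.
rewrite integral_indic// setIT integral_cst//.
by rewrite [X in (_ * X)%E](_ : _ = 1%E) ?mule1//; exact: probability_setT.
Qed.

End start_law.

Section linear_sa_moments.
Context {dZ dO : measure_display} {Z : measurableType dZ} {Omega : measurableType dO}
  {R : realType} {d : nat}.
Variables (V : Z -> R) (P : R.-pker Z ~> Z) (pi : probability Z R).
Hypotheses (mV : measurable_fun setT V) (V1 : forall z, 1 <= V z).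
Variables (rho B M : R).
Hypothesis erg : ergodic_bounds V P pi rho B M.
Let W z := Num.sqrt (V z).
Let V0 z : 0 <= V z. Proof. exact: le_trans (V1 z). Qed.
Let WW z : W z * W z = V z. Proof. by rewrite -expr2 sqr_sqrtr. Qed.
Let W0 z : 0 <= W z. Proof. exact: sqrtr_ge0. Qed.

Variable (f : Z -> 'cV[R]_d).
Variable (cf : R).
Hypotheses (cf0 : 0 <= cf) (mf : forall i, measurable_fun setT (fun z => f z i 0))
  (fW : forall i z, `|f z i 0| <= cf * W z)
  (pif : forall i, \int[pi]_z f z i 0 = 0).

Let fcomp i z := f z i 0.

Let df i : dominated_by W (fcomp i).
Proof. by split; [exact: mf|exists cf => // z; exact: fW]. Qed.

Let r := Num.sqrt rho.
Let K := 2 + B * cf ^+ 2.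

Let B0 : 0 <= B. Proof. by have [[_ h _ _ _] _] := erg. Qed.
Let M0 : 0 <= M. Proof. by have [[_ _ h _ _] _] := erg. Qed.
Let K0 : 0 <= K. Proof. by rewrite addr_ge0// mulr_ge0// sqr_ge0. Qed.

Let r01 : 0 <= r < 1.
Proof. by have [r0' r1' _ _] := sqrt_rate_bounds erg; rewrite (ltW r0'). Qed.

Let r0 : 0 <= r. Proof. by case/andP: r01. Qed.

Lemma kernel_power_decay k j z :
  `|kernel_power P k (fcomp j) z| <= K * r ^+ k * W z.
Proof.
by have := sqrt_decay V1 erg cf0 (mf j) (fW j) k z; rewrite pif subr0.
Qed.

(** Conditioning on the state at time 0 expresses the stationary covariance at lag k by
the iterate P^k. *)
Definition autocov (k : nat) : 'M[R]_d :=
  \matrix_(i, j) \int[pi]_z (fcomp i z * kernel_power P k (fcomp j) z).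

Let dk k j : dominated_by W (kernel_power P k (fcomp j)).
Proof. exact: (kernel_power_dominated V1 erg k (df j)). Qed.

Let dlag k i j : dominated_by V (fun z => fcomp i z * kernel_power P k (fcomp j) z).
Proof. exact: (dominated_sqrtM V1 (df i) (dk k j)). Qed.

Let lag_bound k i j z :
  `|fcomp i z * kernel_power P k (fcomp j) z| <= cf * K * r ^+ k * V z.
Proof.
rewrite normrM -WW.
have -> : cf * K * r ^+ k * (W z * W z) = (cf * W z) * (K * r ^+ k * W z) by ring.
by apply: ler_pM => //; [exact: fW|exact: kernel_power_decay].
Qed.

Lemma autocov_decay k i j :
  `|autocov k i j| <= cf * K * (\int[pi]_z V z) * r ^+ k.
Proof.
rewrite mxE; have ipi := invariant_integrable V1 erg (dlag k i j).
have [[_ _ _ iV _] _] := erg.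
apply: le_trans (le_normr_Rintegral measurableT ipi) _.
have c0 : 0 <= cf * K * r ^+ k by rewrite !mulr_ge0// exprn_ge0.
apply: (@le_trans _ _ (\int[pi]_z (cf * K * r ^+ k * V z))).
  apply: le_Rintegral => //; first exact: integrable_norm.
  exact: integrableZ_fin.
by rewrite RintegralZl// mulrAC.
Qed.

Lemma kernel_power0 (h : Z -> R) z : measurable_fun setT h -> kernel_power P 0 h z = h z.
Proof.
move=> mh; rewrite /kernel_power /Rintegral integral_nstep0//.
exact/measurable_EFinP.
Qed.

(** The two-sided sum lists the lag 0 with its indices exchanged. *)
Lemma autocov0_sym : (autocov 0)^T = autocov 0.
Proof.
apply/matrixP => i j; rewrite !mxE; apply: eq_Rintegral => z _.
by rewrite (kernel_power0 _ (mf i)) (kernel_power0 _ (mf j)) mulrC.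
Qed.

(** Nonnegative lags contribute the transposes of [autocov], negative ones [autocov]
itself: a time shift reduces a negative lag to a chain that starts at that time. *)
Lemma Sigma_Delta_autocov {dS : measure_display} {OmegaS : measurableType dS}
    (PrS : probability OmegaS R) (Psi : int -> {mfun OmegaS >-> Z}) :
  stationary_chain PrS P pi Psi ->
  Sigma_Delta PrS Psi f = mx_series autocov + (mx_series (fun k => autocov k.+1))^T.
Proof.
move=> [chainS lawS].
have shifted_chain (s : int) :
    markov_chain PrS P (fun n : nat => Psi (s + n%:Z)).
  move=> n; have h := chainS (s + n%:Z).
  move=> D C mD sC; rewrite -addn1 PoszD addrA; apply: h => //.
  apply: sub_sigma_algebra2 sC => E [i /= ile XE].
  by exists (s + i%:Z) => //=; rewrite lerD2l lez_nat.
have iVS n : PrS.-integrable setT (EFin \o (V \o Psi n)).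
  have [[_ _ _ iV _] _] := erg.
  exact: (integrable_law (lawS n) iV).
have lag (s : int) (k : nat) i j :
    \int[PrS]_w (f (Psi s w) i 0 * f (Psi (s + k%:Z) w) j 0) = autocov k i j.
  have := markov_pair V1 erg (shifted_chain s) (fun n => iVS _) k (leqnn 0)
    (df i) (df j).
  rewrite add0n !addr0 => ->; rewrite mxE; congr fine.
  have [mh _] := dlag k i j.
  apply: (integral_law (lawS s) (h := fun z => (fcomp i z * kernel_power P k (fcomp j) z)%:E)).
  exact/measurable_EFinP.
have E (F : OmegaS -> R) : fine 'E_PrS[F] = \int[PrS]_w F w by rewrite unlock.
have decay : geometric_mx (cf * K * \int[pi]_z V z) r autocov.
  by move=> k i j; exact: autocov_decay.
have [sA _] := geometric_mx_summable r01 decay.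
have [sA1 EA] := mx_series_recl sA.
have -> : mx_series autocov + (mx_series (fun k => autocov k.+1))^T =
   (mx_series autocov)^T + mx_series (fun k => autocov k.+1).
  by rewrite EA linearD/= autocov0_sym -!addrA; congr (_ + _); rewrite addrC.
apply/matrixP => i j.
rewrite [LHS]mxE [RHS]mxE [X in _ = X + _]mxE [X in _ = X + _]mxE [X in _ = _ + X]mxE.
rewrite /two_sided_sum; congr (_ + _).
  congr (limn (series _)); apply/funext => k.
  rewrite E -(lag 0 k j i) add0r.
  by apply: eq_Rintegral => w _; rewrite mulrC.
congr (limn (series _)); apply/funext => k.
by rewrite E -(lag (- k.+1%:Z) k.+1 i j) addNr.
Qed.

Variables (Pr : probability Omega R) (X : nat -> {mfun Omega >-> Z}).
Hypothesis chain : markov_chain Pr P X.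
Variable z0 : Z.
Hypothesis start : forall w, X 0%N w = z0.
Variables (A : 'M[R]_d) (theta0 : 'cV[R]_d).

Let theta n w := linear_sa A (fun k => f (X k w)) theta0 n.

Let iVX n : Pr.-integrable setT (EFin \o (V \o X n)).
Proof.
have [[_ _ _ _ h] _] := erg; have [iV _] := h n z0.
exact: (integrable_law (chain_law chain start n) iV).
Qed.

Let RintegralX n (h : Z -> R) : measurable_fun setT h ->
  \int[Pr]_w h (X n w) = kernel_power P n h z0.
Proof.
move=> mh; congr fine.
apply: (integral_law (chain_law chain start n) (h := fun z => (h z)%:E)).
exact/measurable_EFinP.
Qed.

Lemma linear_saS n w : theta n.+1 w =
  euler_mx A n *m theta n w + n.+1%:R^-1 *: f (X n.+1 w).
Proof.
by rewrite /theta /= /step_size /euler_mx mulmxDl mul1mx -scalemxAl scalerDr addrA.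
Qed.

(** theta_n is a linear combination of the noise up to time n. *)
Lemma linear_sa_adapted n i : adapted V P Pr X n (fun w => theta n w i 0).
Proof.
elim: n i => [|n IH] i; first exact: (adapted_cst V1 erg chain iVX 0 (theta0 i 0)).
under eq_fun do rewrite linear_saS !mxE.
apply: (adaptedD V1 erg iVX).
  apply: (adapted_sum V1 erg chain iVX) => j; apply: (adaptedZ V1 erg iVX).
  exact: adapted_mono (IH j).
apply: (adaptedZ V1 erg iVX).
exact: (adapted_comp V1 erg chain iVX n.+1 (df i)).
Qed.

Lemma linear_sa_square_integrable n : square_integrable_vec Pr (theta n).
Proof. by move=> i; have [] := linear_sa_adapted n i. Qed.

Lemma noise_square_integrable n : square_integrable_vec Pr (fun w => f (X n w)).
Proof. by move=> i; exact: (square_integrable_comp V1 iVX n (df i)). Qed.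

(** The cross moments decay because conditioning on time n replaces f(X_{n+k+1}) by
P^(k+1) f (X_n), whose L^2 norm is O(r^k) by [sqrt_decay] and the boundedness of
E[V(X_n)]. *)
Lemma linear_sa_moment_data :
  moment_data A (mx_series autocov + (mx_series (fun k => autocov k.+1))^T)
    (fun n => second_moment Pr (theta n) (theta n)).
Proof.
pose piV := \int[pi]_z V z.
have piV0 : 0 <= piV by apply: Rintegral_ge0.
pose C1 := K * Num.sqrt (M * V z0).
pose C2 := B * (cf * K) * V z0.
pose C3 := cf * K * piV.
have C10 : 0 <= C1 by rewrite mulr_ge0// sqrtr_ge0.
have C20 : 0 <= C2 by rewrite !mulr_ge0.
have C30 : 0 <= C3 by rewrite !mulr_ge0.
have C0 : 0 <= C1 + C2 + C3 by rewrite !addr_ge0.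
exists (fun n k => second_moment Pr (theta n) (fun w => f (X (n + k.+1)%N w))).
exists (fun m k => second_moment Pr (fun w => f (X m w)) (fun w => f (X (m + k)%N w))).
exists autocov, (C1 + C2 + C3), r.
have sth := linear_sa_square_integrable; have sf := noise_square_integrable.
split; split=> //.
- move=> n; rewrite addn0 addn1.
  have -> : theta n.+1 = fun w => euler_mx A n *m theta n w + n.+1%:R^-1 *: f (X n.+1 w).
    by apply/funext => w; exact: linear_saS.
  exact: second_moment_step.
- move=> n k.
  have -> : theta n.+1 = fun w => euler_mx A n *m theta n w + n.+1%:R^-1 *: f (X n.+1 w).
    by apply/funext => w; exact: linear_saS.
  rewrite second_moment_addl//; last 2 first.
  - exact: square_integrable_mulmx.
  - exact: square_integrable_scale.
  by rewrite second_moment_mull// second_moment_scalel// addSnnS.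
- by move=> n; exact: possemidef_second_moment.
- move=> n k i j; rewrite mxE.
  have [_ aE] := linear_sa_adapted n i.
  rewrite (aE n k.+1 (fcomp j) (leqnn n) (df j)).
  apply: le_trans (cauchy_schwarz_Rintegral (sth n i)
    (square_integrable_comp V1 iVX n (dk k.+1 j))) _.
  rewrite mulrC; apply: ler_pM; rewrite ?sqrtr_ge0//.
    apply: (@le_trans _ _ (C1 * r ^+ k)); last first.
      by rewrite ler_wpM2r ?exprn_ge0// -addrA lerDl addr_ge0.
    have Kr0 : 0 <= K * r ^+ k.+1 by rewrite mulr_ge0 ?exprn_ge0.
    apply: (@le_trans _ _ (Num.sqrt ((K * r ^+ k.+1) ^+ 2 * (M * V z0)))).
      apply: ler_wsqrtr.
      apply: (@le_trans _ _ (\int[Pr]_w ((K * r ^+ k.+1) ^+ 2 * V (X n w)))).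
        apply: le_Rintegral => //.
        - by have [] := square_integrable_comp V1 iVX n (dk k.+1 j).
        - exact: (integrableZ_fin _ (iVX n)).
        move=> w _; rewrite -WW -expr2 -exprMn -[leLHS]real_normK ?num_real//.
        rewrite ler_pXn2r ?nnegrE ?normr_ge0//; first exact: kernel_power_decay.
        exact: mulr_ge0.
      rewrite (RintegralZl _ measurableT (iVX n)) ler_wpM2l ?sqr_ge0//.
      rewrite RintegralX//; have [[_ _ _ _ h] _] := erg; exact: (h n z0).2.
    rewrite sqrtrM ?sqr_ge0// sqrtr_sqr ger0_norm//.
    have -> : K * r ^+ k.+1 * Num.sqrt (M * V z0) = r * (C1 * r ^+ k).
      by rewrite /C1 exprS; ring.
    by rewrite ler_piMl ?mulr_ge0 ?exprn_ge0//; case/andP: r01 => _ /ltW.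
  apply: ler_wsqrtr; rewrite /mxtrace (bigD1 i)//= mxE.
  under eq_Rintegral do rewrite expr2.
  rewrite lerDl; apply: sumr_ge0 => l _; rewrite mxE.
  by apply: Rintegral_ge0 => w _; rewrite -expr2 sqr_ge0.
- move=> m k i j; rewrite mxE.
  rewrite (markov_pair V1 erg chain iVX k (leqnn m) (df i) (df j)) mxE.
  have [mh _] := dlag k i j.
  rewrite (RintegralX m mh).
  have Kk0 : 0 <= cf * K * r ^+ k by rewrite !mulr_ge0// exprn_ge0.
  have [_ bnd] := erg; apply: le_trans (bnd _ _ Kk0 mh (lag_bound k i j) m z0) _.
  have [_ _ _ rho_r] := sqrt_rate_bounds erg.
  have rho0 : 0 <= rho by have [[/andP[/ltW h _] _ _ _ _] _] := erg.
  have hm : rho ^+ m <= r ^+ m by rewrite lerXn2r.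
  apply: (@le_trans _ _ (C2 * r ^+ (m + k))).
    have -> : C2 * r ^+ (m + k) = B * (cf * K * r ^+ k) * r ^+ m * V z0.
      by rewrite /C2 exprD; ring.
    by rewrite ler_wpM2r// ler_wpM2l// mulr_ge0.
  by rewrite ler_wpM2r ?exprn_ge0// addrAC lerDr addr_ge0.
- move=> k i j; apply: le_trans (autocov_decay k i j) _.
  by rewrite ler_wpM2r ?exprn_ge0// lerDr addr_ge0.
Qed.

End linear_sa_moments.

(** * Eigenvectors in real coordinates, and the theorem *)

Section complex_vectors.
Context {R : realType}.

Definition re_mx {p q : nat} (v : 'M[R[i]]_(p, q)) : 'M[R]_(p, q) :=
  map_mx (@complex.Re R) v.
Definition im_mx {p q : nat} (v : 'M[R[i]]_(p, q)) : 'M[R]_(p, q) :=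
  map_mx (@complex.Im R) v.

Lemma complex_sum (I : Type) (s : seq I) (a b : I -> R) :
  \sum_(i <- s) (a i +i* b i)%C = ((\sum_(i <- s) a i) +i* (\sum_(i <- s) b i))%C.
Proof.
elim: s => [|i s IH]; first by rewrite !big_nil.
by rewrite !big_cons IH; simpc.
Qed.

Lemma complexify_mulmx {p q s : nat} (M : 'M[R]_(p, q)) (v : 'M[R[i]]_(q, s)) i j :
  (complexify M *m v) i j = ((M *m re_mx v) i j +i* (M *m im_mx v) i j)%C.
Proof.
rewrite !mxE -complex_sum; apply: eq_bigr => k _; rewrite !mxE.
by case: (v k j) => a b /=; simpc.
Qed.

(** In real coordinates a left eigenvector is a plane on which A^T acts as multiplication
by the eigenvalue. *)
Lemma left_eigenvector_re_im {d : nat} (A : 'M[R]_d) (l : R[i]) (v : 'cV[R[i]]_d) :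
  v^T *m complexify A = l *: v^T ->
  A^T *m re_mx v = complex.Re l *: re_mx v - complex.Im l *: im_mx v /\
  A^T *m im_mx v = complex.Im l *: re_mx v + complex.Re l *: im_mx v.
Proof.
move=> vA; have {}vA : complexify A^T *m v = l *: v.
  apply: (can_inj trmxK).
  by rewrite trmx_mul /complexify map_trmx trmxK linearZ/= -vA.
have E i : ((A^T *m re_mx v) i 0 +i* (A^T *m im_mx v) i 0)%C = l * v i 0.
  by rewrite -complexify_mulmx vA mxE.
have ER i : (A^T *m re_mx v) i 0 = complex.Re (l * v i 0) by rewrite -E.
have EI i : (A^T *m im_mx v) i 0 = complex.Im (l * v i 0) by rewrite -E.
split; apply/matrixP => i j; rewrite ord1 ?ER ?EI !mxE;
  case: l {vA E ER EI} => a b; case: (v i 0) => x y /=; ring.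
Qed.

Lemma sqmod_pairingE {d : nat} (v : 'cV[R[i]]_d) (x : 'cV[R]_d) :
  sqmod_pairing v x =
  ((re_mx v)^T *m x) 0 0 ^+ 2 + ((im_mx v)^T *m x) 0 0 ^+ 2.
Proof.
rewrite /sqmod_pairing.
have T11 (S : nmodType) (N : 'M[S]_1) : N^T 0 0 = N 0 0 by rewrite mxE.
have -> : (v^T *m complexify x) 0 0 = (complexify x^T *m v) 0 0.
  by rewrite -[RHS]T11 trmx_mul /complexify map_trmx trmxK.
have T (w : 'cV[R]_d) : (x^T *m w) 0 0 = (w^T *m x) 0 0.
  by rewrite -[RHS]T11 trmx_mul trmxK.
by rewrite complexify_mulmx /= !T.
Qed.

End complex_vectors.

Section assembly.
Context {R : realType}.

Lemma integrable_sum_fin {dW : measure_display} {W : measurableType dW}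
    (Pr : probability W R) (I : Type) (s : seq I) (F : I -> W -> R) :
  (forall i, Pr.-integrable setT (EFin \o F i)) ->
  Pr.-integrable setT (EFin \o (fun w => \sum_(i <- s) F i w)) /\
  \int[Pr]_w (\sum_(i <- s) F i w) = \sum_(i <- s) \int[Pr]_w F i w.
Proof.
move=> iF; elim: s => [|i s [iS IH]].
  split; first by under eq_fun do rewrite big_nil; exact: integrable0.
  by under eq_Rintegral do rewrite big_nil; rewrite Rintegral_cst// mul0r big_nil.
split; first by under eq_fun do rewrite big_cons; exact: integrableD_fin.
by under eq_Rintegral do rewrite big_cons; rewrite RintegralD// IH big_cons.
Qed.

(** A semidefinite matrix with a nonzero column has a positive entry on the diagonal. *)
Lemma mxtrace_possemidef_gt0 {d : nat} (Sigma : 'M[R]_d) :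
  possemidef Sigma -> Sigma <> 0 -> 0 < \tr Sigma.
Proof.
move=> S0 Sn0.
have diag i : 0 <= Sigma i i.
  have [_ /(_ (delta_mx i 0))] := S0.
  by rewrite trmx_delta -rowE -colE !mxE.
have [j Sj] : exists j, Sigma *m (delta_mx j 0 : 'cV[R]_d) <> 0.
  apply/not_existsP => h; apply: Sn0; apply/matrixP => i j.
  have /contrapT := h j; rewrite -colE => /matrixP/(_ i 0).
  by rewrite !mxE.
have := possemidef_qform_gt0 S0 Sj; rewrite /qform trmx_delta -rowE -colE !mxE => Sjj.
rewrite /mxtrace (bigD1 j)//= ltr_pwDl// sumr_ge0// => i _; exact: diag.
Qed.

Lemma trace_rate {d : nat} (Y : nat -> 'M[R]_d) (Sigma : 'M[R]_d) (C delta : R) :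
  0 < delta -> 0 < \tr Sigma ->
  (forall n i j, (0 < n)%N ->
     `|Y n i j - n%:R^-1 * Sigma i j| <= C * n%:R `^ (- 1 - delta)) ->
  converges_at_rate (fun n => (\tr (Y n))%:E) 1.
Proof.
move=> d0 S0 h; set s := \tr Sigma in S0.
pose D := d%:R * `|C| + 1.
have D0 : 0 < D by rewrite ltr_wpDl// mulr_ge0.
have tY n : (0 < n)%N -> `|\tr (Y n) - n%:R^-1 * s| <= D * (n%:R^-1 * n%:R `^ (- delta)).
  move=> n0; have P0 : 0 <= n%:R^-1 * n%:R `^ (- delta) :> R.
    by rewrite mulr_ge0 ?invr_ge0 ?powR_ge0.
  have -> : \tr (Y n) - n%:R^-1 * s = \sum_i (Y n i i - n%:R^-1 * Sigma i i).
    by rewrite sumrB -mulr_sumr.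
  apply: le_trans (ler_norm_sum _ _ _) _.
  apply: (@le_trans _ _ (\sum_(i < d) `|C| * (n%:R^-1 * n%:R `^ (- delta)))).
    apply: ler_sum => i _; apply: le_trans (h n i i n0) _.
    rewrite powRD; last by rewrite pnatr_eq0 -lt0n n0 implybT.
    by rewrite powR_inv1// ler_wpM2r// ler_norm.
  by rewrite sumr_const card_ord -[leLHS]mulr_natl mulrA ler_wpM2r// lerDl.
have [N N0 hN] := powR_natN_small d0 (divr_gt0 (divr_gt0 S0 (ltr0n _ 2)) D0).
apply: (@converges_at_rate_of_bounds _ _ _ (s / 2) (s + s / 2) N) => //.
  by rewrite divr_gt0.
move=> n Nn; have n0 : (0 < n)%N by exact: leq_trans Nn.
rewrite powR_inv1//; have q0 : 0 <= n%:R^-1 :> R by rewrite invr_ge0.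
have := tY n n0; have := hN n Nn; rewrite ler_pdivlMr// => h1.
have h2 : D * (n%:R^-1 * n%:R `^ (- delta)) <= n%:R^-1 * (s / 2).
  by rewrite mulrCA ler_wpM2l// mulrC.
move=> h3; have := le_trans h3 h2; rewrite ler_norml => /andP[l u].
by split; [move: l|move: u]; move: (n%:R^-1) => q; lra.
Qed.


(** The exponent is fixed before the noise covariance, so that it can be chosen as a
function of A. *)
Lemma covariance_expansion_exponent {d : nat} (A : 'M[R]_d) :
  exists delta : R,
  (forall l : R[i], eigenvalue (complexify A) l -> complex.Re l < - (1 / 2)) ->
  0 < delta /\ forall Sg Y, moment_data A Sg Y ->
  exists Sigma, [/\ possemidef Sigma, lyapunov_eq A Sg Sigma,
    forall Sigma', lyapunov_eq A Sg Sigma' -> Sigma' = Sigma &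
    exists C : R, forall n i j, (0 < n)%N ->
      `|Y n i j - n%:R^-1 * Sigma i j| <= C * n%:R `^ (- 1 - delta)].
Proof.
have [hA|nhA] := pselect (forall l : R[i], eigenvalue (complexify A) l ->
  complex.Re l < - (1 / 2)); last by exists 0 => /nhA.
have half0 : 0 <= 1 / 2 :> R by rewrite divr_ge0.
have [b [K [nu [hb K0 nuA]]]] := contracting_normP half0 hA.
have b1 : 1 < b by apply: le_lt_trans hb; rewrite mulrCA mulfV// mulr1.
have [delta d0 h] := covariance_expansion nuA K0 b1.
by exists delta.
Qed.

(** For A = -I the Lyapunov equation reads Sg = Sigma, and theta_n is an average of the
noise. *)
Lemma possemidef_noise {d : nat} (Sg : 'M[R]_d) (Y : nat -> 'M[R]_d) :
  moment_data (- 1%:M) Sg Y -> possemidef Sg.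
Proof.
move=> dataY; have [delta h] := covariance_expansion_exponent (- 1%:M : 'M[R]_d).
have hA (l : R[i]) : eigenvalue (complexify (- 1%:M : 'M[R]_d)) l ->
    complex.Re l < - (1 / 2).
  move=> /eigenvalueP [v ve vn0].
  have {}ve : v = - l *: v.
    move: ve; rewrite /complexify map_mxN map_mx1 mulmxN mulmx1 scaleNr => <-.
    by rewrite opprK.
  have /eqP : (1 + l) *: v = 0 by rewrite scalerDl scale1r {1}ve scaleNr addNr.
  rewrite scaler_eq0 (negbTE vn0) orbF addrC addr_eq0 => /eqP ->.
  by rewrite /=; lra.
have [_ /(_ Sg Y dataY) [Sigma [S0 SE _ _]]] := h hA.
suff -> : Sg = Sigma by [].
move: SE; rewrite /lyapunov_eq.
have -> : (1 / 2)%:M + - 1%:M = (- (1 / 2))%:M :> 'M[R]_d.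
  rewrite -(raddfN (@scalar_mx R d)) -(raddfD (@scalar_mx R d)); congr (_%:M).
  by field.
rewrite tr_scalar_mx mul_scalar_mx mul_mx_scalar -scalerDl => /eqP.
rewrite addrC addr_eq0 => /eqP ->.
rewrite -scaleNr (_ : - _ = 1); first by rewrite scale1r.
by field.
Qed.

End assembly.
Theorem theorem2p4 (R : realType) (d : nat) :
  exists delta : 'M[R]_d -> 'M[R]_d -> R,
  forall (Z : ptopologicalType) (V : borel Z -> R)
    (P : R.-pker (borel Z) ~> (borel Z)) (pi : probability (borel Z) R)
    (A : 'M[R]_d) (f : borel Z -> 'cV[R]_d)
    (* the chain, with fixed initial condition *)
    (dO : measure_display) (Omega : measurableType dO)
    (Pr : probability Omega R) (Phi : nat -> {mfun Omega >-> borel Z})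
    (z0 : borel Z) (theta0 : 'cV[R]_d)
    (* its two-sided stationary version, which defines E_pi *)
    (dS : measure_display) (OmegaS : measurableType dS)
    (PrS : probability OmegaS R) (Psi : int -> {mfun OmegaS >-> borel Z}),
  polish R Z ->
  measurable_fun setT V -> (forall z, 1 <= V z) ->
  (* (A1) *)
  markov_chain Pr P Phi -> (forall w, Phi 0%N w = z0) ->
  unique_invariant_law P pi -> V_uniformly_ergodic V P pi ->
  (* (A2) *)
  hurwitz A ->
  (* (A3) *)
  (forall i, measurable_fun setT (fun z => f z i 0)) ->
  (forall i, (Vnorm V (fun z => (f z i 0 ^+ 2)%R) < +oo)%E) ->
  (forall i, (\int[pi]_z (f z i 0%R)%:E = 0)%E) ->
  stationary_chain PrS P pi Psi ->
  let SigmaD := Sigma_Delta PrS Psi f in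
  let theta (n : nat) (w : Omega) :=
    linear_sa A (fun k => f (Phi k w)) theta0 n in
  (* (i) *)
  ((forall lambda : R[i], eigenvalue (complexify A) lambda ->
      complex.Re lambda < - (1 / 2)) ->
   0 < delta A SigmaD /\
   exists Sigma : 'M[R]_d,
     [/\ possemidef Sigma,
         lyapunov_eq A SigmaD Sigma,
         (forall Sigma', lyapunov_eq A SigmaD Sigma' -> Sigma' = Sigma),
         (exists C : R, forall (n : nat) (i j : 'I_d), (1 <= n)%N ->
            (`| 'E_Pr[fun w => ((theta n w *m (theta n w)^T) i j)%R]
                - (n%:R^-1 * Sigma i j)%:E |
             <= (C * n%:R `^ (- 1 - delta A SigmaD))%:E)%E) &
         (SigmaD <> 0 ->
          converges_at_rate (fun n => 'E_Pr[fun w => sqnorm (theta n w)])%E 1)])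
  /\
  (* (ii) *)
  (forall (lambda : R[i]) (rho0 : R) (v : 'cV[R[i]]_d),
     eigenvalue (complexify A) lambda ->
     complex.Re lambda = - rho0 -> - (1 / 2) < complex.Re lambda ->
     v <> 0 -> v^T *m complexify A = lambda *: v^T ->
     complexify SigmaD *m v <> 0 ->
     converges_at_rate
       (fun n => 'E_Pr[fun w => sqmod_pairing v (theta n w)])%E (2 * rho0)).
Proof.
have [delta hdelta] := choice (@covariance_expansion_exponent R d).
exists (fun A _ => delta A).
move=> Z V P pi A f dO Omega Pr Phi z0 theta0 dS OmegaS PrS Psi _ mV V1 chain start _
  verg hurwA mf fV pif0 stat SigmaD theta.
have [rho [B [M erg]]] := V_uniformly_ergodic_bounds mV V1 verg.
have V0 z : 0 <= V z by exact: le_trans (V1 z).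
have [cf cf0 fW] : exists2 cf : R, 0 <= cf &
    forall i z, `|f z i 0| <= cf * Num.sqrt (V z).
  have fc i : exists c : R, 0 <= c /\ forall z, `|f z i 0 ^+ 2| <= c * V z.
    by have [c c0 hc] := VnormP V1 (fV i); exists c.
  have [c hc] := choice fc.
  exists (\sum_i Num.sqrt (c i)) => [|i z]; first by rewrite sumr_ge0.
  apply: (@le_trans _ _ (Num.sqrt (c i) * Num.sqrt (V z))).
    rewrite -sqrtrM; last by have [] := hc i.
    rewrite -sqrtr_sqr ler_wsqrtr//; have [_ /(_ z)] := hc i.
    by rewrite ger0_norm ?sqr_ge0.
  by rewrite ler_wpM2r ?sqrtr_ge0// (bigD1 i)//= lerDl sumr_ge0.
have pif i : \int[pi]_z f z i 0 = 0 by rewrite /Rintegral pif0.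
have SgE := Sigma_Delta_autocov V1 erg cf0 mf fW pif stat.
have dataA (A' : 'M[R]_d) :=
  linear_sa_moment_data mV V1 erg cf0 mf fW pif chain start A' theta0.
rewrite -SgE -/SigmaD in dataA.
pose Y n := second_moment Pr (theta n) (theta n).
have sth n : square_integrable_vec Pr (theta n).
  exact: (linear_sa_square_integrable V1 erg cf0 mf fW chain start A theta0 n).
have expE (F : Omega -> R) : Pr.-integrable setT (EFin \o F) ->
    'E_Pr[F]%E = (\int[Pr]_w F w)%:E.
  by move=> iF; rewrite unlock /Rintegral fineK//; exact: integrable_fin_num iF.
have YE n i j : 'E_Pr[fun w => ((theta n w *m (theta n w)^T) i j)%R]%E = (Y n i j)%:E.
  have -> : (fun w => (theta n w *m (theta n w)^T) i j) =
      (fun w => theta n w i 0 * theta n w j 0).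
    by apply/funext => w; rewrite mxE big_ord1 mxE.
  rewrite expE ?mxE//; exact: (square_integrableM (sth n i) (sth n j)).
split.
  move=> hA; have [d0 /(_ SigmaD Y (dataA A)) [Sigma [S0 SE uS [C hC]]]] := hdelta A hA.
  split=> //; exists Sigma; split=> //.
    exists C => n i j n1; rewrite YE -EFinB abse_EFin lee_fin; exact: hC.
  move=> Sgn0.
  have Sn0 : Sigma <> 0.
    move=> S_eq0; apply: Sgn0; move: SE.
    by rewrite /lyapunov_eq S_eq0 mulmx0 mul0mx !add0r.
  have -> : (fun n => 'E_Pr[fun w => sqnorm (theta n w)])%E = (fun n => (\tr (Y n))%:E).
    apply/funext => n.
    have [iS ES] := integrable_sum_fin (index_enum 'I_d) (fun i => (sth n i).2).
    rewrite expE// ES; congr EFin; apply: eq_bigr => i _; rewrite mxE.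
    by apply: eq_Rintegral => w _; rewrite expr2.
  exact: (trace_rate d0 (mxtrace_possemidef_gt0 S0 Sn0) hC).
move=> l rho0 v le lE lhalf vn0 vA Sgv.
have SgP : possemidef SigmaD by exact: possemidef_noise (dataA (- 1%:M)).
have hA0 (l' : R[i]) : eigenvalue (complexify A) l' -> complex.Re l' < - 0.
  by rewrite oppr0; exact: hurwA.
have [b [K [nu [hb K0 nuA]]]] := contracting_normP (lexx 0) hA0.
rewrite mulr0 in hb.
have r0 : 0 < rho0 by rewrite -oppr_lt0 -lE; exact: hurwA.
have r12 : rho0 < 1 / 2 by rewrite -ltrN2 -lE.
have [Ax Ay] := left_eigenvector_re_im vA; rewrite lE in Ax Ay.
have Sxy : SigmaD *m re_mx v <> 0 \/ SigmaD *m im_mx v <> 0.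
  apply/not_andP => -[hx hy]; apply: Sgv; apply/matrixP => i j.
  by rewrite complexify_mulmx hx hy !mxE.
have -> : (fun n => 'E_Pr[fun w => sqmod_pairing v (theta n w)])%E =
    (fun n => (qform (Y n) (re_mx v) + qform (Y n) (im_mx v))%:E).
  apply/funext => n.
  have sx := square_integrable_mulmx (re_mx v)^T (sth n).
  have sy := square_integrable_mulmx (im_mx v)^T (sth n).
  under eq_fun do rewrite sqmod_pairingE.
  rewrite expE; last exact: (integrableD_fin (sx 0).2 (sy 0).2).
  by rewrite (RintegralD measurableT (sx 0).2 (sy 0).2) !qform_second_moment.
exact: (mode_rate nuA K0 hb (dataA A) SgP r0 r12 Ax Ay Sxy).
Qed.
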